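(* Let $(q:E\to M,\ \xi:M\to E,\ \lambda:E\to TE)$ be a pre-differential bundle in the category of smooth manifolds. Then $(q,\xi,\lambda)$ is a differential bundle if and only if the commutative square with top $\lambda:E\to TE$, left $q:E\to M$, right $(p,T(q)):TE\to E\times TM$ and bottom $(\xi,0):M\to E\times TM$ is a pullback in the category of smooth manifolds.
   Context: Conventions. Composition is applicative: $gf$ means first $f$, then $g$. Smooth manifolds are real, finite dimensional, Hausdorff and second countable, and may have different dimensions on different connected components. $T$ is the tangent bundle functor, $p:TM\to M$ the projection, $0:M\to TM$ the zero section, $+_p$ the fibrewise addition of tangent vectors, and $\ell:TM\to T^2M$ the lift, given in local coordinates by $\ell(x,v)=(x,0,0,v)$ (where for a point $(x,v,w,z)$ of $T^2M$ one has $p(x,v,w,z)=(x,v)$ and $T(p)(x,v,w,z)=(x,w)$). A $T$-limit (e.g. $T$-pullback) is a limit diagram preserved by $T^n$ for every $n\geq 0$. For $q:E\to M$, $E_n$ is the $n$-fold fibre product of $E$ over $M$, with projections $\pi_i$. An additive bundle is a commutative monoid $(q:E\to M,\ +_q:E_2\to E,\ \xi:M\to E)$ in the slice category over $M$. A morphism of additive bundles is a commutative square $(f_1,f_0)$ from $q$ to $q'$ with $f_1(a+_qb)=f_1a+_{q'}f_1b$ and $f_1\xi=\xi'f_0$. If $q$ is an additive bundle whose fibre powers are $T$-limits, $T(q)$ is an additive bundle with addition $+_{T(q)}=T(+_q)$ and zero $T(\xi)$. A pre-differential bundle is a triple $(q:E\to M,\ \xi:M\to E,\ \lambda:E\to TE)$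 with $q\xi=\mathrm{id}$, $\ell\lambda=T(\lambda)\lambda$, $p\lambda=\xi q$ and $\lambda\xi=0\xi$. A pre-differential bundle $(q,\xi,\lambda)$ is a differential bundle if the $n$-fold fibre powers of $q$ exist and are $T$-limits and there is an addition $+_q:E_2\to E$ such that: $(q,+_q,\xi)$ is an additive bundle; $(\lambda,0):(E,q)\to(TE,T(q))$ and $(\lambda,\xi):(E,q)\to(TE,p)$ are additive bundle morphisms; and the square with top $\lambda\pi_0+_{T(q)}0\pi_1:E_2\to TE$, left $q\pi_0=q\pi_1:E_2\to M$, right $T(q):TE\to TM$, bottom $0:M\to TM$ is a $T$-pullback. *)

(* Defs.v *)
From HB Require Import structures.
From mathcomp Require Import all_boot all_order all_algebra.
From mathcomp Require Import all_classical reals.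
From mathcomp Require Import topology normedtype landau derive.
Import Order.TTheory GRing.Theory Num.Theory.
Import numFieldNormedType.Exports.

(* Smooth manifolds over an arbitrary [R : realType], their tangent functor, and
   differential bundles in the category of smooth manifolds. *)

Set Implicit Arguments.
Unset Strict Implicit.
Unset Printing Implicit Defensive.

Local Open Scope classical_set_scope.
Local Open Scope ring_scope.

(* [f] is C^k on the open set [U]: differentiable with all directional
   derivatives C^(k-1). Only meant for finite-dimensional [V]. *)
Fixpoint Ck (R : realType) (V W : normedModType R) (k : nat) (U : set V)
    (f : V -> W) : Prop :=
  if k is k'.+1 then
    (forall x, U x -> differentiable f x) /\
    (forall v, Ck k' U (fun x => 'd f x v))
  else forall x, U x -> {for x, continuous f}.

Definition smooth_on (R : realType) (V W : normedModType R) (U : set V)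
    (f : V -> W) : Prop := forall k, Ck k U f.

Section Calculus.
Variable R : realType.
Implicit Types V W Z : normedModType R.

Lemma near_diff V W (f g : V -> W) x : (\near x, f x = g x) ->
  differentiable f x -> is_diff x g ('d f x).
Proof.
move=> fg df.
have zc : (cst 0 : V -> W) = ('d (cst 0 : V -> W) x) by rewrite diff_cst.
have z0 : (g - f) \o shift x = cst ((g - f) x) + 'd (cst 0 : V -> W) x +o_ 0 id.
  apply/eqaddoP => e e0; rewrite -zc.
  have := fg; rewrite (near_shift 0) subr0 => fg0; near=> y.
  have E : f (y + x) = g (y + x).
    by near: y; exact: fg0.
  rewrite !fctE /= (nbhs_singleton fg) E !subrr addr0 subrr normr0.
  by apply: mulr_ge0 => //; exact: ltW.
have c0 : continuous ('d (cst 0 : V -> W) x).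
  by rewrite -zc => y; exact: cvg_cst.
have d0 := diff_unique c0 z0.
have dd : is_diff x (g - f) 0.
  split; last by rewrite d0 -zc.
  by apply/diff_locallyP; rewrite d0.
have df' := differentiableP df.
have fgE : f + (g - f) = g by rewrite addrC subrK.
have := @is_diffD _ _ _ f (g - f) _ 0 x df' dd.
by rewrite addr0 fgE.
Unshelve. all: by end_near. Qed.

Lemma Ck_ext V W k (U : set V) (f g : V -> W) : open U ->
  (forall x, U x -> f x = g x) -> Ck k U f -> Ck k U g.
Proof.
move=> oU; have nU x : U x -> nbhs x U by move=> Ux; exact: open_nbhs_nbhs.
elim: k f g => [|k IH] f g fg /=.
  move=> cf x Ux; rewrite /prop_for /continuous_at -(fg x Ux).
  apply: cvg_trans (cf x Ux); apply: near_eq_cvg.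
  by near=> y; rewrite fg//; near: y; exact: nU.
move=> [df Cf]; have D x : U x -> is_diff x g ('d f x).
  move=> Ux; apply: near_diff (df x Ux).
  by near=> y; rewrite fg//; near: y; exact: nU.
split=> [x Ux|v]; first by have [] := D x Ux.
have E x : U x -> 'd f x v = 'd g x v.
  by move=> /D[_ ->].
exact: IH E (Cf v).
Unshelve. all: by end_near. Qed.

Lemma Ck_sub V W k (U U' : set V) (f : V -> W) :
  U' `<=` U -> Ck k U f -> Ck k U' f.
Proof.
move=> sU; elim: k f => [|k IH] f /=; first by move=> h x /sU; exact: h.
by move=> [df Cf]; split=> [x /sU|v]; [exact: df|exact: IH].
Qed.

Lemma Ck_glue V W k (U : set V) (f : V -> W) :
  (forall x, U x -> exists2 B, B x & Ck k B f) -> Ck k U f.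
Proof.
elim: k f => [|k IH] f /= h; first by move=> x /h[B Bx]; apply.
split=> [x /h[B Bx []]|v]; first by move=> + _; exact.
by apply: IH => x /h[B Bx [_]]; exists B.
Qed.

Lemma CkW V W k (U : set V) (f : V -> W) : Ck k.+1 U f -> Ck k U f.
Proof.
elim: k f => [|k IH] f; first by move=> [df _] x /df; exact: differentiable_continuous.
by move=> [df Cf]; split => // v; exact: IH.
Qed.

Lemma Ck_cst V W k (U : set V) (a : W) : Ck k U (cst a).
Proof.
elim: k a => [|k IH] a; first by move=> x _; exact: cvg_cst.
split=> [x _|v]; first exact: differentiable_cst.
rewrite (_ : (fun x => _) = cst 0)//.
by apply/funext => x; rewrite diff_cst.
Qed.

Lemma Ck_lin V W Z k (U : set V) (f : V -> W) (L : {linear W -> Z}) :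
  open U -> continuous L -> Ck k U f -> Ck k U (L \o f).
Proof.
move=> oU cL; elim: k f => [|k IH] f /=.
  move=> cf x Ux; apply: continuous_comp; [exact: cf|exact: cL].
move=> [df Cf]; split=> [x Ux|v].
  by apply: differentiable_comp; [exact: df|exact: linear_differentiable].
apply: (Ck_ext oU _ (IH _ (Cf v))) => x Ux /=.
by rewrite (diff_comp (df _ Ux) (linear_differentiable _ cL)) /= diff_lin.
Qed.

Lemma Ck_linear V W k (U : set V) (L : {linear V -> W}) :
  continuous L -> Ck k U L.
Proof.
case: k => [|k] cL; first by move=> x _; exact: cL.
split=> [x _|v]; first exact: linear_differentiable.
rewrite (_ : (fun x => _) = cst (L v)); first exact: Ck_cst.
by apply/funext => x; rewrite diff_lin.
Qed.

Lemma Ck_add V W k (U : set V) (f g : V -> W) :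
  open U -> Ck k U f -> Ck k U g -> Ck k U (fun x => f x + g x).
Proof.
move=> oU; elim: k f g => [|k IH] f g /=.
  by move=> cf cg x Ux; apply: (@cvgD _ W); [exact: cf|exact: cg].
move=> [df Cf] [dg Cg]; split=> [x Ux|v].
  by apply: (@differentiableD _ _ _ f g); [exact: df|exact: dg].
apply: (Ck_ext oU _ (IH _ _ (Cf v) (Cg v))) => x Ux /=.
by rewrite (@diffD _ _ _ f g)//; [exact: df|exact: dg].
Qed.

Lemma Ck_sum V W k (U : set V) n (f : 'I_n -> V -> W) :
  open U -> (forall i, Ck k U (f i)) -> Ck k U (fun x => \sum_i f i x).
Proof.
move=> oU h; suff H (s : seq 'I_n) : Ck k U (fun x => \sum_(i <- s) f i x).
  exact: H.
elim: s => [|i s IH].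
  rewrite (_ : (fun x => _) = cst 0); first exact: Ck_cst.
  by apply/funext => x; rewrite big_nil.
rewrite (_ : (fun x => _) = fun x => f i x + \sum_(i <- s) f i x).
  exact: Ck_add.
by apply/funext => x; rewrite big_cons.
Qed.

Lemma Ck_mul V k (U : set V) (f g : V -> R) :
  open U -> Ck k U f -> Ck k U g -> Ck k U (fun x => f x * g x).
Proof.
move=> oU; elim: k f g => [|k IH] f g.
  by move=> /= cf cg x Ux; apply: cvgM; [exact: cf|exact: cg].
move=> Hf Hg; have := CkW Hf; have := CkW Hg; case: Hf Hg => [df Cf] [dg Cg].
move=> Cg' Cf'; split=> [x Ux|v].
  by apply: (@differentiableM _ _ f g); [exact: df|exact: dg].
apply: (Ck_ext oU _ (Ck_add oU (IH _ _ Cf' (Cg v)) (IH _ _ Cg' (Cf v)))) => x Ux.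
by rewrite (@diffM _ _ f g)//; [exact: df|exact: dg].
Qed.

Lemma coord_linear m n (i : 'I_m) (j : 'I_n) :
  linear (fun M : 'M[R]_(m, n) => M i j : R^o).
Proof. by move=> a u v; rewrite !mxE. Qed.

Definition coordL n (j : 'I_n) : {linear 'rV[R]_n -> R} :=
  HB.pack (fun M : 'rV[R]_n => M 0 j)
    (GRing.isLinear.Build _ _ _ _ _ (coord_linear (m:=1) (n:=n) 0 j)).

Lemma Ck_coord V k (U : set V) n (f : V -> 'rV[R]_n) j :
  open U -> Ck k U f -> Ck k U (fun x => f x 0 j).
Proof.
move=> oU Cf; rewrite (_ : (fun _ => _) = coordL j \o f)//.
apply: Ck_lin => //; exact: coord_continuous.
Qed.

Lemma scale_linear V (w : V) : linear (fun a : R^o => a *: w).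
Proof. by move=> a u v; rewrite scalerDl scalerA. Qed.

Definition scaleL V (w : V) : {linear R -> V} :=
  HB.pack (fun a : R => a *: w)
    (GRing.isLinear.Build _ _ _ _ _ (scale_linear w)).

Lemma Ck_mx V k (U : set V) n (f : V -> 'rV[R]_n) :
  open U -> (forall j, Ck k U (fun x => f x 0 j)) -> Ck k U f.
Proof.
move=> oU Cf; rewrite (_ : f = fun x => \sum_j f x 0 j *: delta_mx 0 j); last first.
  by apply/funext => x; exact: row_sum_delta.
apply: Ck_sum => // j.
apply: (@Ck_lin _ _ _ k U (fun x => f x 0 j) (scaleL (delta_mx 0 j))) => //.
exact: scalel_continuous.
Qed.

Lemma linear_rV_continuous n W (L : {linear 'rV[R]_n -> W}) : continuous L.
Proof.
rewrite (_ : (L : _ -> _) = fun x => \sum_j x 0 j *: L (delta_mx 0 j)); last first.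
  apply/funext => x; rewrite {1}(row_sum_delta x) linear_sum.
  by apply: eq_bigr => j _; rewrite linearZ.
suff : Ck 0 setT (fun x : 'rV_n => \sum_j x 0 j *: L (delta_mx 0 j)).
  by move=> h x; exact: h.
apply: Ck_sum => [|j]; first exact: openT.
apply: (@Ck_lin _ _ _ 0 setT (fun x : 'rV_n => x 0 j) (scaleL (L (delta_mx 0 j)))).
- exact: openT.
- exact: scalel_continuous.
- by move=> x _; exact: coord_continuous.
Qed.

Lemma diff_rV n W (g : 'rV[R]_n -> W) x v :
  'd g x v = \sum_j v 0 j *: 'd g x (delta_mx 0 j).
Proof.
rewrite {1}(row_sum_delta v) linear_sum.
by apply: eq_bigr => j _; rewrite linearZ.
Qed.

Lemma Ck_comp V k (U : set V) n m (U' : set 'rV[R]_n) (f : V -> 'rV[R]_n)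
    (g : 'rV[R]_n -> 'rV[R]_m) : open U -> open U' ->
  (forall x, U x -> U' (f x)) -> Ck k U f -> Ck k U' g -> Ck k U (g \o f).
Proof.
move=> oU oU' UU'; elim: k g => [|k IH] g.
  by move=> cf cg x Ux; apply: continuous_comp; [exact: cf|exact: cg (UU' _ Ux)].
move=> Hf [dg Cg]; have Cf' := CkW Hf; case: Hf => df Cf.
split=> [x Ux|v].
  by apply: differentiable_comp; [exact: df|exact: dg (UU' _ Ux)].
have E i x : U x -> \sum_j ('d f x v) 0 j *
    ('d g (f x) (delta_mx 0 j) 0 i) = 'd (g \o f) x v 0 i.
  move=> Ux; rewrite (diff_comp (df _ Ux) (dg _ (UU' _ Ux))) /=.
  by rewrite [in RHS]diff_rV summxE; apply: eq_bigr => j _; rewrite mxE.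
apply: Ck_mx => // i; apply: (Ck_ext oU (E i)).
apply: Ck_sum => // j; apply: (Ck_mul oU).
  exact: Ck_coord oU (Cf v).
apply: (Ck_coord _ oU).
exact: (IH (fun y => 'd g y (delta_mx 0 j)) Cf' (Cg _)).
Qed.

End Calculus.

Section Calculus2.
Variable R : realType.
Implicit Types V W Z : normedModType R.

Lemma smooth_ext V W (U : set V) (f g : V -> W) : open U ->
  (forall x, U x -> f x = g x) -> smooth_on U f -> smooth_on U g.
Proof. by move=> oU fg h k; exact: Ck_ext oU fg (h k). Qed.

Lemma smooth_sub V W (U U' : set V) (f : V -> W) :
  U' `<=` U -> smooth_on U f -> smooth_on U' f.
Proof. by move=> s h k; exact: Ck_sub s (h k). Qed.

Lemma smooth_glue V W (U : set V) (f : V -> W) :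
  (forall x, U x -> exists2 B, B x & smooth_on B f) -> smooth_on U f.
Proof. by move=> h k; apply: Ck_glue => x /h[B Bx Cf]; exists B. Qed.

Lemma smooth_on_comp V (U : set V) n m (U' : set 'rV[R]_n) (f : V -> 'rV[R]_n)
    (g : 'rV[R]_n -> 'rV[R]_m) : open U -> open U' ->
  (forall x, U x -> U' (f x)) -> smooth_on U f -> smooth_on U' g ->
  smooth_on U (g \o f).
Proof. by move=> oU oU' s hf hg k; exact: Ck_comp oU oU' s (hf k) (hg k). Qed.

Lemma smooth_linear V n (U : set 'rV[R]_n) (L : {linear 'rV[R]_n -> V}) :
  smooth_on U L.
Proof. by move=> k; apply: Ck_linear; exact: linear_rV_continuous. Qed.

Lemma smooth_cst V W (U : set V) (a : W) : smooth_on U (cst a).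
Proof. by move=> k; exact: Ck_cst. Qed.

Lemma smooth_diffble V W (U : set V) (f : V -> W) x :
  smooth_on U f -> U x -> differentiable f x.
Proof. by move=> /(_ 1)[] + _; exact. Qed.

Lemma smooth_cont V W (U : set V) (f : V -> W) x :
  smooth_on U f -> U x -> {for x, continuous f}.
Proof. by move=> /(_ 0); exact. Qed.

Lemma row_mxE n m (u : 'rV[R]_n) (v : 'rV[R]_m) :
  row_mx u v = mulmxr (row_mx 1%:M 0) u + mulmxr (row_mx 0 1%:M) v.
Proof.
by rewrite /= !mul_mx_row !mulmx1 !mulmx0 add_row_mx addr0 add0r.
Qed.

Lemma row_mx_cont (X : topologicalType) n m (f : X -> 'rV[R]_n)
    (g : X -> 'rV[R]_m) x : {for x, continuous f} -> {for x, continuous g} ->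
  {for x, continuous (fun x => row_mx (f x) (g x))}.
Proof.
move=> cf cg; pose LA : {linear 'rV[R]_n -> 'rV[R]_(n + m)} := mulmxr (row_mx 1%:M 0).
pose LB : {linear 'rV[R]_m -> 'rV[R]_(n + m)} := mulmxr (row_mx 0 1%:M).
rewrite (_ : (fun x => _) = fun x => LA (f x) + LB (g x)); last first.
  by apply/funext => y; exact: row_mxE.
have cA := continuous_comp cf (linear_rV_continuous (L := LA) (x := _)).
have cB := continuous_comp cg (linear_rV_continuous (L := LB) (x := _)).
exact: (@cvgD _ 'rV[R]_(n + m) _ _ _ (LA \o f) (LB \o g) _ _ cA cB).
Qed.

Lemma smooth_row_mx V (U : set V) n m (f : V -> 'rV[R]_n)
    (g : V -> 'rV[R]_m) : open U -> smooth_on U f -> smooth_on U g ->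
  smooth_on U (fun x => row_mx (f x) (g x)).
Proof.
move=> oU cf cg k; under eq_fun do rewrite row_mxE.
by apply: (Ck_add oU); apply: (Ck_lin oU) => //; exact: linear_rV_continuous.
Qed.

Lemma smooth_lsubmx n m (U : set 'rV[R]_(n + m)) : smooth_on U lsubmx.
Proof. exact: smooth_linear. Qed.

Lemma smooth_rsubmx n m (U : set 'rV[R]_(n + m)) : smooth_on U rsubmx.
Proof. exact: smooth_linear. Qed.

Lemma open_lsubmx n m (U : set 'rV[R]_n) : open U ->
  open [set z : 'rV[R]_(n + m) | U (lsubmx z)].
Proof. by move=> oU; apply: open_comp oU => z _; exact: continuous_lsubmx. Qed.

Lemma open_rsubmx n m (U : set 'rV[R]_m) : open U ->
  open [set z : 'rV[R]_(n + m) | U (rsubmx z)].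
Proof. by move=> oU; apply: open_comp oU => z _; exact: continuous_rsubmx. Qed.

Lemma smooth_tangent n m (U : set 'rV[R]_n) (f : 'rV[R]_n -> 'rV[R]_m) :
  open U -> smooth_on U f ->
  smooth_on [set z : 'rV[R]_(n + n) | U (lsubmx z)]
    (fun z => 'd f (lsubmx z) (rsubmx z)).
Proof.
move=> oU sf k; have oT := open_lsubmx (m := n) oU.
apply: (Ck_mx oT) => i.
apply: (@Ck_ext _ _ _ _ _ (fun z => \sum_j rsubmx z 0 j *
  'd f (lsubmx z) (delta_mx 0 j) 0 i) _ oT).
  by move=> x _; rewrite diff_rV summxE; apply: eq_bigr => j _; rewrite [RHS]mxE.
apply: (Ck_sum oT) => j; apply: (Ck_mul oT).
  exact: Ck_coord oT (smooth_rsubmx _ _).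
apply: (Ck_coord _ oT); have [_ /(_ (delta_mx 0 j)) sd] := sf k.+1.
exact: (Ck_comp oT oU _ (smooth_lsubmx _ k) sd).
Qed.

End Calculus2.

(* [chart_fwd] and [chart_bwd] are total functions, but only their restrictions
   to [chart_dom] and [chart_cod], where they are mutually inverse
   homeomorphisms, matter. The dimension may vary from chart to chart. *)
Record local_chart (R : realType) (X : topologicalType) := LocalChart {
  chart_dim : nat;
  chart_dom : set X;
  chart_cod : set 'rV[R]_chart_dim;
  chart_fwd : X -> 'rV[R]_chart_dim;
  chart_bwd : 'rV[R]_chart_dim -> X;
  chart_dom_open : open chart_dom;
  chart_cod_open : open chart_cod;
  chart_fwd_cod : forall x, chart_dom x -> chart_cod (chart_fwd x);
  chart_bwd_dom : forall z, chart_cod z -> chart_dom (chart_bwd z);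
  chart_fwdK : forall x, chart_dom x -> chart_bwd (chart_fwd x) = x;
  chart_bwdK : forall z, chart_cod z -> chart_fwd (chart_bwd z) = z;
  chart_fwd_continuous : forall x, chart_dom x -> {for x, continuous chart_fwd};
  chart_bwd_continuous : forall z, chart_cod z -> {for z, continuous chart_bwd}
}.

Arguments chart_cod {R X} _ _.
Arguments chart_cod_open {R X} _ _ _.
Arguments chart_dom_open {R X} _.
Arguments chart_bwd {R X} _ _.

(* The local representative of [f] in the charts [c] and [d], meaningful on the
   set [chart_rep_dom c d f]. *)
Definition chart_rep (R : realType) (X Y : topologicalType)
    (c : local_chart R X) (d : local_chart R Y) (f : X -> Y) :
    'rV[R]_(chart_dim c) -> 'rV[R]_(chart_dim d) :=
  fun z => chart_fwd d (f (chart_bwd c z)).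

Definition chart_rep_dom (R : realType) (X Y : topologicalType)
    (c : local_chart R X) (d : local_chart R Y) (f : X -> Y) :
    set 'rV[R]_(chart_dim c) :=
  [set z | chart_cod c z /\ chart_dom d (f (chart_bwd c z))].

Arguments chart_rep {R X Y} c d f _.
Arguments chart_rep_dom {R X Y} c d f _.

(* The atlas is indexed and need not be maximal. That it covers the carrier is
   expressed by a choice [chart_at] of a chart around each point; this choice is
   used to represent tangent vectors, and is not seen by smooth maps. *)
Record manifold (R : realType) := Manifold {
  carrier :> topologicalType;
  atlas_index : Type;
  atlas : atlas_index -> local_chart R carrier;
  chart_at : carrier -> atlas_index;
  chart_at_dom : forall x, chart_dom (atlas (chart_at x)) x;
  atlas_smooth : forall i j, smooth_on (chart_rep_dom (atlas i) (atlas j) id)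
    (chart_rep (atlas i) (atlas j) id);
  manifold_hausdorff : hausdorff_space carrier;
  manifold_second_countable : @second_countable carrier
}.

Arguments atlas {R} _ _.
Arguments chart_at {R} _ _.

Definition smooth (R : realType) (M N : manifold R) (f : M -> N) : Prop :=
  continuous f /\
  forall i j, smooth_on (chart_rep_dom (atlas M i) (atlas N j) f)
    (chart_rep (atlas M i) (atlas N j) f).

Record smooth_map (R : realType) (M N : manifold R) := SmoothMap {
  smooth_fun :> M -> N;
  smooth_funP : smooth smooth_fun
}.

Section Charts.
Variable R : realType.

Lemma chart_rep_open (X Y : topologicalType) (c : local_chart R X)
    (d : local_chart R Y) (f : X -> Y) :
  (forall x, chart_dom c x -> {for x, continuous f}) ->
  open (chart_rep_dom c d f).
Proof.
move=> cf; rewrite openE => z [cz dz].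
suff : nbhs z (chart_cod c `&` (f \o chart_bwd c) @^-1` chart_dom d) by [].
apply: filterI; first exact: (open_nbhs_nbhs (conj (chart_cod_open c) cz)).
have cb := chart_bwd_continuous cz.
have cfz := cf _ (chart_bwd_dom cz).
exact: (continuous_comp cb cfz) (open_nbhs_nbhs (conj (chart_dom_open d) dz)).
Qed.

Lemma chart_repK (X Y Z : topologicalType) (c : local_chart R X)
    (d : local_chart R Y) (e : local_chart R Z) (f : X -> Y) (g : Y -> Z) z :
  chart_rep_dom c d f z ->
  chart_rep d e g (chart_rep c d f z) = chart_rep c e (g \o f) z.
Proof. by move=> [_ dz]; rewrite /chart_rep chart_fwdK. Qed.

Lemma diff_chart_comp (X Y Z : topologicalType) (c : local_chart R X)
    (d : local_chart R Y) (e : local_chart R Z) (f : X -> Y) (g : Y -> Z) x v :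
  open (chart_rep_dom c d f) ->
  smooth_on (chart_rep_dom c d f) (chart_rep c d f) ->
  smooth_on (chart_rep_dom d e g) (chart_rep d e g) ->
  chart_dom c x -> chart_dom d (f x) -> chart_dom e (g (f x)) ->
  'd (chart_rep d e g) (chart_fwd d (f x)) ('d (chart_rep c d f) (chart_fwd c x) v)
  = 'd (chart_rep c e (g \o f)) (chart_fwd c x) v.
Proof.
move=> o1 s1 s2 cx dfx egx.
have r1 : chart_rep_dom c d f (chart_fwd c x).
  by split; [exact: chart_fwd_cod|rewrite chart_fwdK].
have r2 : chart_rep_dom d e g (chart_fwd d (f x)).
  by split; [exact: chart_fwd_cod|rewrite chart_fwdK].
have d1 := smooth_diffble s1 r1.
have d2 := smooth_diffble s2 r2.
have E : chart_rep c d f (chart_fwd c x) = chart_fwd d (f x).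
  by rewrite /chart_rep chart_fwdK.
rewrite -E in d2 *.
have dc := differentiable_comp d1 d2.
have nE : \forall z \near chart_fwd c x, (chart_rep d e g \o chart_rep c d f) z
    = chart_rep c e (g \o f) z.
  apply: filterS (open_nbhs_nbhs (conj o1 r1)) => z rz /=.
  exact: chart_repK.
have [_ ->] := near_diff nE dc.
by rewrite (diff_comp d1 d2).
Qed.

Lemma diff_chart_id (X : topologicalType) (c : local_chart R X) x v :
  chart_dom c x -> 'd (chart_rep c c id) (chart_fwd c x) v = v.
Proof.
move=> cx.
have nE : \forall z \near chart_fwd c x, id z = chart_rep c c id z.
  apply: filterS (open_nbhs_nbhs (conj (chart_cod_open c) (chart_fwd_cod cx))) => z cz.
  by rewrite /chart_rep chart_bwdK.
have idd : is_diff (chart_fwd c x) id id := is_diff_id _.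
have [_ ->] := near_diff nE (@ex_diff _ _ _ _ _ _ _ idd).
by rewrite (@diff_val _ _ _ _ _ _ _ idd).
Qed.

Lemma continuous_for_id (X : topologicalType) (x : X) : {for x, continuous id}.
Proof. by []. Qed.

Lemma hausdorff_map (X Y : topologicalType) (f : X -> Y) p q :
  hausdorff_space Y -> {for p, continuous f} -> {for q, continuous f} ->
  cluster (nbhs p) q -> f p = f q.
Proof.
move=> hY cp cq pq; apply: hY => A B nA nB.
by have [z [Az Bz]] := pq _ _ (cp _ nA) (cq _ nB); exists (f z).
Qed.

Variables M N P : manifold R.

Lemma smooth_intro (f : M -> N) :
  (forall x, exists i j A, [/\ open A, chart_dom (atlas M i) x,
     A (chart_fwd (atlas M i) x), A `<=` chart_rep_dom (atlas M i) (atlas N j) f &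
     smooth_on A (chart_rep (atlas M i) (atlas N j) f)]) -> smooth f.
Proof.
move=> H; have cf : continuous f.
  move=> x; have [i [j [A [oA ix Ax sA sf]]]] := H x.
  set c := atlas M i in ix Ax sA sf *; set d := atlas N j in sA sf *.
  have c1 := chart_fwd_continuous ix.
  have c2 := smooth_cont sf Ax.
  have [cz dz] := sA _ Ax.
  have c3 : {for chart_rep c d f (chart_fwd c x), continuous (chart_bwd d)}.
    apply: chart_bwd_continuous; exact: chart_fwd_cod.
  have := continuous_comp c1 (continuous_comp c2 c3).
  have E0 : ((chart_bwd d \o chart_rep c d f) \o chart_fwd c) x = f x.
    by move: dz; rewrite /= /chart_rep (chart_fwdK ix) => /chart_fwdK.
  rewrite /prop_for /continuous_at E0.
  apply: cvg_trans; apply: near_eq_cvg.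
  have nx : nbhs x (chart_dom c `&` chart_fwd c @^-1` A).
    apply: filterI; first exact: (open_nbhs_nbhs (conj (chart_dom_open c) ix)).
    exact: (c1 _ (open_nbhs_nbhs (conj oA Ax))).
  apply: filterS nx => y [cy Ay] /=.
  have [_] := sA _ Ay.
  by rewrite /= /chart_rep (chart_fwdK cy) => /chart_fwdK.
split=> // i' j'; apply: smooth_glue => z [iz jz].
have [i [j [A [oA ix Ax sA sf]]]] := H (chart_bwd (atlas M i') z).
set x := chart_bwd _ z in jz ix Ax.
pose c := atlas M i; pose d := atlas N j.
pose c' := atlas M i'; pose d' := atlas N j'.
pose B := chart_rep_dom c' c id `&` chart_rep c' c id @^-1` A `&` chart_rep_dom c' d' f.
have oI : open (chart_rep_dom c' c id).
  by apply: chart_rep_open => ? _; exact: continuous_for_id.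
have sI : smooth_on (chart_rep_dom c' c id) (chart_rep c' c id) := @atlas_smooth _ M _ _.
have oJ : open (chart_rep_dom d d' id).
  by apply: chart_rep_open => ? _; exact: continuous_for_id.
have sJ : smooth_on (chart_rep_dom d d' id) (chart_rep d d' id) := @atlas_smooth _ N _ _.
have oB : open B.
  apply: openI; last by apply: chart_rep_open => ? _; exact: cf.
  rewrite openE => y [ry Ay]; apply: filterI.
    exact: (open_nbhs_nbhs (conj oI ry)).
  exact: (smooth_cont sI ry (open_nbhs_nbhs (conj oA Ay))).
exists B => //.
have BE y : B y -> chart_rep c d f (chart_rep c' c id y) = chart_rep c' d f y.
  by move=> [[ry _] _]; exact: chart_repK.
have BE' y : B y -> chart_dom d (f (chart_bwd c' y)).
  by move=> [[[_ ry] /sA[_]]] + _; rewrite /chart_rep chart_fwdK.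
have s1 : smooth_on B (chart_rep c d f \o chart_rep c' c id).
  apply: (smooth_on_comp oB oA _ (smooth_sub _ sI) sf); first by move=> y [[]].
  by move=> y [[]].
have s2 : smooth_on B (chart_rep d d' id \o (chart_rep c d f \o chart_rep c' c id)).
  apply: (smooth_on_comp oB oJ _ s1 sJ) => y By; rewrite /= BE//.
  have dy := BE' _ By; split; first exact: chart_fwd_cod.
  by rewrite /chart_rep chart_fwdK//; case: By => _ [].
apply: smooth_ext oB _ s2 => y By; rewrite /= BE// /chart_rep chart_fwdK//.
exact: BE'.
Qed.

End Charts.

(* A tangent vector at [x] is represented by its coordinates in the preferred
   chart at [x]; its coordinates in another chart around [x] are obtained by
   applying the differential of the transition map, see [tangent_coord]. *)
Notation tangent_space x := 'rV_(chart_dim (atlas _ (chart_at _ x))).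

Record tangent_vector (R : realType) (M : manifold R) := TangentVector {
  tangent_base : M;
  tangent_vec : 'rV[R]_(chart_dim (atlas M (chart_at M tangent_base)))
}.

Section TangentManifold.
Variables (R : realType) (M : manifold R).
Local Notation TM := (tangent_vector M).
Local Notation chart_of x := (atlas M (chart_at M x)).

Definition tangent_coord (i : atlas_index M) (t : TM) :
    'rV[R]_(chart_dim (atlas M i)) :=
  'd (chart_rep (chart_of (tangent_base t)) (atlas M i) id)
    (chart_fwd (chart_of (tangent_base t)) (tangent_base t)) (tangent_vec t).

Definition tangent_fwd (i : atlas_index M) (t : TM) :
    'rV[R]_(chart_dim (atlas M i) + chart_dim (atlas M i)) :=
  row_mx (chart_fwd (atlas M i) (tangent_base t)) (tangent_coord i t).

Definition tangent_bwd (i : atlas_index M)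
    (z : 'rV[R]_(chart_dim (atlas M i) + chart_dim (atlas M i))) : TM :=
  let x := chart_bwd (atlas M i) (lsubmx z) in
  TangentVector (tangent_base := x)
    ('d (chart_rep (atlas M i) (chart_of x) id) (lsubmx z) (rsubmx z)).

Definition tangent_cod (i : atlas_index M) :
    set 'rV[R]_(chart_dim (atlas M i) + chart_dim (atlas M i)) :=
  [set z | chart_cod (atlas M i) (lsubmx z)].

Arguments tangent_cod : clear implicits.
Arguments tangent_bwd : clear implicits.

Definition tangent_dom (i : atlas_index M) : set TM :=
  [set t | chart_dom (atlas M i) (tangent_base t)].

Lemma trans_open i j : open (chart_rep_dom (atlas M i) (atlas M j) id).
Proof. by apply: chart_rep_open => ? _; exact: continuous_for_id. Qed.

Lemma tangent_cod_open i : open (tangent_cod i).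
Proof. exact: open_lsubmx (chart_cod_open _). Qed.

(* the topology making all the maps [tangent_bwd i] open embeddings *)
Definition tangent_open : set_system TM :=
  [set W | forall i, open (tangent_cod i `&` tangent_bwd i @^-1` W)].

HB.instance Definition _ := gen_eqMixin TM.
HB.instance Definition _ := gen_choiceMixin TM.

Lemma tangent_openT : tangent_open setT.
Proof. by move=> i; rewrite preimage_setT setIT; exact: tangent_cod_open. Qed.

Lemma tangent_openI : setI_closed tangent_open.
Proof.
by move=> A B oA oB i; rewrite preimage_setI -(setIid (tangent_cod i)) setIACA;
  exact: openI.
Qed.

Lemma tangent_open_bigU (I : Type) (f : I -> set TM) :
  (forall i, tangent_open (f i)) -> tangent_open (\bigcup_i f i).
Proof.
by move=> of_ i; rewrite preimage_bigcup setI_bigcupr; apply: bigcup_open => j _;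
  exact: of_.
Qed.

HB.instance Definition _ :=
  isOpenTopological.Build TM tangent_openT tangent_openI tangent_open_bigU.

Lemma tangent_openE (W : set TM) : open W =
  forall i, open (tangent_cod i `&` tangent_bwd i @^-1` W).
Proof. by []. Qed.

Lemma tangent_coord_trans i j (t : TM) : tangent_dom i t -> tangent_dom j t ->
  'd (chart_rep (atlas M i) (atlas M j) id)
    (chart_fwd (atlas M i) (tangent_base t)) (tangent_coord i t) =
  tangent_coord j t.
Proof.
move=> it jt; rewrite /tangent_coord.
apply: (diff_chart_comp (f := id) (g := id)) => //; first exact: trans_open.
- exact: atlas_smooth.
- exact: atlas_smooth.
- exact: chart_at_dom.
Qed.

Lemma tangent_coord_bwd i z : tangent_cod i z ->
  tangent_coord i (tangent_bwd _ z) = rsubmx z.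
Proof.
move=> iz; rewrite /tangent_coord /=.
have ix := chart_bwd_dom iz; have xE := chart_bwdK iz.
move: (rsubmx z) => v; move: xE ix; set x := chart_bwd _ _ => + ix.
clearbody x; move=> <-.
rewrite (diff_chart_comp (f := id) (g := id)) => //; first exact: diff_chart_id.
- exact: trans_open.
- exact: atlas_smooth.
- exact: atlas_smooth.
- exact: chart_at_dom.
Qed.

Lemma tangent_vec_coord (x : M) (v : tangent_space x) :
  tangent_coord (chart_at M x) (TangentVector v) = v.
Proof. by rewrite /tangent_coord diff_chart_id//; exact: chart_at_dom. Qed.

Lemma tangent_inj i (t u : TM) : tangent_dom i t ->
  tangent_base t = tangent_base u -> tangent_coord i t = tangent_coord i u ->
  t = u.
Proof.
case: t u => [x v] [y w] /= ix xy; case: _ / xy in w *.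
move=> /(congr1 ('d (chart_rep (atlas M i) (chart_of x) id)
    (chart_fwd (atlas M i) x))).
have cx := chart_at_dom x.
have := @tangent_coord_trans i (chart_at M x) (TangentVector v) ix cx.
have := @tangent_coord_trans i (chart_at M x) (TangentVector w) ix cx.
by rewrite !tangent_vec_coord /= => -> -> ->.
Qed.

Lemma tangent_fwd_cod i t : tangent_dom i t -> tangent_cod i (tangent_fwd i t).
Proof. by move=> it; rewrite /tangent_cod /= row_mxKl; exact: chart_fwd_cod. Qed.

Lemma tangent_bwd_dom i z : tangent_cod i z -> tangent_dom i (tangent_bwd _ z).
Proof. exact: chart_bwd_dom. Qed.

Lemma tangent_bwdK i z : tangent_cod i z -> tangent_fwd i (tangent_bwd _ z) = z.
Proof.
by move=> iz; rewrite /tangent_fwd tangent_coord_bwd//= chart_bwdK// hsubmxK.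
Qed.

Lemma tangent_fwdK i t : tangent_dom i t -> tangent_bwd i (tangent_fwd i t) = t.
Proof.
move=> it; have ic := tangent_fwd_cod it.
apply: (@tangent_inj i); first exact: tangent_bwd_dom.
  by rewrite /= row_mxKl chart_fwdK.
by rewrite tangent_coord_bwd// row_mxKr.
Qed.

Lemma tangent_trans i j z : tangent_cod i z -> tangent_dom j (tangent_bwd _ z) ->
  tangent_fwd j (tangent_bwd _ z) =
  row_mx (chart_rep (atlas M i) (atlas M j) id (lsubmx z))
    ('d (chart_rep (atlas M i) (atlas M j) id) (lsubmx z) (rsubmx z)).
Proof.
move=> iz jz; rewrite /tangent_fwd; congr row_mx.
have <- := tangent_coord_trans (tangent_bwd_dom iz) jz.
rewrite (tangent_coord_bwd iz).
have -> // : chart_fwd (atlas M i) (tangent_base (tangent_bwd i z)) = lsubmx z.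
exact: chart_bwdK.
Qed.

Lemma tangent_base_open (A : set M) : open A -> open (@tangent_base R M @^-1` A).
Proof.
rewrite tangent_openE => oA i; rewrite openE => z [iz Az].
have nz : nbhs (lsubmx z) (chart_cod (atlas M i) `&` chart_bwd (atlas M i) @^-1` A).
  apply: filterI; first exact: (open_nbhs_nbhs (conj (chart_cod_open _) iz)).
  exact: (chart_bwd_continuous iz (open_nbhs_nbhs (conj oA Az))).
exact: (continuous_lsubmx (x := z) nz).
Qed.

Lemma tangent_base_continuous : continuous (@tangent_base R M).
Proof. by apply/continuousP; exact: tangent_base_open. Qed.

Lemma tangent_dom_open i : open (tangent_dom i).
Proof. exact: tangent_base_open (chart_dom_open _). Qed.

Lemma tangent_trans_smooth i j :
  smooth_on [set z | chart_rep_dom (atlas M i) (atlas M j) id (lsubmx z)]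
   (fun z => row_mx (chart_rep (atlas M i) (atlas M j) id (lsubmx z))
    ('d (chart_rep (atlas M i) (atlas M j) id) (lsubmx z) (rsubmx z))).
Proof.
have oT := @trans_open i j; have sT := @atlas_smooth _ M i j.
have oTT := open_lsubmx (m := chart_dim (atlas M i)) oT.
apply: (smooth_row_mx oTT); last exact: smooth_tangent.
by apply: (smooth_on_comp oTT oT _ _ sT) => //; exact: smooth_lsubmx.
Qed.

Lemma tangent_fwd_continuous i t : tangent_dom i t ->
  {for t, continuous (tangent_fwd i)}.
Proof.
move=> it A; rewrite nbhsE => -[B [oB Bt] sB]; rewrite nbhs_filterE.
suff oW : open (tangent_dom i `&` tangent_fwd i @^-1` B).
  by apply: filterS (open_nbhs_nbhs (conj oW (conj it Bt))) => u [_ /sB].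
rewrite tangent_openE => j; rewrite openE => z [jz [iz Bz]].
have rz : [set z | chart_rep_dom (atlas M j) (atlas M i) id (lsubmx z)] z by [].
have oT := open_lsubmx (m := chart_dim (atlas M j)) (@trans_open j i).
rewrite /= (@tangent_trans j i z jz iz) in Bz.
have n1 : nbhs z ((fun z => row_mx (chart_rep (atlas M j) (atlas M i) id (lsubmx z))
    ('d (chart_rep (atlas M j) (atlas M i) id) (lsubmx z) (rsubmx z))) @^-1` B).
  exact: (smooth_cont (@tangent_trans_smooth j i) rz (open_nbhs_nbhs (conj oB Bz))).
have n2 := open_nbhs_nbhs (conj oT rz).
apply: filterS (filterI n1 n2) => w [+ [jw iw]].
by rewrite /= -(@tangent_trans j i w jw iw).
Qed.

Lemma tangent_bwd_continuous i z : tangent_cod i z ->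
  {for z, continuous (tangent_bwd i)}.
Proof.
move=> iz A; rewrite nbhsE => -[B [oB Bt] sB]; rewrite nbhs_filterE.
have := oB; rewrite tangent_openE => /(_ i) oi.
by apply: filterS (open_nbhs_nbhs (conj oi (conj iz Bt))) => w [_ /sB].
Qed.

Definition tangent_chart (i : atlas_index M) : local_chart R TM :=
  LocalChart (@tangent_dom_open i) (@tangent_cod_open i) (@tangent_fwd_cod i)
    (@tangent_bwd_dom i) (@tangent_fwdK i) (@tangent_bwdK i)
    (@tangent_fwd_continuous i) (@tangent_bwd_continuous i).

Lemma tangent_chart_at_dom (t : TM) :
  chart_dom (tangent_chart (chart_at M (tangent_base t))) t.
Proof. exact: chart_at_dom. Qed.

Lemma tangent_atlas_smooth i j :
  smooth_on (chart_rep_dom (tangent_chart i) (tangent_chart j) id)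
    (chart_rep (tangent_chart i) (tangent_chart j) id).
Proof.
have oT := open_lsubmx (m := chart_dim (atlas M i)) (@trans_open i j).
apply: (smooth_ext oT _ (@tangent_trans_smooth i j)) => z [iz jz].
exact: esym (tangent_trans iz jz).
Qed.

Lemma tangent_hausdorff : hausdorff_space TM.
Proof.
move=> t u tu; have tcont := tangent_base_continuous.
have xy := hausdorff_map (@manifold_hausdorff _ M) (@tcont t) (@tcont u) tu.
pose i := chart_at M (tangent_base t).
have it : tangent_dom i t by exact: chart_at_dom.
have iu : tangent_dom i u by rewrite /tangent_dom /= -xy.
have := hausdorff_map (@norm_hausdorff _ _) (tangent_fwd_continuous it)
  (tangent_fwd_continuous iu) tu.
by move=> /eq_row_mx[_]; exact: tangent_inj.
Qed.

End TangentManifold.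

Arguments tangent_cod {R M} i _.
Arguments tangent_bwd {R M} i _.

Section SecondCountable.
Variable R : realType.

Definition rat_box n (ab : seq rat * seq rat) : set 'rV[R]_n :=
  [set z | forall j : 'I_n, ratr ab.1`_j < z 0 j < ratr ab.2`_j].

Lemma rat_box_open n ab : open (@rat_box n ab).
Proof.
rewrite openE => z zab.
have h (j : 'I_n) : nbhs z [set w : 'rV[R]_n | ratr ab.1`_j < w 0 j < ratr ab.2`_j].
  have /andP[az zb] := zab j.
  have n1 : nbhs z [set w : 'rV[R]_n | ratr ab.1`_j < w 0 j].
    exact: (@coord_continuous _ 1 n 0 j z _ (lt_nbhsr az)).
  have n2 : nbhs z [set w : 'rV[R]_n | w 0 j < ratr ab.2`_j].
    exact: (@coord_continuous _ 1 n 0 j z _ (lt_nbhsl zb)).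
  by apply: filterS (filterI n1 n2) => w [w1 w2]; apply/andP.
suff : nbhs z (rat_box ab) by [].
exact: (filter_forall (F := nbhs z) (nbhs_filter z) h).
Qed.

Lemma rat_box_basis n (z : 'rV[R]_n) (A : set 'rV[R]_n) : nbhs z A ->
  exists2 ab, rat_box ab z & @rat_box n ab `<=` A.
Proof.
move=> /nbhs_ballP[e /= e0 eA].
have ha (j : 'I_n) : exists q : rat, z 0 j - e < ratr q < z 0 j.
  have /rat_in_itvoo[q /itvP qq] : z 0 j - e < z 0 j by rewrite ltrBlDr ltrDl.
  by exists q; rewrite !qq.
have hb (j : 'I_n) : exists q : rat, z 0 j < ratr q < z 0 j + e.
  have /rat_in_itvoo[q /itvP qq] : z 0 j < z 0 j + e by rewrite ltrDl.
  by exists q; rewrite !qq.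
have [a aP] := choice ha; have [b bP] := choice hb.
have nthE (f : 'I_n -> rat) (j : 'I_n) : [seq f i | i <- enum 'I_n]`_j = f j.
  by rewrite (nth_map j) ?size_enum_ord// nth_ord_enum.
exists ([seq a i | i <- enum 'I_n], [seq b i | i <- enum 'I_n]).
  move=> j /=; rewrite !nthE.
  by have /andP[_ ->] := aP j; have /andP[-> _] := bP j.
move=> w wP; apply: eA; split => // i j; rewrite (ord1 i).
have := wP j; rewrite /= !nthE => /andP[w1 w2].
have /andP[a1 _] := aP j; have /andP[_ b2] := bP j.
rewrite /ball /= ltr_distlC (lt_trans a1 w1)/=.
exact: lt_trans w2 b2.
Qed.

End SecondCountable.

Lemma tangent_second_countable (R : realType) (M : manifold R) :
  @second_countable (tangent_vector M).
Proof.
have [B cB [oB bB]] := @manifold_second_countable _ M.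
pose ci (U : set M) : option (atlas_index M) :=
  if pselect (exists i, U `<=` chart_dom (atlas M i)) is left h
  then Some (projT1 (cid h)) else None.
have ciP U i : ci U = Some i -> U `<=` chart_dom (atlas M i).
  by rewrite /ci; case: pselect => // h [<-]; case: (cid h).
have ciE U i : U `<=` chart_dom (atlas M i) -> exists j, ci U = Some j.
  move=> Ui; rewrite /ci; case: pselect => [h|[]]; last by exists i.
  by exists (projT1 (cid h)).
pose G (p : set M * (seq rat * seq rat)) : set (tangent_vector M) :=
  if ci p.1 is Some i then
    [set t | p.1 (tangent_base t) /\ rat_box p.2 (tangent_fwd i t)] else set0.
exists (G @` (B `*` setT)).
  apply: sub_countable; first exact: card_image_le.
  by apply: countableX => //; exact: countableP.
split.
  move=> _ [[U ab] [/= BU _] <-]; rewrite /G /=.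
  case E: (ci U) => [i|]; last exact: open0.
  rewrite openE => t [Ut bt]; have ti := ciP _ _ E _ Ut.
  apply: filterI.
    exact: (open_nbhs_nbhs (conj (tangent_base_open (oB _ BU)) Ut)).
  exact: (tangent_fwd_continuous ti (open_nbhs_nbhs (conj (@rat_box_open _ _ ab) bt))).
move=> t W; rewrite nbhsE => -[W' [oW' W't] sW]; rewrite nbhs_filterE.
pose i0 := chart_at M (tangent_base t).
have nx : nbhs (tangent_base t) (chart_dom (atlas M i0)).
  exact: (open_nbhs_nbhs (conj (chart_dom_open _) (chart_at_dom _))).
have [U [BU Ut] Ui0] := bB (tangent_base t) _ nx.
have [i ciU] := ciE _ _ Ui0; have Ui := ciP _ _ ciU.
have it : tangent_dom i t by exact: Ui.
have oz := oW'; rewrite tangent_openE in oz; have {}oz := oz i.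
have zW : (tangent_cod i `&` tangent_bwd i @^-1` W') (tangent_fwd i t).
  by split; [exact: tangent_fwd_cod|rewrite /= tangent_fwdK].
have [ab abz abW] := rat_box_basis (open_nbhs_nbhs (conj oz zW)).
exists (G (U, ab)); first by split; [exists (U, ab)|rewrite /G /= ciU].
rewrite /G /= ciU => u [/= Uu abu]; apply: sW.
have [_ /=] := abW _ abu; rewrite tangent_fwdK//; exact: Ui.
Qed.

Definition tangent_bundle (R : realType) (M : manifold R) : manifold R :=
  Manifold (@tangent_chart_at_dom R M) (@tangent_atlas_smooth R M)
    (@tangent_hausdorff R M) (@tangent_second_countable R M).

Lemma open_setX (X Y : topologicalType) (A : set X) (B : set Y) :
  open A -> open B -> open (A `*` B).
Proof.
move=> oA oB; rewrite openE => -[x y] [/= Ax By].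
by exists (A, B) => //; split; exact: open_nbhs_nbhs.
Qed.

Section Product.
Variables (R : realType) (M N : manifold R).

Definition prod_dim (ij : atlas_index M * atlas_index N) : nat :=
  chart_dim (atlas M ij.1) + chart_dim (atlas N ij.2).

Definition prod_fwd ij (p : M * N) : 'rV[R]_(prod_dim ij) :=
  row_mx (chart_fwd (atlas M ij.1) p.1) (chart_fwd (atlas N ij.2) p.2).

Definition prod_bwd ij (z : 'rV[R]_(prod_dim ij)) : M * N :=
  (chart_bwd (atlas M ij.1) (lsubmx z), chart_bwd (atlas N ij.2) (rsubmx z)).

Definition prod_dom ij : set (M * N) :=
  chart_dom (atlas M ij.1) `*` chart_dom (atlas N ij.2).

Definition prod_cod ij : set 'rV[R]_(prod_dim ij) :=
  [set z | chart_cod (atlas M ij.1) (lsubmx z) /\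
           chart_cod (atlas N ij.2) (rsubmx z)].

Arguments prod_bwd : clear implicits.
Arguments prod_cod : clear implicits.

Lemma prod_dom_open ij : open (prod_dom ij).
Proof. by apply: open_setX; exact: chart_dom_open. Qed.

Lemma prod_cod_open ij : open (prod_cod ij).
Proof.
by apply: openI; [apply: open_lsubmx|apply: open_rsubmx]; exact: chart_cod_open.
Qed.

Lemma prod_fwd_cod ij p : prod_dom ij p -> prod_cod ij (prod_fwd ij p).
Proof.
by move=> [ip jp]; split; rewrite /= ?row_mxKl ?row_mxKr; exact: chart_fwd_cod.
Qed.

Lemma prod_bwd_dom ij z : prod_cod ij z -> prod_dom ij (prod_bwd ij z).
Proof. by move=> [iz jz]; split; exact: chart_bwd_dom. Qed.

Lemma prod_fwdK ij p : prod_dom ij p -> prod_bwd ij (prod_fwd ij p) = p.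
Proof.
by case: p => x y [/= ip jp]; rewrite /prod_bwd row_mxKl row_mxKr !chart_fwdK.
Qed.

Lemma prod_bwdK ij z : prod_cod ij z -> prod_fwd ij (prod_bwd ij z) = z.
Proof. by move=> [iz jz]; rewrite /prod_fwd !chart_bwdK//= hsubmxK. Qed.

Lemma prod_fwd_continuous ij p : prod_dom ij p ->
  {for p, continuous (prod_fwd ij)}.
Proof.
move=> [ip jp]; apply: row_mx_cont.
  apply: (continuous_comp (f := fst)); first exact: cvg_fst.
  exact: chart_fwd_continuous.
apply: (continuous_comp (f := snd)); first exact: cvg_snd.
exact: chart_fwd_continuous.
Qed.

Lemma prod_bwd_continuous ij z : prod_cod ij z ->
  {for z, continuous (prod_bwd ij)}.
Proof.
move=> [iz jz].
have c1 := continuous_comp (continuous_lsubmx (x := z)) (chart_bwd_continuous iz).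
have c2 := continuous_comp (continuous_rsubmx (x := z)) (chart_bwd_continuous jz).
exact: cvg_pair c1 c2.
Qed.

Definition prod_chart ij : local_chart R (M * N)%type :=
  LocalChart (@prod_dom_open ij) (@prod_cod_open ij) (@prod_fwd_cod ij)
    (@prod_bwd_dom ij) (@prod_fwdK ij) (@prod_bwdK ij)
    (@prod_fwd_continuous ij) (@prod_bwd_continuous ij).

Lemma prod_chart_at_dom (p : M * N) :
  chart_dom (prod_chart (chart_at M p.1, chart_at N p.2)) p.
Proof. by split; exact: chart_at_dom. Qed.

Lemma prod_atlas_smooth ij kl :
  smooth_on (chart_rep_dom (prod_chart ij) (prod_chart kl) id)
    (chart_rep (prod_chart ij) (prod_chart kl) id).
Proof.
have o : open (chart_rep_dom (prod_chart ij) (prod_chart kl) id).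
  by apply: chart_rep_open => ? _; exact: continuous_for_id.
have o1 := @trans_open _ M ij.1 kl.1; have o2 := @trans_open _ N ij.2 kl.2.
have s1 := @atlas_smooth _ M ij.1 kl.1; have s2 := @atlas_smooth _ N ij.2 kl.2.
apply: (smooth_row_mx o).
  by apply: (smooth_on_comp o o1 _ (@smooth_lsubmx _ _ _ _) s1) => z [[? ?] [? ?]].
by apply: (smooth_on_comp o o2 _ (@smooth_rsubmx _ _ _ _) s2) => z [[? ?] [? ?]].
Qed.

Lemma prod_hausdorff : hausdorff_space (M * N)%type.
Proof.
move=> [x y] [x' y'] pq.
have /= -> := hausdorff_map (f := fst) (@manifold_hausdorff _ M) (@cvg_fst _ _ _ _ _) (@cvg_fst _ _ _ _ _) pq.
by have /= -> := hausdorff_map (f := snd) (@manifold_hausdorff _ N) (@cvg_snd _ _ _ _ _) (@cvg_snd _ _ _ _ _) pq.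
Qed.

Lemma prod_second_countable : @second_countable (M * N)%type.
Proof.
have [B cB [oB bB]] := @manifold_second_countable _ M.
have [D cD [oD bD]] := @manifold_second_countable _ N.
exists ((fun p => p.1 `*` p.2) @` (B `*` D)).
  by apply: sub_countable; [exact: card_image_le|exact: countableX].
split; first by move=> _ [[U V] [/= /oB oU /oD oV] <-]; exact: open_setX.
move=> [x y] W [[U V] /= [nU nV] UVW]; rewrite nbhs_filterE.
have [U' [BU' U'x] sU] := bB _ _ nU; have [V' [DV' V'y] sV] := bD _ _ nV.
exists (U' `*` V'); first by split => //; exists (U', V').
by move=> [a b] [/= /sU Ua /sV Vb]; exact: UVW.
Qed.

Definition prod_manifold : manifold R :=
  Manifold prod_chart_at_dom prod_atlas_smooth prod_hausdorff
    prod_second_countable.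

End Product.

Section SmoothMaps.
Variable R : realType.
Implicit Types L M N P : manifold R.

Lemma smooth_id M : smooth (@id M).
Proof. by split=> [x|i j] //; exact: atlas_smooth. Qed.

Lemma smooth_comp M N P (g : smooth_map N P) (f : smooth_map M N) :
  smooth (g \o f).
Proof.
have [cf sf] := smooth_funP f; have [cg sg] := smooth_funP g.
have cgf : continuous (g \o f).
  by move=> x; exact: (continuous_comp (cf x) (cg (f x))).
apply: smooth_intro => x.
pose i := chart_at M x; pose j := chart_at N (f x); pose k := chart_at P (g (f x)).
have ix : chart_dom (atlas M i) x := chart_at_dom x.
have jx : chart_dom (atlas N j) (f x) := chart_at_dom _.
have kx : chart_dom (atlas P k) (g (f x)) := chart_at_dom _.
have o1 : open (chart_rep_dom (atlas M i) (atlas N j) f).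
  by apply: chart_rep_open => ? _; exact: cf.
have o2 : open (chart_rep_dom (atlas N j) (atlas P k) g).
  by apply: chart_rep_open => ? _; exact: cg.
have o3 : open (chart_rep_dom (atlas M i) (atlas P k) (g \o f)).
  by apply: chart_rep_open => ? _; exact: cgf.
exists i, k, (chart_rep_dom (atlas M i) (atlas N j) f `&`
  chart_rep_dom (atlas M i) (atlas P k) (g \o f)).
have oA := openI o1 o3.
split; [exact: oA|exact: ix| | |].
- by split; split; rewrite ?chart_fwdK//; exact: chart_fwd_cod.
- by move=> z [].
- apply: (smooth_ext (f := chart_rep (atlas N j) (atlas P k) g \o
    chart_rep (atlas M i) (atlas N j) f) oA) => [z [rz _]|].
    exact: chart_repK.
  apply: (smooth_on_comp oA o2) => [z [[iz jz] [_ kz]]||].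
  + by split; [exact: chart_fwd_cod|rewrite /chart_rep chart_fwdK].
  + by apply: smooth_sub (sf i j) => z [].
  + exact: sg.
Qed.

Definition smooth_map_id M : smooth_map M M := SmoothMap (smooth_id M).

Definition smooth_map_comp M N P (g : smooth_map N P) (f : smooth_map M N) :
  smooth_map M P := SmoothMap (smooth_comp g f).

Lemma smooth_pair L M N (f : smooth_map L M) (g : smooth_map L N) :
  smooth (fun x => (f x, g x) : prod_manifold M N).
Proof.
have [cf sf] := smooth_funP f; have [cg sg] := smooth_funP g.
have cfg : continuous (fun x => (f x, g x) : prod_manifold M N).
  by move=> x; exact: (cvg_pair (cf x) (cg x)).
split=> // i jk; set c := atlas _ i; set d := atlas _ jk.
have o : open (chart_rep_dom c d (fun x => (f x, g x))).
  by apply: chart_rep_open => ? _; exact: cfg.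
apply: (smooth_row_mx o).
  by apply: smooth_sub (sf i jk.1) => z [? []].
by apply: smooth_sub (sg i jk.2) => z [? []].
Qed.

Definition smooth_map_pair L M N (f : smooth_map L M) (g : smooth_map L N) :
  smooth_map L (prod_manifold M N) := SmoothMap (smooth_pair f g).

Definition tangent_fun M N (f : M -> N) (t : tangent_bundle M) : tangent_bundle N :=
  let x := tangent_base t in
  let c := atlas M (chart_at M x) in
  let d := atlas N (chart_at N (f x)) in
  TangentVector (tangent_base := f x)
    ('d (chart_rep c d f) (chart_fwd c x) (tangent_vec t)).

Lemma tangent_fun_coord M N (f : smooth_map M N) i j (t : tangent_bundle M) :
  tangent_dom i t -> tangent_dom j (tangent_fun f t) ->
  tangent_coord j (tangent_fun f t) =
  'd (chart_rep (atlas M i) (atlas N j) f) (chart_fwd (atlas M i) (tangent_base t))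
    (tangent_coord i t).
Proof.
have [cf sf] := smooth_funP f.
have of' k l : open (chart_rep_dom (atlas M k) (atlas N l) f).
  by apply: chart_rep_open => ? _; exact: cf.
move=> it jt; rewrite /tangent_coord /=.
rewrite (diff_chart_comp (f := f) (g := id) _ (of' _ _) (sf _ _)
  (@atlas_smooth _ N _ _)) //; try exact: chart_at_dom.
rewrite (diff_chart_comp (f := id) (g := f) _ (@trans_open _ M _ _)
  (@atlas_smooth _ M _ _) (sf _ _)) //; exact: chart_at_dom.
Qed.

Lemma smooth_tangent_fun M N (f : smooth_map M N) :
  smooth (tangent_fun f : tangent_bundle M -> tangent_bundle N).
Proof.
have [cf sf] := smooth_funP f.
apply: smooth_intro => t; set x := tangent_base t.
pose i := chart_at M x; pose j := chart_at N (f x).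
have ix : chart_dom (atlas M i) x := chart_at_dom x.
have jx : chart_dom (atlas N j) (f x) := chart_at_dom _.
pose F := chart_rep (atlas M i) (atlas N j) f.
have oF : open (chart_rep_dom (atlas M i) (atlas N j) f).
  by apply: chart_rep_open => ? _; exact: cf.
pose D := [set z : 'rV[R]_(chart_dim (atlas M i) + chart_dim (atlas M i)) |
  chart_rep_dom (atlas M i) (atlas N j) f (lsubmx z)].
have oD : open D := open_lsubmx oF.
exists i, j, D; split; [exact: oD|exact: ix| |by []|].
- split; rewrite /= ?row_mxKl; first exact: chart_fwd_cod.
  by rewrite chart_fwdK.
- apply: (smooth_ext (f := fun z => row_mx (F (lsubmx z))
    ('d F (lsubmx z) (rsubmx z))) oD) => [z [iz jz]|].
    have itz : tangent_dom i (tangent_bwd i z) := chart_bwd_dom iz.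
    rewrite /chart_rep /= /tangent_fwd (tangent_fun_coord itz jz).
    rewrite (tangent_coord_bwd iz).
    have -> // : chart_fwd (atlas M i) (tangent_base (tangent_bwd i z)) = lsubmx z.
    exact: chart_bwdK.
  apply: (smooth_row_mx oD); last exact: smooth_tangent oF (sf i j).
  by apply: (smooth_on_comp oD oF _ (@smooth_lsubmx _ _ _ _) (sf i j)).
Qed.

Definition tangent_map M N (f : smooth_map M N) :
    smooth_map (tangent_bundle M) (tangent_bundle N) :=
  SmoothMap (smooth_tangent_fun f).

Lemma smooth_tangent_proj M : smooth (@tangent_base R M : tangent_bundle M -> M).
Proof.
apply: smooth_intro => t; set i := chart_at M (tangent_base t).
have it : tangent_dom i t := chart_at_dom _.
exists i, i, (tangent_cod i); split; [exact: tangent_cod_open|exact: it| | |].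
- exact: (tangent_fwd_cod it).
- by move=> z iz; split => //; exact: chart_bwd_dom.
- apply: (smooth_ext (@tangent_cod_open _ M i) _ (@smooth_lsubmx _ _ _ _)) => z iz.
  by rewrite /chart_rep /= chart_bwdK.
Qed.

Definition tangent_proj M : smooth_map (tangent_bundle M) M :=
  SmoothMap (@smooth_tangent_proj M).

Lemma tangent_coord0 M i x :
  tangent_coord i (@TangentVector R M x 0) = 0.
Proof. by rewrite /tangent_coord linear0. Qed.

Lemma smooth_tangent_zero M :
  smooth ((fun x => @TangentVector R M x 0) : M -> tangent_bundle M).
Proof.
apply: smooth_intro => x; set i := chart_at M x.
have ix : chart_dom (atlas M i) x := chart_at_dom x.
exists i, i, (chart_cod (atlas M i)); split; [exact: chart_cod_open|exact: ix| | |].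
- exact: chart_fwd_cod.
- by move=> z iz; split => //; exact: chart_bwd_dom.
- have o := chart_cod_open (atlas M i).
  apply: (smooth_ext (f := fun z => row_mx z 0) o) => [z iz|].
    rewrite /chart_rep /= /tangent_fwd tangent_coord0 /=.
    by rewrite chart_bwdK.
  apply: (smooth_row_mx o); last exact: smooth_cst.
  exact: (@smooth_linear _ _ _ _ idfun).
Qed.

Definition tangent_zero M : smooth_map M (tangent_bundle M) :=
  SmoothMap (@smooth_tangent_zero M).

(* l(x, v) = (x, 0, 0, v): the vector with coordinates (0, v) at the point (x, 0)
   of TM. This does not depend on the chart, see [tangent_lift_coord]. *)
Definition tangent_lift_fun M (t : tangent_bundle M) :
    tangent_bundle (tangent_bundle M) :=
  TangentVector (tangent_base := tangent_zero M (tangent_base t))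
    (row_mx 0 (tangent_vec t)).

Lemma is_diff_affine n (V : normedModType R) (b : V) (L : {linear 'rV[R]_n -> V})
  (y : 'rV[R]_n) : is_diff y (fun u => b + L u) L.
Proof.
have dL : is_diff y L L.
  have cL : continuous L by exact: linear_rV_continuous.
  by split; [exact: linear_differentiable|rewrite diff_lin].
have := @is_diffD _ _ _ (cst b) L 0 L y (is_diff_cst _ _) dL.
by rewrite add0r.
Qed.

Lemma tangent_lift_coord M i (t : tangent_bundle M) : tangent_dom i t ->
  tangent_coord (M := tangent_bundle M) i (tangent_lift_fun t) =
  row_mx 0 (tangent_coord i t).
Proof.
case: t => x v it; rewrite /tangent_coord /=.
set c := chart_at M x; set a := chart_fwd (atlas M c) x.
set T := chart_rep (atlas M c) (atlas M i) id.
set G := chart_rep _ _ id.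
have cx : chart_dom (atlas M c) x := chart_at_dom x.
have ra : chart_rep_dom (atlas M c) (atlas M i) id a.
  by split; [exact: chart_fwd_cod|rewrite /= chart_fwdK].
have -> : tangent_fwd c (@TangentVector R M x 0) = row_mx a 0.
  by rewrite /tangent_fwd tangent_coord0.
have dG : differentiable G (row_mx a 0).
  apply: smooth_diffble (@tangent_atlas_smooth _ M c i) _.
  case: ra => r1 r2.
  by split; rewrite /= ?/tangent_cod /= ?/tangent_dom /= row_mxKl.
have GE y : G (row_mx a y) = row_mx (T a) ('d T a y).
  case: ra => r1 r2.
  rewrite /G /chart_rep /= tangent_trans ?row_mxKl ?row_mxKr//.
    by rewrite /tangent_cod /= row_mxKl.
  by rewrite /tangent_dom /= row_mxKl.
pose L1 : {linear 'rV[R]_(chart_dim (atlas M c)) ->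
    'rV[R]_(chart_dim (atlas M c) + chart_dim (atlas M c))} :=
  mulmxr (row_mx 0 1%:M).
pose L2 : {linear 'rV[R]_(chart_dim (atlas M i)) ->
    'rV[R]_(chart_dim (atlas M i) + chart_dim (atlas M i))} :=
  mulmxr (row_mx 0 1%:M).
have L1E y : L1 y = row_mx 0 y by rewrite /L1 /= mul_mx_row mulmx1 mulmx0.
have L2E y : L2 y = row_mx 0 y by rewrite /L2 /= mul_mx_row mulmx1 mulmx0.
pose L3 : {linear 'rV[R]_(chart_dim (atlas M c)) ->
    'rV[R]_(chart_dim (atlas M i) + chart_dim (atlas M i))} := L2 \o 'd T a.
have [dh hE] := is_diff_affine (row_mx a 0) L1 0.
have [_ kE] := is_diff_affine (row_mx (T a) 0) L3 0.
have h0 : row_mx a 0 + L1 0 = row_mx a 0 by rewrite linear0 addr0.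
have dG' : differentiable G (row_mx a 0 + L1 0) by rewrite h0.
have := diff_comp dh dG'.
have -> : G \o (fun u => row_mx a 0 + L1 u) = fun u => row_mx (T a) 0 + L3 u.
  apply/funext => u; rewrite -[LHS]/(G (row_mx a 0 + L1 u)) L1E add_row_mx addr0 add0r GE.
  by rewrite -[L3 u]/(L2 ('d T a u)) L2E add_row_mx addr0 add0r.
rewrite kE => /(congr1 (fun f => f v)) E.
rewrite -L2E -[RHS]/(L3 v) E -[RHS]/('d G _ ('d _ 0 v)) hE h0.
by rewrite L1E.
Qed.

Lemma smooth_tangent_lift M : smooth (@tangent_lift_fun M).
Proof.
apply: smooth_intro => t; set i := chart_at M (tangent_base t).
have it : tangent_dom i t := chart_at_dom _.
have o := @tangent_cod_open _ M i.
exists i, i, (tangent_cod i); split; [exact: o|exact: it| | |].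
- exact: (tangent_fwd_cod it).
- move=> z iz; split => //; exact: chart_bwd_dom.
- apply: (smooth_ext (f := fun z => row_mx (row_mx (lsubmx z) 0)
    (row_mx 0 (rsubmx z))) o) => [z iz|].
    have itz : tangent_dom i (tangent_bwd i z) := chart_bwd_dom iz.
    rewrite /chart_rep /= /tangent_fwd (tangent_lift_coord itz) (tangent_coord_bwd iz).
    by rewrite /= /tangent_fwd tangent_coord0 /= chart_bwdK.
  apply: (smooth_row_mx o); apply: (smooth_row_mx o).
  + exact: smooth_lsubmx.
  + exact: smooth_cst.
  + exact: smooth_cst.
  + exact: smooth_rsubmx.
Qed.

Definition tangent_lift M :
    smooth_map (tangent_bundle M) (tangent_bundle (tangent_bundle M)) :=
  SmoothMap (@smooth_tangent_lift M).

End SmoothMaps.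

Notation "g \os f" := (smooth_map_comp g f)
  (at level 50, left associativity).

Section DifferentialBundles.
Variable R : realType.
Implicit Types (X P A B C E M N : manifold R).

Lemma smooth_map_ext M N (f g : smooth_map M N) : f =1 g -> f = g.
Proof.
case: f g => [f sf] [g sg] /= /funext fg; rewrite fg in sf *.
by rewrite (Prop_irrelevance sf sg).
Qed.

Fixpoint iter_tangent (n : nat) M : manifold R :=
  if n is n'.+1 then tangent_bundle (iter_tangent n' M) else M.

Fixpoint iter_tangent_map (n : nat) M N (f : smooth_map M N) :
    smooth_map (iter_tangent n M) (iter_tangent n N) :=
  if n is n'.+1 then tangent_map (iter_tangent_map n' f) else f.

(* The square   P --a--> A
                |b       |f
                B --g--> C   is a pullback of smooth manifolds. *)
Definition is_pullback P A B C (a : smooth_map P A) (b : smooth_map P B)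
    (f : smooth_map A C) (g : smooth_map B C) : Prop :=
  f \os a = g \os b /\
  forall X (u : smooth_map X A) (v : smooth_map X B), f \os u = g \os v ->
    exists! h : smooth_map X P, a \os h = u /\ b \os h = v.

Definition is_T_pullback P A B C (a : smooth_map P A) (b : smooth_map P B)
    (f : smooth_map A C) (g : smooth_map B C) : Prop :=
  forall n, is_pullback (iter_tangent_map n a) (iter_tangent_map n b)
    (iter_tangent_map n f) (iter_tangent_map n g).

(* [r] is the structure map to the base; it matters only for [n = 0], where the
   fibre power is the base itself. *)
Definition is_fibre_power (n : nat) E M (q : smooth_map E M) P
    (r : smooth_map P M) (pi : 'I_n -> smooth_map P E) : Prop :=
  (forall i, q \os pi i = r) /\
  forall X (s : smooth_map X M) (a : 'I_n -> smooth_map X E),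
    (forall i, q \os a i = s) ->
    exists! h : smooth_map X P, r \os h = s /\ forall i, pi i \os h = a i.

Definition has_T_fibre_powers E M (q : smooth_map E M) : Prop :=
  forall n, exists P (r : smooth_map P M) (pi : 'I_n -> smooth_map P E),
  forall k, is_fibre_power (iter_tangent_map k q) (iter_tangent_map k r)
    (fun i => iter_tangent_map k (pi i)).

(* A fibrewise addition, given by its graph on generalized elements:
   [plus X a b s] reads "a and b lie in the same fibres and s = a + b". *)
Definition addition E : Type :=
  forall X, smooth_map X E -> smooth_map X E -> smooth_map X E -> Prop.

(* a + b := plus <a, b>, for E2 the fibre square with projections pi0, pi1 *)
Definition addition_of E2 E (pi0 pi1 plus : smooth_map E2 E) : addition E :=
  fun X a b s => exists h : smooth_map X E2,
    [/\ pi0 \os h = a, pi1 \os h = b & s = plus \os h].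

(* the fibrewise addition of tangent vectors *)
Definition tangent_addition M : addition (tangent_bundle M) :=
  fun X a b s => forall z : X, exists (x : M) (v w : tangent_space x),
    [/\ a z = TangentVector v, b z = TangentVector w
      & s z = TangentVector (v + w)].

(* (E2, pi0, pi1) is meant to be the fibre square of q. *)
Record additive_bundle E M (q : smooth_map E M) (xi : smooth_map M E) E2
    (pi0 pi1 plus : smooth_map E2 E) : Prop := AdditiveBundle {
  additive_over : q \os plus = q \os pi0;
  additive_section : q \os xi = smooth_map_id M;
  additive_assoc : forall X (a b c ab bc s : smooth_map X E),
    addition_of pi0 pi1 plus a b ab -> addition_of pi0 pi1 plus b c bc ->
    addition_of pi0 pi1 plus ab c s -> addition_of pi0 pi1 plus a bc s;
  additive_comm : forall X (a b s : smooth_map X E),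
    addition_of pi0 pi1 plus a b s -> addition_of pi0 pi1 plus b a s;
  additive_unit : forall X (a : smooth_map X E),
    addition_of pi0 pi1 plus (xi \os (q \os a)) a a
}.

Record additive_morphism E M E' M'
    (q : smooth_map E M) (xi : smooth_map M E) (add : addition E)
    (q' : smooth_map E' M') (xi' : smooth_map M' E') (add' : addition E')
    (f1 : smooth_map E E') (f0 : smooth_map M M') : Prop := AdditiveMorphism {
  additive_morphism_square : q' \os f1 = f0 \os q;
  additive_morphism_add : forall X (a b s : smooth_map X E),
    add X a b s -> add' X (f1 \os a) (f1 \os b) (f1 \os s);
  additive_morphism_zero : f1 \os xi = xi' \os f0
}.

Record pre_differential_bundle E M (q : smooth_map E M) (xi : smooth_map M E)
    (lam : smooth_map E (tangent_bundle E)) : Prop := PreDifferentialBundle {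
  pre_differential_section : q \os xi = smooth_map_id M;
  pre_differential_coassoc : tangent_lift E \os lam = tangent_map lam \os lam;
  pre_differential_proj : tangent_proj E \os lam = xi \os q;
  pre_differential_zero : lam \os xi = tangent_zero E \os xi
}.

Definition differential_bundle E M (q : smooth_map E M) (xi : smooth_map M E)
    (lam : smooth_map E (tangent_bundle E)) : Prop :=
  has_T_fibre_powers q /\
  exists E2 (pi0 pi1 plus : smooth_map E2 E),
  let add_q := addition_of pi0 pi1 plus in
  let add_Tq :=
    addition_of (tangent_map pi0) (tangent_map pi1) (tangent_map plus) in
  [/\ is_T_pullback pi0 pi1 q q,
      additive_bundle q xi pi0 pi1 plus,
      additive_morphism q xi add_q (tangent_map q) (tangent_map xi) add_Tq
        lam (tangent_zero M),
      additive_morphism q xi add_q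
        (tangent_proj E) (tangent_zero E) (@tangent_addition E) lam xi
    & exists2 t : smooth_map E2 (tangent_bundle E),
        add_Tq E2 (lam \os pi0) (tangent_zero E \os pi1) t
      & is_T_pullback t (q \os pi0) (tangent_map q) (tangent_zero M)].

End DifferentialBundles.

(* Main.v *)
Require Import Defs.
From HB Require Import structures.
From mathcomp Require Import all_boot all_order all_algebra.
From mathcomp Require Import all_classical reals.
From mathcomp Require Import topology normedtype derive.
Import Order.TTheory GRing.Theory Num.Theory.
Import numFieldNormedType.Exports.

(** The pullback condition says that lam identifies E with the manifold of
    those tangent vectors of E that are based on the section xi and vertical, that
    is, killed by T(q). A differential bundle satisfies it for formal reasons: the
    map mu = lam pi0 + 0 pi1 of the universal square sends (a, b) to a vector at b
    and (a, 0) to lam a, so the vertical vectors at the zero section are exactly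
    the values of lam (differential_bundle_pullback).

    Conversely, the vertical vectors along xi form the kernel of the idempotent
    T(xi) T(q), which varies smoothly with the point of M. Kernels of nearby
    idempotents are identified by an explicit invertible matrix (intertwiner), and
    this yields charts for the pullback of this vector bundle along any map
    f : A -> M (kernel_bundle). By the hypothesis on lam, the result is the
    pullback of q along f (bundle_pullback). The same local trivializations show
    that q is a submersion (bundle_submersion) and that lam has local smooth left
    inverses (lam_left_inverse).

    To see that these pullbacks are preserved by T, a fibre product is described
    by two pieces of local data: a smooth transport of points between the fibres of
    one leg, and a smooth retraction of the product onto the fibre product
    (submersive_square). Both consist of equations between germs of smooth
    functions, so T preserves them, and together they imply the universal property
    (submersive_square_T_pullback). Fibre powers of q are iterated pullbacks
    (T_fibre_powers).

    The addition of E is transported along lam from the tangent spaces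
    (fibre_combination), so that its laws hold because lam is injective. That lam is
    additive towards T(q) can be tested after applying the injective map T(lam);
    there it becomes additivity of the lift TE -> T(TE), by coassociativity
    (lam_additive_tangent). Finally the universal square is a submersive square:
    since fibres admit subtraction, a vertical vector at b can be translated to the
    zero section, where it is a value of lam (universal_square). *)

Set Implicit Arguments.
Unset Strict Implicit.
Unset Printing Implicit Defensive.

Local Open Scope classical_set_scope.
Local Open Scope ring_scope.

(** * Smooth matrix-valued functions *)

Section SmoothAlgebra.
Variable R : realType.
Implicit Types V W : normedModType R.

Lemma smooth_add V W (U : set V) (f g : V -> W) :
  open U -> smooth_on U f -> smooth_on U g -> smooth_on U (fun x => f x + g x).
Proof. by move=> oU hf hg k; exact: Ck_add. Qed.

Lemma smooth_mul V (U : set V) (f g : V -> R) :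
  open U -> smooth_on U f -> smooth_on U g -> smooth_on U (fun x => f x * g x).
Proof. by move=> oU hf hg k; exact: Ck_mul. Qed.

Lemma smooth_opp V W (U : set V) (f : V -> W) :
  open U -> smooth_on U f -> smooth_on U (fun x => - f x).
Proof.
move=> oU sf k; have -> : (fun x => - f x) = (fun w => - w) \o f by [].
apply: (Ck_lin (L := [the {linear W -> W} of -%R])) => //.
exact: opp_continuous.
Qed.

Lemma smooth_inv V (U : set V) (f : V -> R) : open U ->
  (forall x, U x -> f x != 0) -> smooth_on U f -> smooth_on U (fun x => (f x)^-1).
Proof.
move=> oU f0 sf; elim=> [|k IH] /=.
  by move=> x Ux; apply: cvgV; [exact: f0|exact: smooth_cont sf Ux].
split=> [x Ux|v].
  by apply: differentiableV; [exact: smooth_diffble sf Ux|exact: f0].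
apply: (Ck_ext (f := fun x => - ((f x)^-1 * (f x)^-1 * 'd f x v)) oU) => [x Ux|].
  have df := smooth_diffble sf Ux; have fx0 := f0 _ Ux.
  have E := @diffV R V f x df fx0.
  have {}E := congr1 (fun h : V -> R => h v) E.
  apply: etrans (esym E).
  by rewrite /= -mulNr expr2 invfM.
have -> : (fun x => - ((f x)^-1 * (f x)^-1 * 'd f x v)) =
  (fun x => cst (-1) x * ((f x)^-1 * (f x)^-1 * 'd f x v)).
  by apply/funext => x; rewrite mulN1r.
have [_ /(_ v) sd] := sf k.+1.
by do ! [apply: (Ck_mul oU) => //]; exact: Ck_cst.
Qed.

Lemma smooth_bigsum V W (U : set V) (I : Type) (r : seq I) (P : pred I)
    (F : I -> V -> W) : open U -> (forall i, smooth_on U (F i)) ->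
  smooth_on U (fun x => \sum_(i <- r | P i) F i x).
Proof.
move=> oU sF; elim: r => [|i r IH].
  by under eq_fun do rewrite big_nil; exact: smooth_cst.
under eq_fun do rewrite big_cons; case: (P i) => //.
exact: smooth_add.
Qed.

Lemma smooth_bigprod V (U : set V) (I : Type) (r : seq I) (P : pred I)
    (F : I -> V -> R) : open U -> (forall i, smooth_on U (F i)) ->
  smooth_on U (fun x => \prod_(i <- r | P i) F i x).
Proof.
move=> oU sF; elim: r => [|i r IH].
  by under eq_fun do rewrite big_nil; exact: smooth_cst.
under eq_fun do rewrite big_cons; case: (P i) => //.
exact: smooth_mul.
Qed.

Definition entries_smooth V p r (U : set V) (A : V -> 'M[R]_(p, r)) : Prop :=
  forall i j, smooth_on U (fun x => A x i j).

Lemma entries_smooth_cst V p r (U : set V) (A : 'M[R]_(p, r)) :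
  entries_smooth U (fun=> A).
Proof. by move=> i j; exact: smooth_cst. Qed.

Lemma entries_smooth_mul V p r s (U : set V) (A : V -> 'M[R]_(p, r))
    (B : V -> 'M[R]_(r, s)) : open U -> entries_smooth U A ->
  entries_smooth U B -> entries_smooth U (fun x => A x *m B x).
Proof.
move=> oU sA sB i j; under eq_fun do rewrite mxE.
by apply: smooth_bigsum => // l; exact: smooth_mul.
Qed.

Lemma entries_smooth_add V p r (U : set V) (A B : V -> 'M[R]_(p, r)) :
  open U -> entries_smooth U A -> entries_smooth U B ->
  entries_smooth U (fun x => A x + B x).
Proof.
by move=> oU sA sB i j; under eq_fun do rewrite mxE; exact: smooth_add.
Qed.

Lemma entries_smooth_opp V p r (U : set V) (A : V -> 'M[R]_(p, r)) :
  open U -> entries_smooth U A -> entries_smooth U (fun x => - A x).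
Proof.
by move=> oU sA i j; under eq_fun do rewrite mxE; exact: smooth_opp.
Qed.

Lemma smooth_det V p (U : set V) (A : V -> 'M[R]_p) : open U ->
  entries_smooth U A -> smooth_on U (fun x => \det (A x)).
Proof.
move=> oU sA; apply: smooth_bigsum => // s; apply: smooth_mul => //.
  exact: smooth_cst.
exact: smooth_bigprod.
Qed.

Lemma entries_smooth_inv V p (U : set V) (A : V -> 'M[R]_p) : open U ->
  (forall x, U x -> A x \in unitmx) -> entries_smooth U A ->
  entries_smooth U (fun x => invmx (A x)).
Proof.
move=> oU uA sA i j.
apply: (smooth_ext (f := fun x => (\det (A x))^-1 * cofactor (A x) j i) oU).
  by move=> x /uA Ax; rewrite /invmx Ax !mxE.
apply: smooth_mul => //.
  apply: smooth_inv => // [x /uA|]; last exact: smooth_det.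
  by rewrite unitmxE unitfE.
apply: smooth_mul => //; first exact: smooth_cst.
apply: smooth_det => // k l.
rewrite (_ : (fun x => _) = fun x => A x (lift j k) (lift i l)) //.
by apply/funext => x; rewrite !mxE.
Qed.

Lemma smooth_rowP V n (U : set V) (f : V -> 'rV[R]_n) : open U ->
  entries_smooth U f -> smooth_on U f.
Proof. by move=> oU sf k; apply: Ck_mx => // j; exact: sf. Qed.

Lemma smooth_row_entries V n (U : set V) (f : V -> 'rV[R]_n) : open U ->
  smooth_on U f -> entries_smooth U f.
Proof. by move=> oU sf i j k; rewrite (ord1 i); exact: Ck_coord. Qed.

End SmoothAlgebra.

(** * Functions that are smooth near a point *)

Section SmoothAt.
Variable R : realType.
Implicit Types L M N P : manifold R.

(** Local sections, retractions and transports are encoded as total functions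
    of which only the germ at a point is meaningful. *)
Definition smooth_at M N (f : M -> N) (x : M) : Prop :=
  exists i j A, [/\ open A, chart_dom (atlas M i) x,
     A (chart_fwd (atlas M i) x), A `<=` chart_rep_dom (atlas M i) (atlas N j) f &
     smooth_on A (chart_rep (atlas M i) (atlas N j) f)].

Lemma smooth_at_smooth M N (f : M -> N) : (forall x, smooth_at f x) -> smooth f.
Proof. exact: smooth_intro. Qed.

Lemma smooth_smooth_at M N (f : M -> N) : smooth f -> forall x, smooth_at f x.
Proof.
move=> [cf sf] x; pose i := chart_at M x; pose j := chart_at N (f x).
exists i, j, (chart_rep_dom (atlas M i) (atlas N j) f); split => //.
- by apply: chart_rep_open => ? _; exact: cf.
- exact: chart_at_dom.
- split; first by apply: chart_fwd_cod; exact: chart_at_dom.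
  by rewrite chart_fwdK; exact: chart_at_dom.
Qed.

Lemma smooth_map_at M N (f : smooth_map M N) x : smooth_at f x.
Proof. exact: smooth_smooth_at (smooth_funP f) x. Qed.

Lemma chart_dom_nbhs M i (x : M) :
  chart_dom (atlas M i) x -> nbhs x (chart_dom (atlas M i)).
Proof. by move=> ix; exact: open_nbhs_nbhs (conj (chart_dom_open _) ix). Qed.

Lemma chart_cod_nbhs M i z :
  chart_cod (atlas M i) z -> nbhs z (chart_cod (atlas M i)).
Proof. by move=> iz; exact: open_nbhs_nbhs (conj (chart_cod_open _) iz). Qed.

Lemma smooth_at_continuous M N (f : M -> N) x :
  smooth_at f x -> {for x, continuous f}.
Proof.
move=> [i [j [A [oA ix Ax sA sf]]]].
set c := atlas M i in ix Ax sA sf *; set d := atlas N j in sA sf *.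
have c1 := chart_fwd_continuous ix.
have c2 := smooth_cont sf Ax.
have [cz dz] := sA _ Ax.
have c3 : {for chart_rep c d f (chart_fwd c x), continuous (chart_bwd d)}.
  by apply: chart_bwd_continuous; exact: chart_fwd_cod.
have := continuous_comp c1 (continuous_comp c2 c3).
have E0 : ((chart_bwd d \o chart_rep c d f) \o chart_fwd c) x = f x.
  by move: dz; rewrite /= /chart_rep (chart_fwdK ix) => /chart_fwdK.
rewrite /prop_for /continuous_at E0.
apply: cvg_trans; apply: near_eq_cvg.
have nx : nbhs x (chart_dom c `&` chart_fwd c @^-1` A).
  exact: filterI (chart_dom_nbhs ix) (c1 _ (open_nbhs_nbhs (conj oA Ax))).
apply: filterS nx => y [cy Ay] /=.
have [_] := sA _ Ay.
by rewrite /= /chart_rep (chart_fwdK cy) => /chart_fwdK.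
Qed.

Lemma smooth_at_near M N (f : M -> N) x :
  smooth_at f x -> \forall y \near x, smooth_at f y.
Proof.
move=> [i [j [A [oA ix Ax sA sf]]]].
have nx : nbhs x (chart_dom (atlas M i) `&` chart_fwd (atlas M i) @^-1` A).
  apply: filterI (chart_dom_nbhs ix) _.
  exact: (chart_fwd_continuous ix (open_nbhs_nbhs (conj oA Ax))).
by apply: filterS nx => y [iy Ay]; exists i, j, A; split.
Qed.

Lemma chart_fwd_nbhs M i (x : M) (B : set M) : chart_dom (atlas M i) x ->
  nbhs x B -> nbhs (chart_fwd (atlas M i) x) (chart_bwd (atlas M i) @^-1` B).
Proof.
move=> ix nB; have c := chart_bwd_continuous (chart_fwd_cod ix).
by apply: c; rewrite chart_fwdK.
Qed.

Lemma chart_bwd_preimage_open M i (B : set M) : open B ->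
  open (chart_cod (atlas M i) `&` chart_bwd (atlas M i) @^-1` B).
Proof.
move=> oB; rewrite openE => z [cz Bz]; apply: filterI; first exact: chart_cod_nbhs.
exact: (chart_bwd_continuous cz (open_nbhs_nbhs (conj oB Bz))).
Qed.

Lemma nbhs_open (X : topologicalType) (x : X) (A : set X) :
  nbhs x A -> exists B, [/\ open B, B x & B `<=` A].
Proof. by rewrite nbhsE => -[B [oB Bx] sB]; exists B. Qed.

Lemma smooth_at_ext M N (f g : M -> N) x :
  (\forall y \near x, f y = g y) -> smooth_at f x -> smooth_at g x.
Proof.
move=> fg [i [j [A [oA ix Ax sA sf]]]].
have [B [oB Bx sB]] := nbhs_open (chart_fwd_nbhs ix fg).
exists i, j, (A `&` B); split => //; first exact: openI.
  move=> z [Az /sB /= fgz]; have [iz] := sA _ Az.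
  by rewrite fgz.
apply: (smooth_ext (openI oA oB) _ (smooth_sub _ sf)) => z []// Az /sB /= fgz.
by rewrite /chart_rep fgz.
Qed.

(** The transition maps of both atlases are smooth, so the charts that witness
    smoothness may be exchanged for any others around the two points. *)
Lemma smooth_at_charts M N (f : M -> N) x i' j' : smooth_at f x ->
  chart_dom (atlas M i') x -> chart_dom (atlas N j') (f x) ->
  exists A, [/\ open A, A (chart_fwd (atlas M i') x),
     A `<=` chart_rep_dom (atlas M i') (atlas N j') f &
     smooth_on A (chart_rep (atlas M i') (atlas N j') f)].
Proof.
move=> sfx ix' jx'; have cfx := smooth_at_continuous sfx.
have [i [j [A [oA ix Ax sA sf]]]] := sfx.
pose c := atlas M i; pose d := atlas N j.
pose c' := atlas M i'; pose d' := atlas N j'.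
have oI : open (chart_rep_dom c' c id) := @trans_open _ M i' i.
have sI : smooth_on (chart_rep_dom c' c id) (chart_rep c' c id) := @atlas_smooth _ M _ _.
have oJ : open (chart_rep_dom d d' id) := @trans_open _ N j j'.
have sJ : smooth_on (chart_rep_dom d d' id) (chart_rep d d' id) := @atlas_smooth _ N _ _.
have nB : nbhs (chart_fwd c' x) (chart_rep_dom c' c id `&`
    chart_rep c' c id @^-1` A `&` (chart_bwd c' @^-1` (f @^-1` chart_dom d'))).
  have rx : chart_rep_dom c' c id (chart_fwd c' x).
    by split; [exact: chart_fwd_cod|rewrite /= chart_fwdK].
  apply: filterI; first apply: filterI.
  - exact: open_nbhs_nbhs (conj oI rx).
  - apply: (smooth_cont sI rx); rewrite /chart_rep chart_fwdK//.
    exact: open_nbhs_nbhs (conj oA Ax).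
  - by apply: chart_fwd_nbhs => //; exact: cfx (chart_dom_nbhs jx').
have [B [oB Bx sB]] := nbhs_open nB.
have BE y : B y -> chart_rep c d f (chart_rep c' c id y) = chart_rep c' d f y.
  by move=> /sB[[ry _] _]; exact: chart_repK.
have BE' y : B y -> chart_dom d (f (chart_bwd c' y)).
  by move=> /sB[[[_ ry] /sA[_]] +] _; rewrite /chart_rep chart_fwdK.
exists B; split => //; first by move=> y /sB[[[]]].
have s1 : smooth_on B (chart_rep c d f \o chart_rep c' c id).
  apply: (smooth_on_comp oB oA _ (smooth_sub _ sI) sf); first by move=> y /sB[[]].
  by move=> y /sB[[]].
have s2 : smooth_on B (chart_rep d d' id \o (chart_rep c d f \o chart_rep c' c id)).
  apply: (smooth_on_comp oB oJ _ s1 sJ) => y By; rewrite /= BE//.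
  have dy := BE' _ By; split; first exact: chart_fwd_cod.
  by rewrite /chart_rep chart_fwdK//; case: (sB _ By).
apply: smooth_ext oB _ s2 => y By; rewrite /= BE// /chart_rep chart_fwdK//.
exact: BE'.
Qed.

Lemma smooth_at_comp M N P (g : N -> P) (f : M -> N) x :
  smooth_at f x -> smooth_at g (f x) -> smooth_at (g \o f) x.
Proof.
move=> sfx sgx.
pose i := chart_at M x; pose j := chart_at N (f x); pose k := chart_at P (g (f x)).
have ix : chart_dom (atlas M i) x := chart_at_dom x.
have jx : chart_dom (atlas N j) (f x) := chart_at_dom _.
have kx : chart_dom (atlas P k) (g (f x)) := chart_at_dom _.
have [A [oA Ax sA sf]] := smooth_at_charts sfx ix jx.
have [B [oB Bx sB sg]] := smooth_at_charts sgx jx kx.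
set F := chart_rep _ _ f in sf; set G := chart_rep _ _ g in sg.
have nC : nbhs (chart_fwd (atlas M i) x) (A `&` F @^-1` B).
  apply: filterI; first exact: open_nbhs_nbhs.
  apply: (smooth_cont sf Ax); apply: open_nbhs_nbhs; split => //.
  by rewrite /F /chart_rep chart_fwdK.
have [C [oC Cx sC]] := nbhs_open nC.
have CE z : C z -> G (F z) = chart_rep (atlas M i) (atlas P k) (g \o f) z.
  by move=> /sC[/sA Az _]; exact: chart_repK.
exists i, k, C; split => //.
  move=> z Cz; have [/sA[iz jz] /sB[_]] := sC _ Cz.
  by rewrite /F /chart_rep chart_fwdK.
apply: (smooth_ext (f := G \o F) oC) => [z Cz|]; first exact: CE.
by apply: (smooth_on_comp oC oB _ (smooth_sub _ sf) sg) => z /sC[].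
Qed.

Lemma smooth_at_pair L M N (f : L -> M) (g : L -> N) x :
  smooth_at f x -> smooth_at g x ->
  smooth_at (fun y => (f y, g y) : prod_manifold M N) x.
Proof.
move=> sf sg; have ix := chart_at_dom x.
have [A [oA Ax sA {}sf]] := smooth_at_charts sf ix (chart_at_dom (f x)).
have [B [oB Bx sB {}sg]] := smooth_at_charts sg ix (chart_at_dom (g x)).
exists (chart_at L x), (chart_at M (f x), chart_at N (g x)), (A `&` B).
have oAB := openI oA oB.
split => //; first by move=> z [/sA[? ?] /sB[? ?]].
by apply: (smooth_row_mx oAB); [apply: smooth_sub sf|apply: smooth_sub sg] => z [].
Qed.

Lemma smooth_at_cst M N (y : N) x : smooth_at (fun _ : M => y) x.
Proof.
have ix := chart_at_dom x; have jy := chart_at_dom y.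
exists (chart_at M x), (chart_at N y), (chart_cod (atlas M (chart_at M x))).
split; [exact: chart_cod_open|exact: ix|exact: chart_fwd_cod|by move=> z iz; split|].
exact: smooth_cst.
Qed.

Definition smooth_map_cst M N (y : N) : smooth_map M N :=
  SmoothMap (smooth_at_smooth (@smooth_at_cst M N y)).

Lemma smooth_at_id M x : smooth_at (@id M) x.
Proof. exact: smooth_smooth_at (smooth_id M) x. Qed.

Lemma smooth_at_fst M N x : smooth_at (fst : prod_manifold M N -> M) x.
Proof.
pose i : atlas_index (prod_manifold M N) := chart_at _ x.
exists i, i.1, (@prod_cod R M N i); split.
- exact: (@prod_cod_open R M N i).
- exact: (@chart_at_dom _ (prod_manifold M N) x).
- exact: (prod_fwd_cod (@chart_at_dom _ (prod_manifold M N) x)).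
- by move=> z iz; split => //; case: (prod_bwd_dom iz).
- apply: (smooth_ext (@prod_cod_open R M N i) _ (@smooth_lsubmx _ _ _ _)) => z [iz jz].
  by rewrite /chart_rep /= chart_bwdK.
Qed.

Lemma smooth_at_snd M N x : smooth_at (snd : prod_manifold M N -> N) x.
Proof.
pose i : atlas_index (prod_manifold M N) := chart_at _ x.
exists i, i.2, (@prod_cod R M N i); split.
- exact: (@prod_cod_open R M N i).
- exact: (@chart_at_dom _ (prod_manifold M N) x).
- exact: (prod_fwd_cod (@chart_at_dom _ (prod_manifold M N) x)).
- by move=> z iz; split => //; case: (prod_bwd_dom iz).
- apply: (smooth_ext (@prod_cod_open R M N i) _ (@smooth_rsubmx _ _ _ _)) => z [iz jz].
  by rewrite /chart_rep /= chart_bwdK.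
Qed.

Definition smooth_map_fst M N : smooth_map (prod_manifold M N) M :=
  SmoothMap (smooth_at_smooth (@smooth_at_fst M N)).

Definition smooth_map_snd M N : smooth_map (prod_manifold M N) N :=
  SmoothMap (smooth_at_smooth (@smooth_at_snd M N)).

End SmoothAt.

(** * Euclidean spaces *)

Section Euclidean.
Variables (R : realType).

Definition euclidean_chart n : local_chart R 'rV[R]_n :=
  @LocalChart R 'rV[R]_n n setT setT id id openT openT (fun x h => h)
    (fun x h => h) (fun _ _ => erefl) (fun _ _ => erefl)
    (fun x _ => @continuous_for_id 'rV[R]_n x)
    (fun x _ => @continuous_for_id 'rV[R]_n x).

Lemma euclidean_second_countable n : @second_countable 'rV[R]_n.
Proof.
exists (@rat_box R n @` setT).
  by apply: sub_countable; [exact: card_image_le|exact: countableP].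
split; first by move=> _ [ab _ <-]; exact: rat_box_open.
move=> z A nA; rewrite nbhs_filterE; have [ab abz abA] := rat_box_basis nA.
by exists (rat_box ab) => //; split => //; exists ab.
Qed.

Lemma euclidean_atlas_smooth n (i j : unit) :
  smooth_on (chart_rep_dom (euclidean_chart n) (euclidean_chart n) id)
    (chart_rep (euclidean_chart n) (euclidean_chart n) id).
Proof. exact: (@smooth_linear R _ n _ idfun). Qed.

Definition euclidean n : manifold R :=
  @Manifold R 'rV[R]_n unit (fun=> euclidean_chart n) (fun=> tt) (fun=> Logic.I)
    (@euclidean_atlas_smooth n) (@norm_hausdorff _ 'rV[R]_n)
    (@euclidean_second_countable n).

Lemma smooth_on_at n m (U : set 'rV[R]_n) (f : 'rV[R]_n -> 'rV[R]_m) x :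
  open U -> U x -> smooth_on U f -> @smooth_at R (euclidean n) (euclidean m) f x.
Proof. by move=> oU Ux sf; exists tt, tt, U; split. Qed.

Lemma smooth_at_on n m (U : set 'rV[R]_n) (f : 'rV[R]_n -> 'rV[R]_m) :
  (forall x, U x -> @smooth_at R (euclidean n) (euclidean m) f x) -> smooth_on U f.
Proof.
move=> sf; apply: smooth_glue => x Ux.
by have [A [_ Ax _ sA]] := @smooth_at_charts _ (euclidean n) (euclidean m) f x tt tt
  (sf x Ux) Logic.I Logic.I; exists A.
Qed.

Variable M : manifold R.
Implicit Type i : atlas_index M.

Lemma chart_fwd_smooth i x : chart_dom (atlas M i) x ->
  @smooth_at R M (euclidean _) (chart_fwd (atlas M i)) x.
Proof.
move=> ix; exists i, tt, (chart_cod (atlas M i)).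
split=> //; [exact: chart_cod_open|exact: chart_fwd_cod|].
have o := chart_cod_open (atlas M i).
apply: (smooth_ext (f := id) o) => [z iz|].
  by rewrite /chart_rep /= chart_bwdK.
exact: (@smooth_linear R _ _ _ idfun).
Qed.

Lemma chart_bwd_smooth i z : chart_cod (atlas M i) z ->
  @smooth_at R (euclidean _) M (chart_bwd (atlas M i)) z.
Proof.
move=> iz; exists tt, i, (chart_cod (atlas M i)).
have o := chart_cod_open (atlas M i).
split=> //; first by move=> w iw; split => //; exact: chart_bwd_dom.
apply: (smooth_ext (f := id) o) => [w iw|].
  by rewrite /chart_rep /= chart_bwdK.
exact: (@smooth_linear R _ _ _ idfun).
Qed.

Lemma smooth_at_row_mx n m (f : M -> 'rV[R]_n) (g : M -> 'rV[R]_m) x :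
  @smooth_at R M (euclidean n) f x -> @smooth_at R M (euclidean m) g x ->
  @smooth_at R M (euclidean (n + m)) (fun y => row_mx (f y) (g y)) x.
Proof.
move=> sf sg; have ix := chart_at_dom x.
have [A [oA Ax sA {}sf]] := @smooth_at_charts _ _ (euclidean n) _ _ _ tt sf ix Logic.I.
have [B [oB Bx sB {}sg]] := @smooth_at_charts _ _ (euclidean m) _ _ _ tt sg ix Logic.I.
exists (chart_at M x), tt, (A `&` B); have oAB := openI oA oB.
split => //; first by move=> z [/sA[? _] _]; split.
by apply: (smooth_row_mx oAB); [apply: smooth_sub sf|apply: smooth_sub sg] => z [].
Qed.

Lemma smooth_at_linear n m (L : {linear 'rV[R]_n -> 'rV[R]_m}) x :
  @smooth_at R (euclidean n) (euclidean m) L x.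
Proof. exact: smooth_on_at (@openT _) Logic.I (@smooth_linear R _ _ setT L). Qed.

End Euclidean.

(** * The tangent functor on germs *)

Section TangentAt.
Variable R : realType.
Implicit Types L M N P : manifold R.

Lemma diff_near_eq (V W : normedModType R) (f g : V -> W) z v :
  (\near z, f z = g z) -> differentiable f z -> 'd f z v = 'd g z v.
Proof. by move=> fg df; have [_ ->] := near_diff fg df. Qed.

Lemma smooth_at_diff M N (f : M -> N) x i j : smooth_at f x ->
  chart_dom (atlas M i) x -> chart_dom (atlas N j) (f x) ->
  differentiable (chart_rep (atlas M i) (atlas N j) f) (chart_fwd (atlas M i) x).
Proof.
move=> sf ix jx; have [A [_ Ax _ sA]] := smooth_at_charts sf ix jx.
exact: smooth_diffble sA Ax.
Qed.

Lemma diff_rep_comp M N P (f : M -> N) (g : N -> P) x i j k v :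
  smooth_at f x -> smooth_at g (f x) ->
  chart_dom (atlas M i) x -> chart_dom (atlas N j) (f x) ->
  chart_dom (atlas P k) (g (f x)) ->
  'd (chart_rep (atlas N j) (atlas P k) g) (chart_fwd (atlas N j) (f x))
    ('d (chart_rep (atlas M i) (atlas N j) f) (chart_fwd (atlas M i) x) v)
  = 'd (chart_rep (atlas M i) (atlas P k) (g \o f)) (chart_fwd (atlas M i) x) v.
Proof.
move=> sf sg ix jx kx.
have d1 := smooth_at_diff sf ix jx; have d2 := smooth_at_diff sg jx kx.
have [A [oA Ax sA _]] := smooth_at_charts sf ix jx.
have E : chart_rep (atlas M i) (atlas N j) f (chart_fwd (atlas M i) x)
    = chart_fwd (atlas N j) (f x) by rewrite /chart_rep chart_fwdK.
rewrite -E in d2 *.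
have nE : \forall z \near chart_fwd (atlas M i) x,
    (chart_rep (atlas N j) (atlas P k) g \o chart_rep (atlas M i) (atlas N j) f) z
    = chart_rep (atlas M i) (atlas P k) (g \o f) z.
  apply: filterS (open_nbhs_nbhs (conj oA Ax)) => z /sA rz /=.
  exact: chart_repK.
have [_ ->] := near_diff nE (differentiable_comp d1 d2).
by rewrite (diff_comp d1 d2).
Qed.

(** T is a functor on germs of smooth functions, so local constructions can be
    differentiated without passing to open submanifolds. *)
Lemma tangent_fun_comp M N P (g : N -> P) (f : M -> N) (t : tangent_bundle M) :
  smooth_at f (tangent_base t) -> smooth_at g (f (tangent_base t)) ->
  tangent_fun (g \o f) t = tangent_fun g (tangent_fun f t).
Proof.
move=> sf sg; rewrite {1}/tangent_fun [in RHS]/tangent_fun /=; congr TangentVector.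
by apply: esym; apply: diff_rep_comp => //; exact: chart_at_dom.
Qed.

Lemma tangent_fun_id M (t : tangent_bundle M) : tangent_fun id t = t.
Proof.
by case: t => x v; rewrite /tangent_fun /= diff_chart_id//; exact: chart_at_dom.
Qed.

Lemma tangent_fun_coord_at M N (f : M -> N) i j (t : tangent_bundle M) :
  smooth_at f (tangent_base t) ->
  tangent_dom i t -> chart_dom (atlas N j) (f (tangent_base t)) ->
  tangent_coord j (tangent_fun f t) =
  'd (chart_rep (atlas M i) (atlas N j) f) (chart_fwd (atlas M i) (tangent_base t))
    (tangent_coord i t).
Proof.
move=> sf it jt; rewrite /tangent_coord /=.
have ct := chart_at_dom (tangent_base t).
rewrite (diff_rep_comp (f := f) (g := id)) //; try exact: chart_at_dom;
  last exact: smooth_at_id.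
by rewrite (diff_rep_comp (f := id) (g := f)) //; exact: smooth_at_id.
Qed.

Lemma tangent_fun_ext M N (f g : M -> N) (t : tangent_bundle M) :
  smooth_at f (tangent_base t) -> (\forall y \near tangent_base t, f y = g y) ->
  tangent_fun f t = tangent_fun g t.
Proof.
move=> sf fg; have E := nbhs_singleton fg.
have sg := smooth_at_ext fg sf; set x := tangent_base t in sf fg E sg *.
pose i := chart_at M x; pose j := chart_at N (f x).
have it : tangent_dom i t := chart_at_dom x.
have jf : chart_dom (atlas N j) (f x) := chart_at_dom _.
have jg : chart_dom (atlas N j) (g x) by rewrite -E.
apply: (@tangent_inj _ _ j) => //.
rewrite (tangent_fun_coord_at sf it jf) (tangent_fun_coord_at sg it jg).
have nE : \forall z \near chart_fwd (atlas M i) x,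
    chart_rep (atlas M i) (atlas N j) f z = chart_rep (atlas M i) (atlas N j) g z.
  by apply: filterS (chart_fwd_nbhs it fg) => z /= fgz; rewrite /chart_rep fgz.
exact: diff_near_eq nE (smooth_at_diff sf it jf).
Qed.

Lemma near_tangent M (t : tangent_bundle M) (Q : M -> Prop) :
  (\forall x \near tangent_base t, Q x) ->
  \forall u \near t, Q (tangent_base u).
Proof. exact: tangent_base_continuous. Qed.

Lemma near_near (X : topologicalType) (x : X) (Q : X -> Prop) :
  (\forall y \near x, Q y) -> \forall y \near x, \forall z \near y, Q z.
Proof. by move=> /nbhs_interior. Qed.

Lemma tangent_fun_smooth_at M N (f : M -> N) (t : tangent_bundle M) :
  smooth_at f (tangent_base t) ->
  smooth_at (tangent_fun f : tangent_bundle M -> tangent_bundle N) t.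
Proof.
move=> sf; set x := tangent_base t.
pose i := chart_at M x; pose j := chart_at N (f x).
have ix : chart_dom (atlas M i) x := chart_at_dom x.
have jx : chart_dom (atlas N j) (f x) := chart_at_dom _.
have [A0 [oA0 Ax0 sA0 sFA0]] := smooth_at_charts sf ix jx.
set F := chart_rep (atlas M i) (atlas N j) f in sFA0.
have nA : nbhs (chart_fwd (atlas M i) x)
    (A0 `&` (chart_bwd (atlas M i) @^-1` smooth_at f)).
  apply: filterI; first exact: open_nbhs_nbhs.
  exact: chart_fwd_nbhs ix (smooth_at_near sf).
have [A [oA Ax sA]] := nbhs_open nA.
have sF : smooth_on A F by apply: smooth_sub sFA0 => z /sA[].
pose D := [set z : 'rV[R]_(chart_dim (atlas M i) + chart_dim (atlas M i)) |
  A (lsubmx z)].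
have oD : open D := open_lsubmx oA.
exists i, j, D; split; [exact: oD|exact: ix| | |].
- by rewrite /D /= row_mxKl.
- by move=> z /sA[/sA0[]].
- apply: (smooth_ext (f := fun z => row_mx (F (lsubmx z))
    ('d F (lsubmx z) (rsubmx z))) oD) => [z /sA[/sA0[iz jz] sz]|].
    have itz : tangent_dom i (tangent_bwd i z) := chart_bwd_dom iz.
    have {}sz : smooth_at f (tangent_base (tangent_bwd i z)) := sz.
    rewrite /chart_rep /= /tangent_fwd (tangent_fun_coord_at sz itz jz).
    rewrite (tangent_coord_bwd iz).
    have -> // : chart_fwd (atlas M i) (tangent_base (tangent_bwd i z)) = lsubmx z.
    exact: chart_bwdK.
  apply: (smooth_row_mx oD); last exact: smooth_tangent oA sF.
  by apply: (smooth_on_comp oD oA _ (@smooth_lsubmx _ _ _ _) sF).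
Qed.

Lemma tangent_fun0 M N (f : M -> N) x :
  tangent_fun f (tangent_zero M x) = tangent_zero N (f x).
Proof. by rewrite /tangent_fun /= linear0. Qed.

(** The comparison TM x TN -> T(M x N), inverse to (T fst, T snd). It has this
    form because the preferred charts of a product are products of preferred
    charts. *)
Definition tpair M N (t : tangent_bundle M) (u : tangent_bundle N) :
    tangent_bundle (prod_manifold M N) :=
  @TangentVector R (prod_manifold M N) (tangent_base t, tangent_base u)
    (row_mx (tangent_vec t) (tangent_vec u)).

Local Notation Tfst := (@tangent_fun R (prod_manifold _ _) _ fst).
Local Notation Tsnd := (@tangent_fun R (prod_manifold _ _) _ snd).

Lemma is_diff_near_linear n m (F : 'rV[R]_n -> 'rV[R]_m)
    (L : {linear 'rV[R]_n -> 'rV[R]_m}) z v :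
  (\forall y \near z, L y = F y) -> 'd F z v = L v.
Proof.
move=> nE; have cL : continuous L by exact: linear_rV_continuous.
by have [_ ->] := near_diff nE (linear_differentiable z cL); rewrite diff_lin.
Qed.

Lemma tangent_fst_coord M N ij (t : tangent_bundle (prod_manifold M N)) :
  tangent_dom ij t ->
  tangent_coord ij.1 (Tfst t) = lsubmx (tangent_coord ij t).
Proof.
move=> it; have [i1 i2] := it.
rewrite (tangent_fun_coord_at (@smooth_at_fst _ _ _ _) it)//.
apply: (@is_diff_near_linear _ _ _ (@lsubmx _ _ _ _)).
apply: filterS (chart_cod_nbhs (chart_fwd_cod it)) => z [iz jz].
by rewrite /chart_rep /= chart_bwdK.
Qed.

Lemma tangent_snd_coord M N ij (t : tangent_bundle (prod_manifold M N)) :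
  tangent_dom ij t ->
  tangent_coord ij.2 (Tsnd t) = rsubmx (tangent_coord ij t).
Proof.
move=> it; have [i1 i2] := it.
rewrite (tangent_fun_coord_at (@smooth_at_snd _ _ _ _) it)//.
apply: (@is_diff_near_linear _ _ _ (@rsubmx _ _ _ _)).
apply: filterS (chart_cod_nbhs (chart_fwd_cod it)) => z [iz jz].
by rewrite /chart_rep /= chart_bwdK.
Qed.

Lemma tpair_fst M N (t : tangent_bundle M) (u : tangent_bundle N) :
  Tfst (tpair t u) = t.
Proof.
pose ij := chart_at (prod_manifold M N) (tangent_base t, tangent_base u).
have it : tangent_dom ij (tpair t u) := chart_at_dom _.
apply: (@tangent_inj _ _ ij.1); [exact: chart_at_dom|by []|].
rewrite (tangent_fst_coord it).
have -> : tangent_coord ij (tpair t u) = row_mx (tangent_vec t) (tangent_vec u).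
  exact: tangent_vec_coord.
rewrite row_mxKl; case: t {it} @ij => y v ij; exact: esym (tangent_vec_coord v).
Qed.

Lemma tpair_snd M N (t : tangent_bundle M) (u : tangent_bundle N) :
  Tsnd (tpair t u) = u.
Proof.
pose ij := chart_at (prod_manifold M N) (tangent_base t, tangent_base u).
have it : tangent_dom ij (tpair t u) := chart_at_dom _.
apply: (@tangent_inj _ _ ij.2); [exact: chart_at_dom|by []|].
rewrite (tangent_snd_coord it).
have -> : tangent_coord ij (tpair t u) = row_mx (tangent_vec t) (tangent_vec u).
  exact: tangent_vec_coord.
rewrite row_mxKr; case: u {it} @ij => y v ij; exact: esym (tangent_vec_coord v).
Qed.

Lemma tpair_inj M N (t u : tangent_bundle (prod_manifold M N)) :
  Tfst t = Tfst u ->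
  Tsnd t = Tsnd u -> t = u.
Proof.
move=> E1 E2; set ij := chart_at _ (tangent_base t).
have it : tangent_dom ij t := chart_at_dom _.
have bE : tangent_base t = tangent_base u.
  have e1 := congr1 (@tangent_base _ _) E1; have e2 := congr1 (@tangent_base _ _) E2.
  by rewrite [LHS]surjective_pairing [RHS]surjective_pairing; congr pair.
have iu : tangent_dom ij u by rewrite /tangent_dom /= -bE.
apply: (tangent_inj it bE).
rewrite -[LHS]hsubmxK -[RHS]hsubmxK -!tangent_fst_coord// -!tangent_snd_coord//.
by rewrite E1 E2.
Qed.

Lemma tangent_fun_pair L M N (f : L -> M) (g : L -> N) (t : tangent_bundle L) :
  smooth_at f (tangent_base t) -> smooth_at g (tangent_base t) ->
  tangent_fun ((fun x => (f x, g x)) : L -> prod_manifold M N) t =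
  tpair (tangent_fun f t) (tangent_fun g t).
Proof.
move=> sf sg; have sp := smooth_at_pair sf sg.
apply: tpair_inj; rewrite ?tpair_fst ?tpair_snd.
  by rewrite -tangent_fun_comp//; exact: smooth_at_fst.
by rewrite -tangent_fun_comp//; exact: smooth_at_snd.
Qed.

Lemma smooth_at_tpair M N (z : prod_manifold (tangent_bundle M) (tangent_bundle N)) :
  smooth_at ((fun z => tpair z.1 z.2) :
    prod_manifold (tangent_bundle M) (tangent_bundle N) ->
    tangent_bundle (prod_manifold M N)) z.
Proof.
pose ij : atlas_index (prod_manifold M N) :=
  (chart_at M (tangent_base z.1), chart_at N (tangent_base z.2)).
exists (ij : atlas_index (prod_manifold (tangent_bundle M) (tangent_bundle N))).
exists ij, (@prod_cod R (tangent_bundle M) (tangent_bundle N) ij).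
have o := @prod_cod_open R (tangent_bundle M) (tangent_bundle N) ij.
have iz : prod_dom (M := tangent_bundle M) (N := tangent_bundle N) ij z.
  by split; exact: chart_at_dom.
split.
- exact: o.
- exact: iz.
- exact: prod_fwd_cod iz.
- move=> w [/= iw jw]; split => //; split; exact: chart_bwd_dom.
- pose n := chart_dim (atlas M ij.1); pose m := chart_dim (atlas N ij.2).
  apply: (smooth_ext (f := fun w : 'rV[R]_((n + n) + (m + m)) =>
    row_mx (row_mx (lsubmx (lsubmx w)) (lsubmx (rsubmx w)))
      (row_mx (rsubmx (lsubmx w)) (rsubmx (rsubmx w)))) o) => [w [iw jw]|].
    have iw' := tangent_bwd_dom iw; have jw' := tangent_bwd_dom jw.
    have id : tangent_dom ij (tpair (tangent_bwd ij.1 (lsubmx w))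
       (tangent_bwd ij.2 (rsubmx w))) by [].
    rewrite /chart_rep /= /tangent_fwd; congr row_mx.
      by rewrite /= /prod_fwd /= !chart_bwdK.
    rewrite -[RHS]hsubmxK -tangent_fst_coord// -tangent_snd_coord//.
    by rewrite tpair_fst tpair_snd !tangent_coord_bwd.
  have sL (k : nat) (L : {linear 'rV[R]_((n + n) + (m + m)) -> 'rV[R]_k}) :
    smooth_on (@prod_cod R (tangent_bundle M) (tangent_bundle N) ij) L.
    exact: smooth_linear.
  do ! apply: (smooth_row_mx o).
  + exact: sL (lsubmx \o lsubmx).
  + exact: sL (lsubmx \o rsubmx).
  + exact: sL (rsubmx \o lsubmx).
  + exact: sL (rsubmx \o rsubmx).
Qed.

End TangentAt.

(** * Fibrewise linear combinations of tangent vectors *)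

Section FibrewiseCombination.
Variable R : realType.
Implicit Types M N X : manifold R.

(** The vector u is read in the preferred chart of the base point of t, so that
    no transport between tangent spaces at provably equal points is needed. *)
Definition tcomb M (a b : R) (t u : tangent_bundle M) : tangent_bundle M :=
  TangentVector (tangent_base := tangent_base t)
    (a *: tangent_vec t + b *: tangent_coord (chart_at M (tangent_base t)) u).

Lemma tcomb_coord M (a b : R) i (t u : tangent_bundle M) :
  tangent_dom i t -> tangent_base t = tangent_base u ->
  tangent_coord i (tcomb a b t u) =
  a *: tangent_coord i t + b *: tangent_coord i u.
Proof.
case: t u => [x v] [y w] it /= xy; case: _ / xy in w *.
rewrite /tcomb /= tangent_vec_coord /tangent_coord /=.
by rewrite linearD !linearZ.
Qed.

(** The same combination computed in a fixed chart; it makes sense, and is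
    smooth, also for vectors at different points. *)
Definition chart_comb M i (a b : R) (t u : tangent_bundle M) : tangent_bundle M :=
  tangent_bwd i (row_mx (chart_fwd (atlas M i) (tangent_base t))
    (a *: tangent_coord i t + b *: tangent_coord i u)).

Lemma chart_combE M i (a b : R) (t u : tangent_bundle M) :
  tangent_dom i t -> tangent_base t = tangent_base u ->
  chart_comb i a b t u = tcomb a b t u.
Proof.
move=> it tu; rewrite /chart_comb -tcomb_coord//.
exact: (@tangent_fwdK _ _ i (tcomb a b t u) it).
Qed.

Lemma smooth_at_chart_comb X M i (a b : R) (f g : X -> tangent_bundle M) x :
  smooth_at f x -> smooth_at g x -> tangent_dom i (f x) -> tangent_dom i (g x) ->
  smooth_at (fun y => chart_comb i a b (f y) (g y)) x.
Proof.
move=> sf sg fi gi; pose n := chart_dim (atlas M i).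
pose H (w : 'rV[R]_((n + n) + (n + n))) : 'rV[R]_(n + n) :=
  row_mx (lsubmx (lsubmx w)) (a *: rsubmx (lsubmx w) + b *: rsubmx (rsubmx w)).
have sH w : @smooth_at R (euclidean _ _) (euclidean _ _) H w.
  apply: (@smooth_on_at R _ _ setT) => //; first exact: openT.
  apply: smooth_row_mx; first exact: openT.
    exact: (@smooth_linear R _ _ _ (lsubmx \o lsubmx)).
  apply: smooth_add; first exact: openT.
    exact: (@smooth_linear R _ _ _ (a \*: (rsubmx \o lsubmx))).
  exact: (@smooth_linear R _ _ _ (b \*: (rsubmx \o rsubmx))).
have sF : @smooth_at R X (euclidean _ _)
    (fun y => row_mx (tangent_fwd i (f y)) (tangent_fwd i (g y))) x.
  apply: smooth_at_row_mx.
    exact: smooth_at_comp sf (@chart_fwd_smooth _ (tangent_bundle M) i _ fi).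
  exact: smooth_at_comp sg (@chart_fwd_smooth _ (tangent_bundle M) i _ gi).
have HE y : H (row_mx (tangent_fwd i (f y)) (tangent_fwd i (g y))) =
    row_mx (chart_fwd (atlas M i) (tangent_base (f y)))
      (a *: tangent_coord i (f y) + b *: tangent_coord i (g y)).
  by rewrite /H /tangent_fwd !(row_mxKl, row_mxKr).
have ci : tangent_cod i (H (row_mx (tangent_fwd i (f x)) (tangent_fwd i (g x)))).
  by rewrite HE /tangent_cod /= row_mxKl; exact: chart_fwd_cod.
have := smooth_at_comp (smooth_at_comp sF (sH _))
  (@chart_bwd_smooth _ (tangent_bundle M) i _ ci).
apply: smooth_at_ext; near=> y; by rewrite /chart_comb -HE.
Unshelve. all: by end_near. Qed.

Lemma smooth_at_tcomb X M (a b : R) (f g : X -> tangent_bundle M) x :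
  smooth_at f x -> smooth_at g x ->
  (\forall y \near x, tangent_base (f y) = tangent_base (g y)) ->
  smooth_at (fun y => tcomb a b (f y) (g y)) x.
Proof.
move=> sf sg fg; have E := nbhs_singleton fg.
pose i := chart_at M (tangent_base (f x)).
have fi : tangent_dom i (f x) := chart_at_dom _.
have gi : tangent_dom i (g x) by rewrite /tangent_dom /= -E.
apply: (smooth_at_ext _ (smooth_at_chart_comb a b sf sg fi gi)).
have nx : nbhs x (f @^-1` tangent_dom i).
  by apply: (smooth_at_continuous sf); exact: (@chart_dom_nbhs _ (tangent_bundle M) i).
by apply: filterS2 nx fg => y iy ey; exact: chart_combE.
Qed.

Lemma tangent_fun_tcomb M N (a b : R) (f : M -> N) (t u : tangent_bundle M) :
  smooth_at f (tangent_base t) -> tangent_base t = tangent_base u ->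
  tangent_fun f (tcomb a b t u) = tcomb a b (tangent_fun f t) (tangent_fun f u).
Proof.
move=> sf tu; have su : smooth_at f (tangent_base u) by rewrite -tu.
pose i := chart_at M (tangent_base t); pose j := chart_at N (f (tangent_base t)).
have it : tangent_dom i t := chart_at_dom _.
have iu : tangent_dom i u by rewrite /tangent_dom /= -tu.
have jt : chart_dom (atlas N j) (f (tangent_base t)) := chart_at_dom _.
have ju : chart_dom (atlas N j) (f (tangent_base u)) by rewrite -tu.
apply: (@tangent_inj _ _ j) => //.
rewrite tcomb_coord//=; last by rewrite tu.
rewrite (@tangent_fun_coord_at _ _ _ f i j (tcomb a b t u) sf it jt) /= tcomb_coord//.
rewrite (tangent_fun_coord_at sf it jt) (tangent_fun_coord_at su iu ju) -tu.
by rewrite linearD !linearZ.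
Qed.

Lemma tcomb0 M (a b : R) x y :
  tcomb a b (tangent_zero M x) (tangent_zero M y) = tangent_zero M x.
Proof. by rewrite /tcomb /= tangent_coord0 !scaler0 addr0. Qed.

Lemma tangent_vectorE M (t u : tangent_bundle M) :
  tangent_base t = tangent_base u ->
  u = TangentVector (tangent_coord (chart_at M (tangent_base t)) u).
Proof.
by case: t u => [x v] [y w] /= xy; case: _ / xy in w *; rewrite tangent_vec_coord.
Qed.

Section SameBase.
Variables (M : manifold R) (t u v : tangent_bundle M).
Hypothesis tu : tangent_base t = tangent_base u.
Hypothesis tv : tangent_base t = tangent_base v.
Let i := chart_at M (tangent_base t).
Let it : tangent_dom i t := chart_at_dom _.
Let iu : tangent_dom i u.
Proof. by rewrite /tangent_dom /= -tu; exact: it. Qed.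

Lemma tcombA : tcomb 1 1 (tcomb 1 1 t u) v = tcomb 1 1 t (tcomb 1 1 u v).
Proof.
have uv : tangent_base u = tangent_base v by rewrite -tu.
by apply: (@tangent_inj _ _ i); [exact: it|by []|]; rewrite !tcomb_coord// !scale1r addrA.
Qed.

Lemma tcombC : tcomb 1 1 t u = tcomb 1 1 u t.
Proof.
by apply: (@tangent_inj _ _ i); [exact: it|by []|]; rewrite !tcomb_coord// !scale1r addrC.
Qed.

Lemma tcombK : tcomb 1 1 (tcomb 1 (-1) t u) u = t.
Proof.
by apply: (@tangent_inj _ _ i); [exact: it|by []|]; rewrite !tcomb_coord// !scale1r scaleN1r subrK.
Qed.

Lemma tcombDK : tcomb 1 (-1) (tcomb 1 1 t u) u = t.
Proof.
by apply: (@tangent_inj _ _ i); [exact: it|by []|]; rewrite !tcomb_coord// !scale1r scaleN1r addrK.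
Qed.

Lemma tcombv : tcomb 1 (-1) t t = tangent_zero M (tangent_base t).
Proof.
apply: (@tangent_inj _ _ i); [exact: it|by []|]; rewrite tcomb_coord//= tangent_coord0.
by rewrite scale1r scaleN1r subrr.
Qed.

Lemma tcomb0l : tcomb 1 1 (tangent_zero M (tangent_base t)) t = t.
Proof.
apply: (@tangent_inj _ _ i) => //.
by rewrite tcomb_coord//= tangent_coord0 scaler0 scale1r add0r.
Qed.

End SameBase.

Lemma diff_comp_linear n m p (F : 'rV[R]_n -> 'rV[R]_m)
    (L : {linear 'rV[R]_m -> 'rV[R]_p}) z v : differentiable F z ->
  differentiable (L \o F) z /\ 'd (L \o F) z v = L ('d F z v).
Proof.
move=> dF; have cL : continuous L by exact: linear_rV_continuous.
have dL := linear_differentiable (F z) cL; split; first exact: differentiable_comp.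
by rewrite (diff_comp dF dL) /= diff_lin.
Qed.

(** The fibrewise combination of vectors acts on the tangent vectors of TM by
    combining the last of their four coordinates (x, v, w, z). *)
Lemma tangent_fun_comb_coord X M (a b : R) (f g : X -> tangent_bundle M) i
    (t : tangent_bundle X) :
  smooth_at f (tangent_base t) -> smooth_at g (tangent_base t) ->
  (\forall y \near tangent_base t, tangent_base (f y) = tangent_base (g y)) ->
  tangent_dom i (f (tangent_base t)) ->
  tangent_coord (M := tangent_bundle M) i
    (tangent_fun (fun y => tcomb a b (f y) (g y)) t) =
  row_mx (lsubmx (tangent_coord (M := tangent_bundle M) i (tangent_fun f t)))
    (a *: rsubmx (tangent_coord (M := tangent_bundle M) i (tangent_fun f t)) +
     b *: rsubmx (tangent_coord (M := tangent_bundle M) i (tangent_fun g t))).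
Proof.
move=> sf sg fg fi; set x := tangent_base t in sf sg fg fi *.
have gi : tangent_dom i (g x) by rewrite /tangent_dom /= -(nbhs_singleton fg).
pose c := chart_at X x; have ct : tangent_dom c t := chart_at_dom x.
have sh := smooth_at_tcomb a b sf sg fg.
pose n := chart_dim (atlas M i).
pose F : 'rV[R]_(chart_dim (atlas X c)) -> 'rV[R]_(n + n) :=
  chart_rep (atlas X c) (atlas (tangent_bundle M) i) f.
pose G : 'rV[R]_(chart_dim (atlas X c)) -> 'rV[R]_(n + n) :=
  chart_rep (atlas X c) (atlas (tangent_bundle M) i) g.
pose L1 : {linear 'rV[R]_(n + n) -> 'rV[R]_(n + n)} :=
  mulmxr (block_mx 1%:M 0 0 a%:M).
pose L2 : {linear 'rV[R]_(n + n) -> 'rV[R]_(n + n)} :=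
  mulmxr (block_mx 0 0 0 b%:M).
have L1E w : L1 w = row_mx (lsubmx w) (a *: rsubmx w).
  rewrite /L1 /= -{1}(hsubmxK w) mul_row_block !mulmx0 mulmx1 mul_mx_scalar.
  by rewrite addr0 add0r.
have L2E w : L2 w = row_mx 0 (b *: rsubmx w).
  by rewrite /L2 /= -{1}(hsubmxK w) mul_row_block !mulmx0 mul_mx_scalar addr0 add0r.
have combE (u v u' v' : 'rV[R]_(n + n)) : u = u' -> v = v' ->
    row_mx (lsubmx u) (a *: rsubmx u + b *: rsubmx v) =
    row_mx (lsubmx u') (a *: rsubmx u' + b *: rsubmx v') :> 'rV[R]_(n + n).
  by move=> -> ->.
have Ef := @tangent_fun_coord_at _ X (tangent_bundle M) f c i t sf ct fi.
have Eg := @tangent_fun_coord_at _ X (tangent_bundle M) g c i t sg ct gi.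
have Eh := @tangent_fun_coord_at _ X (tangent_bundle M) _ c i t sh ct fi.
refine (etrans Eh _); refine (etrans _ (esym (combE _ _ _ _ Ef Eg))).
have dF : differentiable F (chart_fwd (atlas X c) x).
  exact: (@smooth_at_diff _ X (tangent_bundle M) f x c i).
have dG : differentiable G (chart_fwd (atlas X c) x).
  exact: (@smooth_at_diff _ X (tangent_bundle M) g x c i).
have [d1 e1] := diff_comp_linear L1 (tangent_coord c t) dF.
have [d2 e2] := diff_comp_linear L2 (tangent_coord c t) dG.
have nE : \forall z \near chart_fwd (atlas X c) x, ((L1 \o F) + (L2 \o G)) z =
    chart_rep (atlas X c) (atlas (tangent_bundle M) i) (fun y => tcomb a b (f y) (g y)) z.
  have nx : \forall y \near x,
      tangent_dom i (f y) /\ tangent_base (f y) = tangent_base (g y).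
    apply: filterI fg.
    by apply: (smooth_at_continuous sf); exact: (@chart_dom_nbhs _ (tangent_bundle M) i).
  apply: filterS (chart_fwd_nbhs ct nx) => z [iz ez].
  rewrite -[LHS]/(L1 (F z) + L2 (G z)) L1E L2E add_row_mx addr0.
  rewrite /F /G /chart_rep /= /tangent_fwd !row_mxKl !row_mxKr tcomb_coord//.
refine (etrans (esym (diff_near_eq _ nE (differentiableD d1 d2))) _).
have E := diffD d1 d2; have {}E := congr1 (@^~ (tangent_coord c t)) E.
refine (etrans E (etrans (congr2 +%R e1 e2) _)).
by rewrite L1E L2E add_row_mx addr0.
Qed.

End FibrewiseCombination.

(** * Embedded submanifolds *)

Section EmbeddedSubmanifold.
Variables (R : realType) (N : manifold R) (S : set N).

(** A local parametrization of [S] whose inverse [slice_fwd] is the restriction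
    of a function on the ambient manifold that is smooth near the points of [S]:
    this yields both the smoothness of the transition maps and local retractions of
    the ambient manifold onto [S]. *)
Record slice := Slice {
  slice_dim : nat;
  slice_dom : set N;
  slice_cod : set 'rV[R]_slice_dim;
  slice_fwd : N -> 'rV[R]_slice_dim;
  slice_bwd : 'rV[R]_slice_dim -> N;
  slice_dom_open : open slice_dom;
  slice_cod_open : open slice_cod;
  slice_fwd_smooth : forall x, slice_dom x -> S x ->
    @smooth_at R N (euclidean _ _) slice_fwd x;
  slice_bwd_smooth : forall z, slice_cod z ->
    @smooth_at R (euclidean _ _) N slice_bwd z;
  slice_fwd_cod : forall x, slice_dom x -> S x -> slice_cod (slice_fwd x);
  slice_bwd_dom : forall z, slice_cod z -> slice_dom (slice_bwd z);
  slice_bwd_sub : forall z, slice_cod z -> S (slice_bwd z);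
  slice_fwdK : forall x, slice_dom x -> S x -> slice_bwd (slice_fwd x) = x;
  slice_bwdK : forall z, slice_cod z -> slice_fwd (slice_bwd z) = z
}.

Definition subset_type := {x : N | S x}.
Definition subset_val (s : subset_type) : N := proj1_sig s.

HB.instance Definition _ := gen_eqMixin subset_type.
HB.instance Definition _ := gen_choiceMixin subset_type.
HB.instance Definition _ := Topological.copy subset_type (initial_topology subset_val).

Lemma subset_val_inj : injective subset_val.
Proof.
by move=> [x Sx] [y Sy] /= xy; case: _ / xy in Sy *; rewrite (Prop_irrelevance Sx Sy).
Qed.

Lemma subset_val_continuous : continuous subset_val.
Proof. exact: initial_continuous. Qed.

Lemma subset_nbhs (s : subset_type) (A : set subset_type) : nbhs s A ->
  exists2 B : set N, nbhs (subset_val s) B & subset_val @^-1` B `<=` A.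
Proof.
move=> /nbhs_open[_ [[B oB <-] Bs sB]].
by exists B => //; exact: open_nbhs_nbhs (conj oB Bs).
Qed.

Lemma subset_continuous (T : topologicalType) (f : T -> subset_type) x :
  {for x, continuous (subset_val \o f)} -> {for x, continuous f}.
Proof.
move=> cf A /subset_nbhs[B nB sB].
have nx : nbhs x ((subset_val \o f) @^-1` B) := cf _ nB.
by apply: filterS nx => y By; exact: sB.
Qed.

Lemma subset_hausdorff : hausdorff_space subset_type.
Proof.
move=> s t st; apply: subset_val_inj.
exact: hausdorff_map (@manifold_hausdorff _ N) (@subset_val_continuous s)
  (@subset_val_continuous t) st.
Qed.

Lemma subset_second_countable : @second_countable subset_type.
Proof.
have [B cB [oB bB]] := @manifold_second_countable _ N.
exists ((fun U => subset_val @^-1` U) @` B).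
  by apply: sub_countable; [exact: card_image_le|].
split; first by move=> _ [U /oB oU <-]; exists U.
move=> s A /subset_nbhs[W nW sW]; rewrite nbhs_filterE.
have [U [BU Us] UW] := bB _ _ nW.
exists (subset_val @^-1` U); first by split => //; exists U.
by move=> t /UW /sW.
Qed.

Variable slice_at : subset_type -> slice.
Hypothesis slice_at_dom : forall s, slice_dom (slice_at s) (subset_val s).

Definition subset_dom s : set subset_type :=
  subset_val @^-1` slice_dom (slice_at s).

Definition subset_fwd s (t : subset_type) := slice_fwd (slice_at s) (subset_val t).

(** Outside its codomain the inverse chart takes the junk value [s]. *)
Definition subset_bwd s (z : 'rV[R]_(slice_dim (slice_at s))) : subset_type :=
  if pselect (S (slice_bwd z)) is left h then exist _ _ h else s.

Lemma subset_bwdE s z : slice_cod z ->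
  subset_val (@subset_bwd s z) = slice_bwd z.
Proof.
move=> cz; rewrite /subset_bwd; case: pselect => // -[].
exact: slice_bwd_sub.
Qed.

Lemma subset_dom_open s : open (subset_dom s).
Proof. by exists (slice_dom (slice_at s)) => //; exact: slice_dom_open. Qed.

Lemma subset_fwd_cod s t : subset_dom s t -> slice_cod (subset_fwd s t).
Proof. by move=> st; apply: slice_fwd_cod => //; exact: proj2_sig. Qed.

Lemma subset_bwd_dom s z : slice_cod z -> subset_dom s (@subset_bwd s z).
Proof.
by move=> cz; rewrite /subset_dom /= subset_bwdE//; exact: slice_bwd_dom.
Qed.

Lemma subset_fwdK s t : subset_dom s t -> subset_bwd (subset_fwd s t) = t.
Proof.
move=> st; apply: subset_val_inj; rewrite subset_bwdE; last exact: subset_fwd_cod.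
by apply: slice_fwdK => //; exact: proj2_sig.
Qed.

Lemma subset_bwdK s z : slice_cod z -> subset_fwd s (subset_bwd z) = z.
Proof. by move=> cz; rewrite /subset_fwd subset_bwdE// slice_bwdK. Qed.

Lemma subset_fwd_continuous s t : subset_dom s t ->
  {for t, continuous (subset_fwd s)}.
Proof.
move=> st; apply: (continuous_comp (f := subset_val)).
  exact: subset_val_continuous.
exact: smooth_at_continuous (slice_fwd_smooth st (proj2_sig t)).
Qed.

Lemma subset_bwd_continuous s z : slice_cod z ->
  {for z, continuous (@subset_bwd s)}.
Proof.
move=> cz; apply: subset_continuous.
have cb := smooth_at_continuous (slice_bwd_smooth cz).
have E0 : (subset_val \o @subset_bwd s) z = slice_bwd z by exact: subset_bwdE.
rewrite /prop_for /continuous_at E0.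
have nz : nbhs z (@slice_cod (slice_at s)).
  exact: open_nbhs_nbhs (conj (@slice_cod_open _) cz).
have nE : \forall w \near z, @slice_bwd (slice_at s) w = (subset_val \o @subset_bwd s) w.
  by apply: filterS nz => w cw; rewrite /= subset_bwdE.
exact: cvg_trans (near_eq_cvg nE) cb.
Qed.

Definition subset_chart s : local_chart R subset_type :=
  LocalChart (@subset_dom_open s) (@slice_cod_open (slice_at s))
    (@subset_fwd_cod s) (@subset_bwd_dom s) (@subset_fwdK s) (@subset_bwdK s)
    (@subset_fwd_continuous s) (@subset_bwd_continuous s).

Lemma subset_atlas_smooth s t :
  smooth_on (chart_rep_dom (subset_chart s) (subset_chart t) id)
    (chart_rep (subset_chart s) (subset_chart t) id).
Proof.
have o : open (chart_rep_dom (subset_chart s) (subset_chart t) id).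
  by apply: chart_rep_open => ? _; exact: continuous_for_id.
apply: (smooth_ext (f := slice_fwd (slice_at t) \o @slice_bwd (slice_at s)) o).
  by move=> z [cz _]; rewrite /chart_rep /= /subset_fwd subset_bwdE.
apply: smooth_at_on => z [/= cz dz].
rewrite /subset_dom /= subset_bwdE// in dz.
by apply: smooth_at_comp (slice_bwd_smooth cz) (slice_fwd_smooth dz (slice_bwd_sub cz)).
Qed.

Definition submanifold : manifold R :=
  @Manifold R subset_type subset_type subset_chart id slice_at_dom
    subset_atlas_smooth subset_hausdorff subset_second_countable.

Lemma smooth_at_subset_val (s : submanifold) :
  @smooth_at R submanifold N subset_val s.
Proof.
have cs := @subset_fwd_cod s s (slice_at_dom s).
have sv := smooth_at_comp (@chart_fwd_smooth R submanifold s s (slice_at_dom s))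
  (slice_bwd_smooth cs).
apply: smooth_at_ext sv.
apply: filterS (@chart_dom_nbhs R submanifold s s (slice_at_dom s)) => t dt.
by apply: slice_fwdK => //; exact: proj2_sig.
Qed.

Definition submanifold_val : smooth_map submanifold N :=
  SmoothMap (smooth_at_smooth smooth_at_subset_val).

(** A smooth retraction of a neighbourhood of [s] in the ambient manifold onto a
    neighbourhood of [s] in the submanifold. *)
Definition submanifold_retr (s : submanifold) (x : N) : submanifold :=
  subset_bwd (slice_fwd (slice_at s) x).

Lemma smooth_at_retr (s : submanifold) :
  smooth_at (submanifold_retr s) (subset_val s).
Proof.
apply: (smooth_at_comp (slice_fwd_smooth (slice_at_dom s) (proj2_sig s))).
apply: (@chart_bwd_smooth R submanifold s).
exact: (@subset_fwd_cod s s (slice_at_dom s)).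
Qed.

Lemma retr_near (s : submanifold) : \forall x \near subset_val s,
  slice_dom (slice_at s) x /\ slice_cod (slice_fwd (slice_at s) x).
Proof.
apply: filterI; first exact: open_nbhs_nbhs (conj (@slice_dom_open _) (slice_at_dom s)).
apply: (smooth_at_continuous (slice_fwd_smooth (slice_at_dom s) (proj2_sig s))).
apply: open_nbhs_nbhs; split; first exact: slice_cod_open.
exact: (@subset_fwd_cod s s (slice_at_dom s)).
Qed.

Lemma retrK (s : submanifold) :
  \forall x \near subset_val s, forall t, subset_val t = x ->
    submanifold_retr s x = t.
Proof.
by apply: filterS (retr_near s) => x [dx _] t tx; rewrite -tx in dx *; exact: subset_fwdK.
Qed.

End EmbeddedSubmanifold.

(** * Pullbacks along submersions and the tangent functor *)

Section TangentPullbacks.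
Variable R : realType.
Implicit Types A B C M N P X : manifold R.

Lemma near_smooth M N (f : M -> N) x (Q : N -> Prop) : smooth_at f x ->
  (\forall y \near f x, Q y) -> \forall y \near x, Q (f y).
Proof. by move=> /smooth_at_continuous cf; exact: cf. Qed.

Lemma near_tpair M N (z0 : prod_manifold (tangent_bundle M) (tangent_bundle N))
    (Q : prod_manifold M N -> Prop) :
  (\forall z \near ((tangent_base z0.1, tangent_base z0.2) : prod_manifold M N), Q z) ->
  \forall z \near z0, Q (tangent_base z.1, tangent_base z.2).
Proof.
move=> nQ.
have sb := smooth_at_comp (smooth_at_tpair z0) (smooth_map_at (tangent_proj _) _).
exact: near_smooth sb nQ.
Qed.

Lemma smooth_at_tangent_pair M N P (f : prod_manifold M N -> P)
    (z : prod_manifold (tangent_bundle M) (tangent_bundle N)) :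
  smooth_at f (tangent_base z.1, tangent_base z.2) ->
  smooth_at (fun w : prod_manifold (tangent_bundle M) (tangent_bundle N) =>
    tangent_fun f (tpair w.1 w.2)) z.
Proof.
move=> sf; have sT := @tangent_fun_smooth_at _ _ _ f (tpair z.1 z.2) sf.
exact: (smooth_at_comp (smooth_at_tpair z) sT).
Qed.

(** Submersions, in an equational form that is preserved by any functor
    preserving products: near each point of the source, tau moves the point y to
    the fibre over c, and fixes it when it lies there already. *)
Definition submersion B C (g : smooth_map B C) : Prop := forall y0,
  exists tau : prod_manifold C B -> B,
  [/\ smooth_at tau (g y0, y0),
      \forall z \near ((g y0, y0) : prod_manifold C B), g (tau z) = z.1 &
      \forall y \near y0, tau (g y, y) = y].

Lemma submersion_tangent B C (g : smooth_map B C) :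
  submersion g -> submersion (tangent_map g).
Proof.
move=> sg u0; have [tau [stau gtau taug]] := sg (tangent_base u0).
exists (fun z => tangent_fun tau (tpair z.1 z.2)); split.
- exact: (@smooth_at_tangent_pair _ _ _ tau (tangent_fun g u0, u0) stau).
- have n1 := @near_tpair _ _ (tangent_fun g u0, u0) _ (smooth_at_near stau).
  have n2 := @near_tpair _ _ (tangent_fun g u0, u0) _ (near_near gtau).
  apply: filterS2 n1 n2 => z s1 e1.
  rewrite [LHS]/= -(@tangent_fun_comp _ _ _ _ g tau (tpair z.1 z.2) s1 (smooth_map_at g _)).
  rewrite (@tangent_fun_ext _ _ _ (g \o tau) fst (tpair z.1 z.2) _ e1) ?tpair_fst//.
  exact: smooth_at_comp s1 (smooth_map_at g _).
- have sgi y : smooth_at (fun y => (g y, y) : prod_manifold C B) y.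
    exact: smooth_at_pair (smooth_map_at g y) (smooth_at_id y).
  have n1 := near_tangent (near_smooth (sgi _) (smooth_at_near stau)).
  have n2 := near_tangent (near_near taug).
  apply: filterS2 n1 n2 => u s1 e1.
  have <- : tangent_fun (fun y => (g y, y) : prod_manifold C B) u =
      tpair (tangent_map g u) u.
    by rewrite tangent_fun_pair ?tangent_fun_id//; [exact: smooth_map_at|exact: smooth_at_id].
  rewrite -tangent_fun_comp//.
  rewrite (tangent_fun_ext _ e1) ?tangent_fun_id//.
  exact: smooth_at_comp (sgi _) s1.
Qed.

(** A fibre product of sets whose inverse to (a, b) is locally the restriction
    of a smooth function on the product, along a submersion. In contrast to the
    universal property, this is visibly stable under the tangent functor. *)
Record submersive_square P A B C (a : smooth_map P A) (b : smooth_map P B)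
    (f : smooth_map A C) (g : smooth_map B C) : Prop := SubmersiveSquare {
  square_comm : forall p, f (a p) = g (b p);
  square_surj : forall x y, f x = g y -> exists p, a p = x /\ b p = y;
  square_retract : forall p0, exists2 kappa : prod_manifold A B -> P,
    smooth_at kappa (a p0, b p0) &
    \forall z \near ((a p0, b p0) : prod_manifold A B),
      forall p, a p = z.1 -> b p = z.2 -> kappa z = p;
  square_submersion : submersion g
}.

Section Squares.
Variables (P A B C : manifold R) (a : smooth_map P A) (b : smooth_map P B).
Variables (f : smooth_map A C) (g : smooth_map B C).
Hypothesis sq : submersive_square a b f g.

Lemma square_inj p p' : a p = a p' -> b p = b p' -> p = p'.
Proof.
move=> ap bp; have [kappa _ /nbhs_singleton kE] := square_retract sq p'.
by rewrite -(kE p ap bp) (kE p').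
Qed.

Lemma smooth_at_pair_map M M1 M2 (h : smooth_map M M1) (k : smooth_map M M2) x :
  smooth_at (fun y => (h y, k y) : prod_manifold M1 M2) x.
Proof. exact: smooth_at_pair (smooth_map_at h x) (smooth_map_at k x). Qed.

(** The vectors t and u are not given as the velocity of a curve in the fibre
    product. They are lifted by differentiating the function
    (x, y) |-> kappa (x, tau (f x, y)) instead, whose argument has been moved into
    the fibre product. *)
Lemma tangent_square_surj (t : tangent_bundle A) (u : tangent_bundle B) :
  tangent_map f t = tangent_map g u ->
  exists p, tangent_map a p = t /\ tangent_map b p = u.
Proof.
move=> tu; have fg : f (tangent_base t) = g (tangent_base u).
  by have := congr1 (@tangent_base _ _) tu.
have [p0 [ap0 bp0]] := square_surj sq fg.
have [kappa skappa kappaE] := square_retract sq p0.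
have [tau [stau gtau taug]] := square_submersion sq (b p0).
have gb : g (b p0) = f (tangent_base t) by rewrite -(square_comm sq) ap0.
rewrite ap0 bp0 in skappa kappaE; rewrite gb bp0 in stau gtau taug.
pose F (z : prod_manifold A B) : prod_manifold C B := (f z.1, z.2).
pose H (z : prod_manifold A B) : prod_manifold A B := (z.1, tau (F z)).
pose z0 : prod_manifold A B := (tangent_base t, tangent_base u).
have sF z : smooth_at F z.
  apply: smooth_at_pair (smooth_at_comp (smooth_at_fst z) (smooth_map_at f _)) _.
  exact: smooth_at_snd.
have stauF : smooth_at (tau \o F) z0 by exact: smooth_at_comp (sF z0) stau.
have sH : smooth_at H z0 by exact: smooth_at_pair (smooth_at_fst z0) stauF.
have tau0 : tau (F z0) = tangent_base u.
  by rewrite /F /= fg; apply: (nbhs_singleton taug).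
have H0 : H z0 = z0 by rewrite /H tau0.
have skH : smooth_at (kappa \o H) z0 by apply: (smooth_at_comp sH); rewrite H0.
(* (x, tau (f x, y)) lies in the fibre product, where kappa inverts (a, b) *)
have nH : \forall z \near z0, a (kappa (H z)) = z.1 /\ b (kappa (H z)) = tau (F z).
  have n1 : \forall z \near z0, g (tau (F z)) = f z.1.
    exact: near_smooth (sF z0) gtau.
  have n2 : \forall z \near z0, forall p,
      a p = z.1 -> b p = tau (F z) -> kappa (H z) = p.
    have kE0 : \forall z \near H z0, forall p, a p = z.1 -> b p = z.2 -> kappa z = p.
      by rewrite H0.
    exact: near_smooth sH kE0.
  apply: filterS2 n1 n2 => z e1 e2.
  have [p [ap bp]] := square_surj sq (esym e1).
  by rewrite (e2 p).
pose z' := tpair t u; exists (tangent_fun (kappa \o H) z'); split.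
- rewrite [LHS]/= -(tangent_fun_comp (t := z') skH (smooth_map_at a _)).
  have n1 : \forall z \near z0, (a \o (kappa \o H)) z = z.1.
    by apply: filterS nH => z [].
  rewrite (tangent_fun_ext (t := z') _ n1) ?tpair_fst//.
  exact: smooth_at_comp skH (smooth_map_at a _).
- rewrite [LHS]/= -(tangent_fun_comp (t := z') skH (smooth_map_at b _)).
  have n1 : \forall z \near z0, (b \o (kappa \o H)) z = (tau \o F) z.
    by apply: filterS nH => z [].
  rewrite (tangent_fun_ext (t := z') _ n1); last first.
    exact: smooth_at_comp skH (smooth_map_at b _).
  have stau' : smooth_at tau (F (tangent_base z')) := stau.
  rewrite (@tangent_fun_comp _ _ _ _ tau F z' (sF _) stau').
  have -> : tangent_fun F z' = tpair (tangent_map g u) u.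
    have s1 := @smooth_at_fst _ A B (tangent_base z').
    have s2 : smooth_at f (tangent_base z').1 by exact: smooth_map_at.
    rewrite /F tangent_fun_pair; [|exact: smooth_at_comp s1 s2|exact: smooth_at_snd].
    rewrite (@tangent_fun_comp _ (prod_manifold A B) A C f fst z' s1 s2).
    by rewrite tpair_fst tpair_snd -tu.
  have -> : tpair (tangent_map g u) u = tangent_fun (fun y => (g y, y) : prod_manifold C B) u.
    by rewrite tangent_fun_pair ?tangent_fun_id//; [exact: smooth_map_at|exact: smooth_at_id].
  rewrite fg in stau.
  rewrite -tangent_fun_comp//; last exact: smooth_at_pair (smooth_map_at g _) (smooth_at_id _).
  rewrite (tangent_fun_ext (t := u) _ taug) ?tangent_fun_id//.
  by apply: smooth_at_comp stau; exact: smooth_at_pair (smooth_map_at g _) (smooth_at_id _).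
Qed.

Lemma submersive_square_tangent :
  submersive_square (tangent_map a) (tangent_map b) (tangent_map f) (tangent_map g).
Proof.
split.
- move=> p; rewrite /= -!tangent_fun_comp; try exact: smooth_map_at.
  by congr tangent_fun; apply/funext => x; exact: square_comm sq x.
- exact: tangent_square_surj.
- move=> p0; have [kappa skappa kappaE] := square_retract sq (tangent_base p0).
  exists (fun z => tangent_fun kappa (tpair z.1 z.2)).
    exact: (@smooth_at_tangent_pair _ _ _ kappa (tangent_fun a p0, tangent_fun b p0) skappa).
  have n1 := @near_tpair _ _ (tangent_map a p0, tangent_map b p0) _ (smooth_at_near skappa).
  have n2 := @near_tpair _ _ (tangent_map a p0, tangent_map b p0) _ (near_near kappaE).
  apply: filterS2 n1 n2 => -[z1 z2] /= s1 e1 p ap bp.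
  rewrite -ap -bp -[tpair _ _](tangent_fun_pair (smooth_map_at a _) (smooth_map_at b _)).
  have {}s1 : smooth_at kappa (a (tangent_base p), b (tangent_base p)).
    by move: s1; rewrite -ap -bp.
  rewrite -tangent_fun_comp//; last exact: smooth_at_pair_map.
  have n3 : \forall x \near tangent_base p, kappa (a x, b x) = x.
    move: e1; rewrite -ap -bp => /(near_smooth (smooth_at_pair_map a b _)) e1.
    by apply: filterS e1 => x; exact.
  rewrite (tangent_fun_ext _ n3) ?tangent_fun_id//.
  exact: smooth_at_comp (smooth_at_pair_map a b _) s1.
- exact: submersion_tangent (square_submersion sq).
Qed.

(** The pointwise lift is unique, hence near each point equal to kappa (u, v). *)
Lemma square_lift X (u : smooth_map X A) (v : smooth_map X B) :
  (forall z, f (u z) = g (v z)) ->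
  exists h : smooth_map X P, forall z, a (h z) = u z /\ b (h z) = v z.
Proof.
move=> uv.
have [h hP] := choice (fun z => square_surj sq (uv z)).
suff sh : smooth h by exists (SmoothMap sh).
apply: smooth_at_smooth => z0; have [kappa skappa kappaE] := square_retract sq (h z0).
have [ah bh] := hP z0; rewrite ah bh in skappa kappaE.
have suv := smooth_at_pair_map u v z0.
apply: (smooth_at_ext _ (smooth_at_comp suv skappa)).
apply: filterS (near_smooth suv kappaE) => z kz /=.
by have [ahz bhz] := hP z; exact: kz.
Qed.

Lemma submersive_square_pullback : is_pullback a b f g.
Proof.
split; first by apply: smooth_map_ext => p; exact: square_comm sq p.
move=> X u v uv; have {}uv z : f (u z) = g (v z).
  by have := congr1 (fun h : smooth_map _ _ => h z) uv.
have [h hP] := square_lift uv; exists h; split.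
  by split; apply: smooth_map_ext => z; have [] := hP z.
move=> h' [ah' bh']; apply: smooth_map_ext => z; have [ah bh] := hP z.
by apply: square_inj; rewrite ?ah ?bh -?ah' -?bh'.
Qed.

End Squares.

Lemma submersive_square_T_pullback P A B C (a : smooth_map P A)
    (b : smooth_map P B) (f : smooth_map A C) (g : smooth_map B C) :
  submersive_square a b f g -> is_T_pullback a b f g.
Proof.
move=> sq n; apply: submersive_square_pullback.
by elim: n => //= n IH; exact: submersive_square_tangent.
Qed.

(** The power of exponent n + 1 is the pullback along q of the power of exponent
    n, at every level T^k. *)
Lemma T_fibre_powers E M (q : smooth_map E M) :
  (forall A (f : smooth_map A M), exists P (a : smooth_map P A) (b : smooth_map P E),
    is_T_pullback a b f q) -> has_T_fibre_powers q.
Proof.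
move=> pb; elim=> [|n [P [r [pi piP]]]].
  exists M, (smooth_map_id M), (fun i : 'I_0 => False_rect _ (notF (ltn_ord i))) => k.
  have idE : iter_tangent_map k (smooth_map_id M) = smooth_map_id _.
    elim: k => //= k ->; apply: smooth_map_ext => t; exact: tangent_fun_id.
  split; first by case.
  move=> X s a _; exists s; split.
    by split; [rewrite idE; apply: smooth_map_ext|case].
  by move=> h [<- _]; rewrite idE; apply: smooth_map_ext.
have [P' [a [b ab]]] := pb P r.
exists P', (r \os a), (fun i => if unlift ord0 i is Some j then pi j \os a else b).
move=> k; have [fgk univ] := ab k; have [piq univn] := piP k.
have compE A B C (g : smooth_map B C) (f : smooth_map A B) :
    iter_tangent_map k (g \os f) = iter_tangent_map k g \os iter_tangent_map k f.
  elim: k {fgk univ piq univn} => //= k ->; apply: smooth_map_ext => t.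
  by apply: tangent_fun_comp; exact: smooth_map_at.
have assoc A B C D (h : smooth_map C D) (g : smooth_map B C) (f : smooth_map A B) :
    h \os (g \os f) = h \os g \os f by exact: smooth_map_ext.
split.
  move=> i; case: unliftP => [j _|_]; last by rewrite compE fgk.
  by rewrite !compE assoc piq.
move=> X s c cs.
have [h0 [[h0s h0c] h0u]] := univn X s (fun j => c (lift ord0 j)) (fun j => cs _).
have e0 : iter_tangent_map k r \os h0 = iter_tangent_map k q \os c ord0.
  by rewrite h0s cs.
have [h [[ha hb] hu]] := univ X h0 (c ord0) e0; exists h; split.
  split; first by rewrite compE -assoc ha.
  move=> i; case: unliftP => [j ->|->]; last exact: hb.
  by rewrite compE -assoc ha h0c.
move=> h' [h's h'c]; apply: hu; split.
  apply/esym/h0u; split; first by rewrite assoc -compE.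
  by move=> j; have := h'c (lift ord0 j); rewrite liftK compE -assoc.
by have := h'c ord0; rewrite unlift_none.
Qed.

End TangentPullbacks.

(** * Kernels of nearby idempotents *)

Section ConjugateIdempotents.
Variables (F : fieldType) (n : nat).
Implicit Types (Q : 'M[F]_n) (v : 'rV[F]_n).

(** Intertwines the idempotents Q and Q0, and is invertible when they are close
    to each other, since it is the identity when they are equal. *)
Definition intertwiner Q0 Q : 'M[F]_n :=
  Q *m Q0 + (1%:M - Q) *m (1%:M - Q0).

Definition kernel_basis Q : 'M[F]_(\rank (kermx Q), n) := row_base (kermx Q).

Variable Q0 : 'M[F]_n.
Hypothesis Q0_idem : Q0 *m Q0 = Q0.
Local Notation K := (kernel_basis Q0).

Lemma intertwiner_id : intertwiner Q0 Q0 = 1%:M.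
Proof.
rewrite /intertwiner mulmxBl !mulmxBr !mul1mx !mulmx1 Q0_idem.
by rewrite subrr subr0 addrC subrK.
Qed.

Lemma intertwinerP Q : Q *m Q = Q ->
  intertwiner Q0 Q *m Q0 = Q *m intertwiner Q0 Q.
Proof.
move=> QQ; have z0 : (1%:M - Q0) *m Q0 = 0 by rewrite mulmxBl mul1mx Q0_idem subrr.
have z1 : Q *m (1%:M - Q) = 0 by rewrite mulmxBr mulmx1 QQ subrr.
rewrite /intertwiner [LHS]mulmxDl [RHS]mulmxDr -[X in X + _ = _]mulmxA Q0_idem.
rewrite -[X in _ + X = _]mulmxA z0 mulmx0 [X in _ = X + _]mulmxA QQ.
by rewrite [X in _ = _ + X]mulmxA z1 mul0mx.
Qed.

Lemma kernel_basis_ker : K *m Q0 = 0.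
Proof. by apply/sub_kermxP; rewrite eq_row_base. Qed.

Lemma kernel_basisK m (w : 'M_(m, _)) : w *m K *m pinvmx K = w.
Proof. by rewrite mulmxKp// row_base_free. Qed.

Lemma pinv_kernel_basis v : v *m Q0 = 0 -> v *m pinvmx K *m K = v.
Proof.
by move=> /sub_kermxP vQ; rewrite mulmxKpV// eq_row_base.
Qed.

Variable Q : 'M[F]_n.
Hypotheses (Q_idem : Q *m Q = Q) (NU : intertwiner Q0 Q \in unitmx).
Local Notation N := (intertwiner Q0 Q).

(** The intertwiner carries the kernel of Q onto that of Q0, so one basis of the
    latter gives coordinates on all nearby kernels. *)
Lemma kernel_trivializationK v : v *m Q = 0 ->
  v *m N *m pinvmx K *m K *m invmx N = v.
Proof.
move=> vQ; rewrite pinv_kernel_basis ?mulmxK//.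
by rewrite -mulmxA intertwinerP// mulmxA vQ mul0mx.
Qed.

Lemma kernel_trivialization_inv (w : 'rV_(\rank (kermx Q0))) :
  w *m K *m invmx N *m N *m pinvmx K = w.
Proof. by rewrite mulmxKV// kernel_basisK. Qed.

Lemma kernel_trivialization_ker (w : 'rV_(\rank (kermx Q0))) :
  w *m K *m invmx N *m Q = 0.
Proof.
have NQ : invmx N *m Q = Q0 *m invmx N.
  by rewrite -[LHS](mulmxK NU) -(mulmxA (invmx N)) -intertwinerP// mulmxA mulVmx ?mul1mx.
by rewrite -mulmxA NQ mulmxA -(mulmxA w) kernel_basis_ker mulmx0 mul0mx.
Qed.

End ConjugateIdempotents.

(** * The vertical vectors along a section *)

Section EntriesComposition.
Variable R : realType.

Lemma entries_smooth_comp (V : normedModType R) n p r (U : set V)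
    (U' : set 'rV[R]_n) (f : V -> 'rV[R]_n) (A : 'rV[R]_n -> 'M[R]_(p, r)) :
  open U -> open U' -> (forall x, U x -> U' (f x)) -> smooth_on U f ->
  entries_smooth U' A -> entries_smooth U (fun x => A (f x)).
Proof.
move=> oU oU' UU' sf sA i j.
have sr : smooth_on U' (fun y => row i (A y)).
  apply: smooth_rowP => // k l.
  by rewrite (_ : (fun x => _) = (fun x => A x i l)) //; apply/funext => x; rewrite mxE.
have := smooth_row_entries oU (smooth_on_comp oU oU' UU' sf sr) 0 j.
by rewrite (_ : (fun x => _) = (fun x => A (f x) i j)) //; apply/funext => x; rewrite mxE.
Qed.

Lemma entries_smooth_diff n m (U : set 'rV[R]_n) (f : 'rV[R]_n -> 'rV[R]_m) :
  open U -> smooth_on U f -> entries_smooth U (fun y => lin1_mx ('d f y)).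
Proof.
move=> oU sf i j; have sd : smooth_on U (fun y => 'd f y (delta_mx 0 i)).
  by move=> k; have [_] := sf k.+1; exact.
have := smooth_row_entries oU sd 0 j.
by rewrite (_ : (fun x => _ i j) = (fun x => 'd f x (delta_mx 0 i) 0 j)) //;
  apply/funext => x; rewrite mxE.
Qed.

End EntriesComposition.

Section RetractionJacobian.
Variables (R : realType) (E M : manifold R).
Variables (q : smooth_map E M) (xi : smooth_map M E).
Hypothesis qxi : forall m, q (xi m) = m.
Variable j : atlas_index E.
Local Notation d := (atlas E j).
Local Notation k := (chart_dim d).

Definition retraction_dom : set 'rV[R]_k := chart_rep_dom d d (xi \o q).

(** The matrix of T(xi q); it is idempotent at the points of the section xi. *)
Definition retraction_jacobian (y : 'rV[R]_k) : 'M[R]_k :=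
  lin1_mx ('d (chart_rep d d (xi \o q)) y).

Lemma smooth_map_comp_fun L N P (g : @smooth_map R N P) (f : @smooth_map R L N) :
  smooth (g \o f).
Proof. exact: smooth_funP (g \os f). Qed.

Lemma retraction_dom_open : open retraction_dom.
Proof.
by apply: chart_rep_open => x _; have [c _] := smooth_map_comp_fun xi q; exact: c.
Qed.

Lemma retraction_jacobian_smooth : entries_smooth retraction_dom retraction_jacobian.
Proof.
apply: entries_smooth_diff retraction_dom_open _.
by have [_] := smooth_map_comp_fun xi q; exact.
Qed.

Lemma retraction_at x : smooth_at (xi \o q) x.
Proof. exact: smooth_smooth_at (smooth_map_comp_fun xi q) x. Qed.

Lemma retraction_coord (t : tangent_bundle E) m :
  chart_dom d (xi m) -> tangent_base t = xi m ->
  tangent_coord j (tangent_fun (xi \o q) t) =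
  tangent_coord j t *m retraction_jacobian (chart_fwd d (tangent_base t)).
Proof.
move=> dm tm; rewrite mul_rV_lin1.
apply: tangent_fun_coord_at; first exact: retraction_at.
  by rewrite /tangent_dom /= tm.
by rewrite /= tm /= qxi.
Qed.

Lemma retraction_jacobian_idem m : chart_dom d (xi m) ->
  let Q := retraction_jacobian (chart_fwd d (xi m)) in Q *m Q = Q.
Proof.
move=> dm /=; set y := chart_fwd d (xi m).
have fx : (xi \o q) (xi m) = xi m by rewrite /= qxi.
have dfx : chart_dom d ((xi \o q) (xi m)) by rewrite fx.
have dffx : chart_dom d ((xi \o q) ((xi \o q) (xi m))) by rewrite !fx.
apply/row_matrixP => i; rewrite row_mul rowE !mul_rV_lin1 /y.
have JJ := diff_rep_comp (delta_mx 0 i) (retraction_at (xi m)) (retraction_at _) dm dfx dffx.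
have yE : chart_fwd d ((xi \o q) (xi m)) = chart_fwd d (xi m) by rewrite fx.
have FE : (xi \o q) \o (xi \o q) = xi \o q by apply/funext => e /=; rewrite qxi.
by rewrite yE FE in JJ.
Qed.

Lemma retraction_dom_section m : chart_dom d (xi m) ->
  retraction_dom (chart_fwd d (xi m)).
Proof.
by move=> dm; split; [exact: chart_fwd_cod|rewrite chart_fwdK//= qxi].
Qed.

(** At a point of the section, T(q) and the idempotent T(xi) T(q) have the same
    kernel, because T(q) T(xi) is the identity. *)
Lemma verticalP (t : tangent_bundle E) m :
  chart_dom d (xi m) -> tangent_base t = xi m ->
  tangent_map q t = tangent_zero M m <->
  tangent_coord j t *m retraction_jacobian (chart_fwd d (tangent_base t)) = 0.
Proof.
move=> dm tm; rewrite -(retraction_coord dm tm).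
have compE u : tangent_fun (xi \o q) u = tangent_map xi (tangent_map q u).
  by apply: tangent_fun_comp; exact: smooth_map_at.
rewrite compE; split=> [->|t0].
  by rewrite /= tangent_fun0 tangent_coord0.
have t0' : tangent_map xi (tangent_map q t) = tangent_zero E (xi m).
  have bE : tangent_base (tangent_map xi (tangent_map q t)) = xi m.
    by rewrite /= tm qxi.
  apply: (@tangent_inj _ _ j) => //; first by rewrite /tangent_dom /= tm qxi.
  by rewrite t0 /= tangent_coord0.
have := congr1 (tangent_map q) t0'.
rewrite /= tangent_fun0 qxi -(@tangent_fun_comp _ _ _ _ q xi); try exact: smooth_map_at.
have -> : q \o xi = id by apply/funext => x /=; exact: qxi.
by rewrite tangent_fun_id.
Qed.

End RetractionJacobian.

Section KernelBundle.
Variables (R : realType) (E M A : manifold R).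
Variables (q : smooth_map E M) (xi : smooth_map M E) (f : smooth_map A M).
Hypothesis qxi : forall m, q (xi m) = m.

(** The total space of the pullback along f of the vector bundle of those
    tangent vectors of E that are vertical and based at the section. *)
Definition kernel_bundle_set : set (prod_manifold A (tangent_bundle E)) :=
  [set z | tangent_base z.2 = xi (f z.1) /\
           tangent_map q z.2 = tangent_zero M (f z.1)].

Section Slice.
Variable a0 : A.
Local Notation i := (chart_at A a0).
Local Notation j := (chart_at E (xi (f a0))).
Local Notation c := (atlas A i).
Local Notation d := (atlas E j).
Local Notation k := (chart_dim d).
Local Notation J := (@retraction_jacobian R E M q xi j).
Local Notation Q0 := (J (chart_fwd d (xi (f a0)))).
Local Notation K := (kernel_basis Q0).
Local Notation r := (\rank (kermx Q0)).
Local Notation T y := (intertwiner Q0 (J y)).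

(** Where the kernel of the idempotent can be identified with its kernel at the
    centre of the chart. *)
Definition frame_dom : set 'rV[R]_k :=
  [set y | @retraction_dom R E M q xi j y /\ T y \in unitmx].

Lemma intertwiner_smooth : entries_smooth (@retraction_dom R E M q xi j) (fun y => T y).
Proof.
have o := @retraction_dom_open R E M q xi j.
have sJ := @retraction_jacobian_smooth R E M q xi j.
apply: (entries_smooth_add (A := fun y => J y *m Q0)
  (B := fun y => (1%:M - J y) *m (1%:M - Q0)) o).
  by apply: (entries_smooth_mul o sJ); exact: entries_smooth_cst.
apply: (entries_smooth_mul (A := fun y => 1%:M - J y) o); last exact: entries_smooth_cst.
apply: (entries_smooth_add o); first exact: entries_smooth_cst.
exact: (entries_smooth_opp o sJ).
Qed.

Lemma frame_dom_open : open frame_dom.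
Proof.
have o := @retraction_dom_open R E M q xi j.
have sd := smooth_det o intertwiner_smooth.
rewrite openE => y [oy]; rewrite unitmxE unitfE => dy.
apply: filterI; first exact: open_nbhs_nbhs (conj o oy).
have cd := smooth_cont sd oy.
have n0 : nbhs (\det (T y)) [set x : R | x != 0].
  by apply: open_nbhs_nbhs; split => //; exact: open_neq.
have ny : nbhs y ((fun x => \det (T x)) @^-1` [set x : R | x != 0]) := cd _ n0.
by apply: filterS ny => x; rewrite /= unitmxE unitfE.
Qed.

Definition trivialize (w : 'rV[R]_(k + k)) : 'rV[R]_r :=
  rsubmx w *m T (lsubmx w) *m pinvmx K.

Definition untrivialize (w : 'rV[R]_(k + r)) : 'rV[R]_(k + k) :=
  row_mx (lsubmx w) (rsubmx w *m K *m invmx (T (lsubmx w))).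

Lemma frame_smooth n (U : set 'rV[R]_(k + n)) : U = [set w | frame_dom (lsubmx w)] ->
  entries_smooth U (fun w => T (lsubmx w)).
Proof.
move=> ->.
have o := frame_dom_open; have oU := open_lsubmx (m := n) o.
apply: (entries_smooth_comp oU (@retraction_dom_open R E M q xi j) _ _ intertwiner_smooth).
  by move=> w [].
exact: smooth_lsubmx.
Qed.

Lemma trivialize_smooth w : frame_dom (lsubmx w) ->
  @smooth_at R (euclidean _ _) (euclidean _ _) trivialize w.
Proof.
move=> ow; have oU := open_lsubmx (m := k) frame_dom_open.
apply: (smooth_on_at oU) => //; apply: (smooth_rowP oU).
apply: (entries_smooth_mul oU); last exact: entries_smooth_cst.
apply: (entries_smooth_mul oU); last exact: frame_smooth.
exact: (smooth_row_entries oU (@smooth_rsubmx _ _ _ _)).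
Qed.

Lemma untrivialize_smooth w : frame_dom (lsubmx w) ->
  @smooth_at R (euclidean _ _) (euclidean _ _) untrivialize w.
Proof.
move=> ow; have oU := open_lsubmx (m := r) frame_dom_open.
apply: (smooth_on_at oU) => //; apply: (smooth_row_mx oU).
  exact: smooth_lsubmx.
apply: (smooth_rowP oU); apply: (entries_smooth_mul oU).
  apply: (entries_smooth_mul oU); last exact: entries_smooth_cst.
  exact: (smooth_row_entries oU (@smooth_rsubmx _ _ _ _)).
apply: (entries_smooth_inv oU); last exact: frame_smooth.
by move=> x [].
Qed.

Definition base_dom : set A :=
  [set a | chart_dom d (xi (f a)) /\ frame_dom (chart_fwd d (xi (f a)))].

Lemma section_at a : smooth_at (xi \o f) a.
Proof. exact: smooth_at_comp (smooth_map_at f a) (smooth_map_at xi _). Qed.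

Lemma section_coord_smooth a : chart_dom d (xi (f a)) ->
  @smooth_at R A (euclidean _ _) (fun a => chart_fwd d (xi (f a))) a.
Proof. by move=> da; exact: smooth_at_comp (section_at a) (chart_fwd_smooth da). Qed.

Lemma base_dom_open : open base_dom.
Proof.
rewrite openE => a [da oa]; apply: filterI.
  exact: near_smooth (section_at a) (chart_dom_nbhs da).
apply: near_smooth (section_coord_smooth da) _.
exact: open_nbhs_nbhs (conj frame_dom_open oa).
Qed.

Lemma base_dom_center : base_dom a0.
Proof.
have da0 : chart_dom d (xi (f a0)) by exact: chart_at_dom.
split => //; split; first exact: retraction_dom_section.
by rewrite intertwiner_id ?unitmx1//; exact: retraction_jacobian_idem.
Qed.

Definition kb_dom : set (prod_manifold A (tangent_bundle E)) :=
  [set z | [/\ chart_dom c z.1, base_dom z.1 & tangent_dom j z.2]].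

Definition kb_cod : set 'rV[R]_(chart_dim c + r) :=
  [set w | (chart_cod c `&` chart_bwd c @^-1` base_dom) (lsubmx w)].

(** The coordinates of (a, t) are those of a and those of t in the fixed vector
    space ker Q0. *)
Definition kb_fwd (z : prod_manifold A (tangent_bundle E)) : 'rV[R]_(chart_dim c + r) :=
  row_mx (chart_fwd c z.1) (trivialize (tangent_fwd j z.2)).

Definition kb_bwd (w : 'rV[R]_(chart_dim c + r)) : prod_manifold A (tangent_bundle E) :=
  let a := chart_bwd c (lsubmx w) in
  (a, tangent_bwd j (untrivialize (row_mx (chart_fwd d (xi (f a))) (rsubmx w)))).

Lemma kb_dom_open : open kb_dom.
Proof.
rewrite openE => -[a t] [/= ca ba dt]; rewrite /interior.
pose z0 : prod_manifold A (tangent_bundle E) := (a, t).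
have m1 : \forall x \near a, (chart_dom c `&` base_dom) x.
  apply: filterI; first exact: chart_dom_nbhs.
  exact: open_nbhs_nbhs (conj base_dom_open ba).
have n1 : \forall z \near z0, (chart_dom c `&` base_dom) z.1.
  exact: near_smooth (smooth_at_fst z0) m1.
have m2 : \forall u \near t, tangent_dom j u.
  exact: (@chart_dom_nbhs _ (tangent_bundle E) j).
have n2 : \forall z \near z0, tangent_dom j z.2.
  exact: near_smooth (smooth_at_snd z0) m2.
by apply: filterS2 n1 n2 => z [? ?] ?; split.
Qed.

Lemma kb_cod_open : open kb_cod.
Proof. exact: open_lsubmx (chart_bwd_preimage_open base_dom_open). Qed.

Lemma kb_fwd_smooth z : kb_dom z -> kernel_bundle_set z ->
  @smooth_at R (prod_manifold A (tangent_bundle E)) (euclidean _ _) kb_fwd z.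
Proof.
move=> [cz [dz oz] jz] [bz _]; apply: smooth_at_row_mx.
  exact: smooth_at_comp (smooth_at_fst z) (chart_fwd_smooth cz).
have s2 := smooth_at_comp (smooth_at_snd z)
  (@chart_fwd_smooth _ (tangent_bundle E) j z.2 jz).
apply: (smooth_at_comp s2); apply: trivialize_smooth.
by rewrite /= /tangent_fwd row_mxKl bz.
Qed.

Lemma untrivialize_cod a w : base_dom a ->
  tangent_cod j (untrivialize (row_mx (chart_fwd d (xi (f a))) w)).
Proof. by move=> [da _]; rewrite /tangent_cod /= !row_mxKl; exact: chart_fwd_cod. Qed.

Lemma kb_bwd_smooth w : kb_cod w ->
  @smooth_at R (euclidean _ _) (prod_manifold A (tangent_bundle E)) kb_bwd w.
Proof.
move=> [cw bw].
have s1 : @smooth_at R (euclidean _ _) A (fun w => chart_bwd c (lsubmx w)) w.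
  exact: smooth_at_comp (smooth_at_linear (@lsubmx _ _ _ _) w) (chart_bwd_smooth cw).
apply: smooth_at_pair => //.
have [da oa] := bw.
have s2 := smooth_at_comp s1 (section_coord_smooth da).
have s3 := smooth_at_row_mx s2 (smooth_at_linear (@rsubmx _ _ _ _) w).
have ow : frame_dom (lsubmx
    (row_mx (chart_fwd d (xi (f (chart_bwd c (lsubmx w))))) (rsubmx w))).
  by rewrite row_mxKl.
have s4 := smooth_at_comp s3 (untrivialize_smooth ow).
have cz := untrivialize_cod (rsubmx w) bw.
exact: smooth_at_comp s4 (@chart_bwd_smooth _ (tangent_bundle E) j _ cz).
Qed.

Lemma kb_fwd_cod z : kb_dom z -> kernel_bundle_set z -> kb_cod (kb_fwd z).
Proof.
move=> [cz bz _] _; rewrite /kb_cod /= /kb_fwd row_mxKl chart_fwdK//.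
by split => //; exact: chart_fwd_cod.
Qed.

Lemma kb_bwd_base w : kb_cod w ->
  tangent_base (kb_bwd w).2 = xi (f (chart_bwd c (lsubmx w))).
Proof. by move=> [cw [da _]] /=; rewrite /untrivialize !row_mxKl chart_fwdK. Qed.

Lemma kb_bwd_coord w : kb_cod w -> tangent_coord j (kb_bwd w).2 =
  rsubmx w *m K *m invmx (T (chart_fwd d (xi (f (chart_bwd c (lsubmx w)))))).
Proof.
move=> [cw bw]; rewrite /= (tangent_coord_bwd (untrivialize_cod _ bw)).
by rewrite /untrivialize !row_mxKr row_mxKl.
Qed.

Lemma kb_bwd_dom w : kb_cod w -> kb_dom (kb_bwd w).
Proof.
move=> cw; have bE := kb_bwd_base cw; have [cl [da oa]] := cw.
split => //; first exact: chart_bwd_dom.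
by move: da; rewrite /tangent_dom -bE.
Qed.

Let Q0_idem : Q0 *m Q0 = Q0.
Proof. by apply: retraction_jacobian_idem => //; exact: chart_at_dom. Qed.

Lemma kb_bwd_sub w : kb_cod w -> kernel_bundle_set (kb_bwd w).
Proof.
move=> cw; have bE := kb_bwd_base cw; have [cl [da [oa ua]]] := cw.
split => //; apply/(verticalP qxi (j := j)) => //.
rewrite kb_bwd_coord// bE.
exact: (kernel_trivialization_ker Q0_idem (retraction_jacobian_idem qxi da) ua (rsubmx w)).
Qed.

Lemma kb_fwdK z : kb_dom z -> kernel_bundle_set z -> kb_bwd (kb_fwd z) = z.
Proof.
case: z => a t dz Sz; have cz := kb_fwd_cod dz Sz.
have bE := kb_bwd_base cz; have cE := kb_bwd_coord cz.
have [bt vt] : tangent_base t = xi (f a) /\ tangent_map q t = tangent_zero M (f a) := Sz.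
have ca : chart_dom c a by case: dz.
have [da [oa ua]] : base_dom a by case: dz.
have dt : tangent_dom j t by case: dz.
have aE : chart_bwd c (lsubmx (kb_fwd (a, t))) = a.
  by rewrite /kb_fwd row_mxKl chart_fwdK.
rewrite aE in bE cE; rewrite [LHS]surjective_pairing; congr pair; first exact: aE.
apply: (@tangent_inj _ _ j).
- have dE : chart_dom d (tangent_base (kb_bwd (kb_fwd (a, t))).2) by rewrite bE.
  exact: dE.
- by rewrite bE bt.
have v0 := (verticalP qxi (j := j) da bt).1 vt; rewrite bt in v0.
rewrite cE /kb_fwd row_mxKr /trivialize /tangent_fwd row_mxKr row_mxKl bt.
exact: (kernel_trivializationK Q0_idem (retraction_jacobian_idem qxi da) ua v0).
Qed.

Lemma kb_bwdK w : kb_cod w -> kb_fwd (kb_bwd w) = w.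
Proof.
move=> cw; have bE := kb_bwd_base cw; have cE := kb_bwd_coord cw.
have [cl [da [oa ua]]] := cw.
rewrite -[RHS]hsubmxK /kb_fwd; congr row_mx; first exact: chart_bwdK.
rewrite /trivialize /tangent_fwd row_mxKl row_mxKr cE bE.
exact: (kernel_trivialization_inv ua (rsubmx w)).
Qed.

Definition kb_slice : slice kernel_bundle_set :=
  Slice kb_dom_open kb_cod_open kb_fwd_smooth kb_bwd_smooth kb_fwd_cod kb_bwd_dom
    kb_bwd_sub kb_fwdK kb_bwdK.

End Slice.

Lemma kb_slice_at_dom (s : subset_type kernel_bundle_set) :
  slice_dom (kb_slice (subset_val s).1) (subset_val s).
Proof.
split; [exact: chart_at_dom|exact: base_dom_center|].
have [bs _] := proj2_sig s; rewrite /tangent_dom /= /subset_val bs.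
exact: chart_at_dom.
Qed.

Definition kernel_bundle : manifold R := submanifold kb_slice_at_dom.

Definition kernel_bundle_base : smooth_map kernel_bundle A :=
  smooth_map_fst _ _ \os submanifold_val kb_slice_at_dom.

Definition kernel_bundle_vector : smooth_map kernel_bundle (tangent_bundle E) :=
  smooth_map_snd _ _ \os submanifold_val kb_slice_at_dom.

Lemma kernel_bundleP p :
  tangent_base (kernel_bundle_vector p) = xi (f (kernel_bundle_base p)) /\
  tangent_map q (kernel_bundle_vector p) = tangent_zero M (f (kernel_bundle_base p)).
Proof. exact: proj2_sig p. Qed.

Lemma kernel_bundle_surj a t : tangent_base t = xi (f a) ->
  tangent_map q t = tangent_zero M (f a) ->
  exists p, kernel_bundle_base p = a /\ kernel_bundle_vector p = t.
Proof.
move=> ta vt; have S : kernel_bundle_set (a, t) by [].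
by exists (exist _ (a, t) S).
Qed.

(** The retraction keeps the base point and the coordinates in ker Q0, so it can
    move a vertical vector at one point of the section to another point. *)
Lemma kernel_bundle_retract (p0 : kernel_bundle) :
  let z0 := (kernel_bundle_base p0, kernel_bundle_vector p0) in
  exists kappa : prod_manifold A (tangent_bundle E) -> kernel_bundle,
  [/\ smooth_at kappa z0,
      \forall z \near (z0 : prod_manifold A (tangent_bundle E)),
        kernel_bundle_base (kappa z) = z.1 &
      \forall z \near (z0 : prod_manifold A (tangent_bundle E)), forall p,
        kernel_bundle_base p = z.1 -> kernel_bundle_vector p = z.2 -> kappa z = p].
Proof.
move=> z0; have zE : z0 = subset_val p0 by rewrite /z0 [RHS]surjective_pairing.
exists (submanifold_retr (p0 : submanifold kb_slice_at_dom)).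
rewrite zE; split.
- exact: smooth_at_retr.
- apply: filterS (retr_near (p0 : submanifold kb_slice_at_dom)) => -[a t] [[/= ca ba dt] cz].
  rewrite /submanifold_retr /= subset_bwdE// /= /kb_bwd /kb_fwd /= row_mxKl.
  by rewrite chart_fwdK.
- apply: filterS (retrK (p0 : submanifold kb_slice_at_dom)) => z zK p p1 p2; apply: zK.
  by rewrite [LHS]surjective_pairing [RHS]surjective_pairing; congr pair.
Qed.

End KernelBundle.

(** * From the pullback square to a differential bundle *)

Lemma smooth_map_eq (R : realType) (M N : manifold R) (f g : smooth_map M N) :
  f = g -> forall x, f x = g x.
Proof. by move=> ->. Qed.

(** The points of a pullback are its maps from a one-point manifold. *)
Lemma pullback_inj (R : realType) (P A B C : manifold R)
    (a : smooth_map P A) (b : smooth_map P B)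
    (f : smooth_map A C) (g : smooth_map B C) p p' :
  is_pullback a b f g -> a p = a p' -> b p = b p' -> p = p'.
Proof.
move=> [c univ] ap bp; pose pt := euclidean R 0.
have [|h [_ hu]] := univ pt (smooth_map_cst _ (a p)) (smooth_map_cst _ (b p)).
  by apply: smooth_map_ext => z; exact: smooth_map_eq c p.
have e1 : h = smooth_map_cst _ p by apply: hu; split; apply: smooth_map_ext.
have e2 : h = smooth_map_cst _ p' by apply: hu; split; apply: smooth_map_ext => z /=.
exact: smooth_map_eq (etrans (esym e1) e2) (0 : 'rV_0).
Qed.

Lemma tangent_map_comp (R : realType) (M N P : manifold R) (g : smooth_map N P)
    (f : smooth_map M N) (t : tangent_bundle M) :
  tangent_map g (tangent_map f t) = tangent_fun (g \o f) t.
Proof. by rewrite tangent_fun_comp//; exact: smooth_map_at. Qed.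

Lemma is_T_pullback_sym (R : realType) (P A B C : manifold R)
    (a : smooth_map P A) (b : smooth_map P B)
    (f : smooth_map A C) (g : smooth_map B C) :
  is_T_pullback a b f g -> is_T_pullback b a g f.
Proof.
move=> pb n; have [c univ] := pb n; split; first by rewrite c.
move=> X u v uv; have [h [[ha hb] hu]] := univ X v u (esym uv).
by exists h; split => // h' [? ?]; apply: hu.
Qed.

Section FromPullback.
Variables (R : realType) (E M : manifold R).
Variables (q : smooth_map E M) (xi : smooth_map M E).
Variable (lam : smooth_map E (tangent_bundle E)).
Hypothesis pre : pre_differential_bundle q xi lam.
Hypothesis pb : is_pullback lam q
  (smooth_map_pair (tangent_proj E) (tangent_map q))
  (smooth_map_pair xi (tangent_zero M)).

Lemma section_id m : q (xi m) = m.
Proof. exact: smooth_map_eq (pre_differential_section pre) m. Qed.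
Local Notation qxi := section_id.

Lemma lam_base e : tangent_base (lam e) = xi (q e).
Proof. exact: smooth_map_eq (pre_differential_proj pre) e. Qed.

Lemma lam_section m : lam (xi m) = tangent_zero E (xi m).
Proof. exact: smooth_map_eq (pre_differential_zero pre) m. Qed.

Lemma lam_vertical e : tangent_map q (lam e) = tangent_zero M (q e).
Proof.
have [c _] := pb; have ce := smooth_map_eq c e.
exact: (congr1 (fun z : E * tangent_bundle M => z.2) ce).
Qed.

Lemma lam_lift X (u : smooth_map X (tangent_bundle E)) (v : smooth_map X M) :
  (forall z, tangent_base (u z) = xi (v z)) ->
  (forall z, tangent_map q (u z) = tangent_zero M (v z)) ->
  exists h : smooth_map X E, forall z, lam (h z) = u z /\ q (h z) = v z.
Proof.
move=> ub uv; have [_ univ] := pb.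
have [|h [[lh qh] _]] := univ X u v.
  by apply: smooth_map_ext => z /=; congr pair; [exact: ub|exact: uv].
by exists h => z; split; [exact: smooth_map_eq lh z|exact: smooth_map_eq qh z].
Qed.

Lemma lam_inj e e' : lam e = lam e' -> e = e'.
Proof.
move=> ee'; apply: (pullback_inj pb ee').
by rewrite -(qxi (q e)) -lam_base ee' lam_base qxi.
Qed.

Lemma lam_surj (t : tangent_bundle E) m : tangent_base t = xi m ->
  tangent_map q t = tangent_zero M m -> exists e, lam e = t /\ q e = m.
Proof.
move=> tb tv; pose pt := euclidean R 0.
have [//|//|h hP] := @lam_lift pt (smooth_map_cst pt t) (smooth_map_cst pt m).
by exists (h 0); exact: hP.
Qed.

Section PullBack.
Variables (A : manifold R) (f : smooth_map A M).
Local Notation KB := (kernel_bundle f qxi).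

(** This map makes the kernel bundle of f the pullback of q along f: lam
    identifies the fibres of q with the vertical tangent spaces at the section. *)
Lemma kernel_bundle_lift : exists b : smooth_map KB E, forall p,
  lam (b p) = kernel_bundle_vector f qxi p /\ q (b p) = f (kernel_bundle_base f qxi p).
Proof.
apply: (lam_lift (u := kernel_bundle_vector f qxi)
  (v := f \os kernel_bundle_base f qxi)) => p.
- by have [] := kernel_bundleP p.
- by have [] := kernel_bundleP p.
Qed.

End PullBack.

(** A point y is transported to the fibre over c by keeping the coordinates of
    the vertical vector lam y. *)
Lemma bundle_submersion : submersion q.
Proof.
move=> y0; have [b bP] := kernel_bundle_lift (smooth_map_id M).
have surj y : exists p : kernel_bundle (smooth_map_id M) qxi,
    kernel_bundle_base _ qxi p = q y /\ kernel_bundle_vector _ qxi p = lam y.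
  apply: kernel_bundle_surj; first exact: lam_base.
  exact: lam_vertical.
have [p0 [p0b p0v]] := surj y0.
have [kappa [sk kb kP]] := kernel_bundle_retract p0.
rewrite p0b p0v in sk kb kP.
pose F (z : prod_manifold M E) : prod_manifold M (tangent_bundle E) := (z.1, lam z.2).
have sF z : smooth_at F z.
  apply: smooth_at_pair; first exact: smooth_at_fst.
  exact: smooth_at_comp (smooth_at_snd z) (smooth_map_at lam _).
have skF : smooth_at (kappa \o F) (q y0, y0) by exact: smooth_at_comp (sF (q y0, y0)) sk.
exists (b \o (kappa \o F)); split.
- exact: smooth_at_comp skF (smooth_map_at b _).
- apply: filterS (near_smooth (sF (q y0, y0)) kb) => z zb.
  by rewrite /= (bP _).2 zb.
- have sG : smooth_at (fun y => (q y, y) : prod_manifold M E) y0.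
    exact: smooth_at_pair (smooth_map_at q _) (smooth_at_id _).
  have nk := near_smooth sG (near_smooth (sF (q y0, y0)) kP).
  apply: filterS nk => y yP; have [p [pb' pv]] := surj y.
  by rewrite /= (yP p pb' pv); apply: lam_inj; rewrite (bP p).1.
Qed.

(** The retraction of TE onto the vertical vectors at the section, followed by
    the identification of these with E. It stands in for the universal property of
    lam when a map is only defined locally. *)
Lemma lam_left_inverse e0 : exists rho : tangent_bundle E -> E,
  smooth_at rho (lam e0) /\
  \forall t \near lam e0, forall e, lam e = t -> rho t = e.
Proof.
have [b bP] := kernel_bundle_lift (smooth_map_id M).
have surj y : exists p : kernel_bundle (smooth_map_id M) qxi,
    kernel_bundle_base _ qxi p = q y /\ kernel_bundle_vector _ qxi p = lam y.
  apply: kernel_bundle_surj; first exact: lam_base.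
  exact: lam_vertical.
have [p0 [p0b p0v]] := surj e0.
have [kappa [sk kb kP]] := kernel_bundle_retract p0.
rewrite p0b p0v in sk kP.
pose F (t : tangent_bundle E) : prod_manifold M (tangent_bundle E) :=
  ((q \os tangent_proj E) t, t).
have sF t : smooth_at F t.
  exact: smooth_at_pair (smooth_map_at _ _) (smooth_at_id _).
have F0 : F (lam e0) = (q e0, lam e0) by rewrite /F /= lam_base qxi.
rewrite -F0 in sk kP.
exists (b \o (kappa \o F)); split.
  exact: smooth_at_comp (smooth_at_comp (sF _) sk) (smooth_map_at b _).
apply: filterS (near_smooth (sF (lam e0)) kP) => t tP e et.
have [p [pb' pv]] := surj e.
rewrite /= (tP p) /= -?et ?lam_base ?qxi//.
by apply: lam_inj; rewrite (bP p).1.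
Qed.

Lemma tangent_lam_inj (t u : tangent_bundle E) :
  tangent_map lam t = tangent_map lam u -> t = u.
Proof.
move=> tu; have bE : tangent_base t = tangent_base u.
  by apply: lam_inj; have := congr1 (@tangent_base _ _) tu.
have [rho [srho rhoE]] := lam_left_inverse (tangent_base t).
have left (w : tangent_bundle E) : tangent_base w = tangent_base t ->
    tangent_fun rho (tangent_map lam w) = w.
  move=> wt; rewrite -wt in srho rhoE.
  rewrite -(@tangent_fun_comp _ _ _ _ rho lam w (smooth_map_at lam _) srho).
  have n1 : \forall y \near tangent_base w, (rho \o lam) y = y.
    by apply: filterS (near_smooth (smooth_map_at lam _) rhoE) => y; exact.
  rewrite (tangent_fun_ext _ n1) ?tangent_fun_id//.
  exact: smooth_at_comp (smooth_map_at lam _) srho.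
by rewrite -[LHS]left// -[RHS]left ?tu.
Qed.

(** The pullback is realized by the kernel bundle of f, which unlike a subset of
    A x E has evident charts. *)
Lemma bundle_pullback (A : manifold R) (f : smooth_map A M) :
  exists P (a : smooth_map P A) (b : smooth_map P E), submersive_square a b f q.
Proof.
have [b bP] := kernel_bundle_lift f.
exists (kernel_bundle f qxi), (kernel_bundle_base f qxi), b; split.
- by move=> p; rewrite (bP p).2.
- move=> x y xy.
  have [|//|p [pa pv]] := @kernel_bundle_surj _ _ _ _ q xi f qxi x (lam y).
  + by rewrite lam_base xy.
  + by rewrite lam_vertical xy.
  + by exists p; split => //; apply: lam_inj; rewrite (bP p).1.
- move=> p0; have [kappa [sk _ kP]] := kernel_bundle_retract p0.
  rewrite -(bP p0).1 in sk kP.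
  pose F (z : prod_manifold A E) : prod_manifold A (tangent_bundle E) := (z.1, lam z.2).
  have sF z : smooth_at F z.
    apply: smooth_at_pair; first exact: smooth_at_fst.
    exact: smooth_at_comp (smooth_at_snd z) (smooth_map_at lam _).
  exists (kappa \o F); first exact: smooth_at_comp (sF (kernel_bundle_base f qxi p0, b p0)) sk.
  apply: filterS (near_smooth (sF (kernel_bundle_base f qxi p0, b p0)) kP) => z zP p pa pb'.
  by apply: zP => //; rewrite -(bP p).1 pb'.
- exact: bundle_submersion.
Qed.

Section FibreSquare.
Variables (E2 : manifold R) (pi0 pi1 : smooth_map E2 E).
Hypothesis sq : submersive_square pi0 pi1 q q.

Lemma lam_base2 z : tangent_base (lam (pi0 z)) = tangent_base (lam (pi1 z)).
Proof. by rewrite !lam_base (square_comm sq). Qed.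

(** The linear structure of the fibres of q is transported along lam from the
    vertical tangent spaces. *)
Lemma fibre_combination (a b : R) : exists h : smooth_map E2 E, forall z,
  lam (h z) = tcomb a b (lam (pi0 z)) (lam (pi1 z)) /\ q (h z) = q (pi0 z).
Proof.
have su : smooth (fun z => tcomb a b (lam (pi0 z)) (lam (pi1 z))).
  apply: smooth_at_smooth => z; apply: smooth_at_tcomb.
  - exact: (smooth_map_at (lam \os pi0)).
  - exact: (smooth_map_at (lam \os pi1)).
  - by apply: nearW => y; exact: lam_base2.
apply: (lam_lift (u := SmoothMap su) (v := q \os pi0)) => z.
  exact: lam_base.
rewrite [LHS]/= tangent_fun_tcomb; [|exact: smooth_map_at|exact: lam_base2].
have /= -> := lam_vertical (pi0 z); have /= -> := lam_vertical (pi1 z).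
exact: tcomb0.
Qed.

Variable plus : smooth_map E2 E.
Hypothesis plusE : forall z, lam (plus z) = tcomb 1 1 (lam (pi0 z)) (lam (pi1 z)).

Lemma q_plus z : q (plus z) = q (pi0 z).
Proof. by rewrite -(qxi (q (plus z))) -lam_base plusE /= lam_base qxi. Qed.

(** The laws of the addition thereby become identities between tangent vectors. *)
Lemma addition_ofP X (a b s : smooth_map X E) :
  addition_of pi0 pi1 plus a b s <->
  (forall z, q (a z) = q (b z)) /\
  (forall z, lam (s z) = tcomb 1 1 (lam (a z)) (lam (b z))).
Proof.
split=> [[h [<- <- ->]]|[qab sE]].
  by split=> z; [exact: square_comm sq (h z)|exact: plusE].
have [h hP] := square_lift sq qab; exists h; split; apply: smooth_map_ext => z.
- by have [] := hP z.
- by have [] := hP z.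
- by apply: lam_inj; rewrite sE /= plusE; have [-> ->] := hP z.
Qed.

Lemma bundle_additive : additive_bundle q xi pi0 pi1 plus.
Proof.
split.
- by apply: smooth_map_ext => z; exact: q_plus.
- exact: pre_differential_section pre.
- move=> X a b c ab bc s /addition_ofP[qab abE] /addition_ofP[qbc bcE].
  move=> /addition_ofP[_ sE]; apply/addition_ofP; split=> z.
    by rewrite -[RHS]qxi -lam_base bcE /= lam_base qxi.
  by rewrite sE abE bcE tcombA// !lam_base -?qbc ?qab.
- move=> X a b s /addition_ofP[qab sE]; apply/addition_ofP; split=> z //.
  by rewrite sE tcombC// !lam_base qab.
- move=> X a; apply/addition_ofP; split=> z; first exact: qxi.
  by rewrite /= lam_section -lam_base tcomb0l.
Qed.

Lemma lam_additive_proj :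
  additive_morphism q xi (addition_of pi0 pi1 plus) (tangent_proj E)
    (tangent_zero E) (@tangent_addition R E) lam xi.
Proof.
split.
- exact: pre_differential_proj pre.
- move=> X a b s /addition_ofP[qab sE] z; set t := lam (a z).
  exists (tangent_base t), (tangent_vec t),
    (tangent_coord (chart_at E (tangent_base t)) (lam (b z))).
  split; first by rewrite /= -/t; case: t.
    by apply: tangent_vectorE; rewrite !lam_base qab.
  by rewrite /= sE /tcomb !scale1r.
- exact: pre_differential_zero pre.
Qed.

Let sqT := submersive_square_tangent sq.

(** T(lam) is injective, so the two sides may be compared after applying it; by
    coassociativity T(lam) lam is the lift TE -> T(TE) after lam, and the lift is
    additive since in coordinates it is v |-> (0, v). *)
Lemma lam_additive_tangent :
  additive_morphism q xi (addition_of pi0 pi1 plus) (tangent_map q)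
    (tangent_map xi)
    (addition_of (tangent_map pi0) (tangent_map pi1) (tangent_map plus))
    lam (tangent_zero M).
Proof.
split.
- by apply: smooth_map_ext => e; exact: lam_vertical.
- move=> X a b s /addition_ofP[qab sE].
  have [|h hP] := square_lift sqT (u := lam \os a) (v := lam \os b).
    by move=> z; rewrite /= -![tangent_fun _ _]/(tangent_map q _) !lam_vertical qab.
  exists h; split; apply: smooth_map_ext => z.
  + by have [] := hP z.
  + by have [] := hP z.
  have [h0 h1] : tangent_map pi0 (h z) = lam (a z) /\
      tangent_map pi1 (h z) = lam (b z) := hP z.
  have coassoc e : tangent_map lam (lam e) = tangent_lift E (lam e).
    exact: esym (smooth_map_eq (pre_differential_coassoc pre) e).
  apply: tangent_lam_inj; rewrite [in RHS]/=.
  rewrite -[tangent_fun plus _]/(tangent_map plus _).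
  rewrite [RHS]tangent_map_comp [LHS]coassoc.
  have -> : lam \o plus = fun w => tcomb 1 1 (lam (pi0 w)) (lam (pi1 w)).
    by apply/funext => w; exact: plusE.
  set n := tangent_base (h z).
  have n0 : pi0 n = xi (q (a z)).
    by have := congr1 (@tangent_base _ _) h0; rewrite /= lam_base.
  have n1 : pi1 n = xi (q (a z)).
    by have := congr1 (@tangent_base _ _) h1; rewrite /= lam_base -qab.
  have qs : q (s z) = q (a z) by rewrite -(qxi (q (s z))) -lam_base sE /= lam_base qxi.
  pose i := chart_at E (xi (q (a z))).
  have it e : q e = q (a z) -> tangent_dom i (lam e).
    by move=> qe; rewrite /tangent_dom /= lam_base qe; exact: chart_at_dom.
  apply: (@tangent_inj _ (tangent_bundle E) i).
  + exact: it.
  + by rewrite /= -/n n0 n1 lam_section tcomb0 lam_base qs.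
  have in0 : tangent_dom i (lam (pi0 n)) by apply: it; rewrite n0 qxi.
  have near0 : \forall w \near n, tangent_base (lam (pi0 w)) = tangent_base (lam (pi1 w)).
    by apply: nearW; exact: lam_base2.
  have eqc := tangent_fun_comb_coord 1 1 (smooth_map_at (lam \os pi0) n)
    (smooth_map_at (lam \os pi1) n) near0 in0.
  refine (etrans _ (esym eqc)).
  have c0 : tangent_fun (lam \os pi0) (h z) = tangent_lift E (lam (a z)).
    by rewrite -coassoc -h0 tangent_map_comp.
  have c1 : tangent_fun (lam \os pi1) (h z) = tangent_lift E (lam (b z)).
    by rewrite -coassoc -h1 tangent_map_comp.
  rewrite c0 c1 !tangent_lift_coord; try exact: it.
  have ab : tangent_base (lam (a z)) = tangent_base (lam (b z)) by rewrite !lam_base qab.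
  by rewrite row_mxKl !row_mxKr sE (tcomb_coord _ _ (it _ erefl) ab).
- by apply: smooth_map_ext => m; rewrite /= tangent_fun0 lam_section.
Qed.

(** The vector mu (a, b) sits at b, and a is its vertical part translated to the
    zero section. For a vertical vector u at b, the translation is T(sub)(u, 0_b),
    where sub is the subtraction of the fibres; it is vertical at the zero section,
    hence of the form lam a. *)
Lemma universal_square : exists2 mu : smooth_map E2 (tangent_bundle E),
  addition_of (tangent_map pi0) (tangent_map pi1) (tangent_map plus)
    (lam \os pi0) (tangent_zero E \os pi1) mu &
  is_T_pullback mu (q \os pi0) (tangent_map q) (tangent_zero M).
Proof.
have [|h hP] := square_lift sqT (u := lam \os pi0) (v := tangent_zero E \os pi1).
  move=> z; rewrite /= tangent_fun0 -(square_comm sq).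
  exact: lam_vertical.
have h0 z : tangent_map pi0 (h z) = lam (pi0 z) by have [] := hP z.
have h1 z : tangent_map pi1 (h z) = tangent_zero E (pi1 z) by have [] := hP z.
exists (tangent_map plus \os h).
  by exists h; split => //; apply: smooth_map_ext => z; have [] := hP z.
apply: is_T_pullback_sym; apply: submersive_square_T_pullback.
have sbP z : q (xi (q z)) = q z by exact: qxi.
have [sigma sigmaP] := square_lift sq (u := xi \os q) (v := smooth_map_id E) sbP.
have sigma0 e : pi0 (sigma e) = xi (q e) by have [] := sigmaP e.
have sigma1 e : pi1 (sigma e) = e by have [] := sigmaP e.
have plus_sigma e : plus (sigma e) = e.
  by apply: lam_inj; rewrite plusE sigma0 sigma1 lam_section -lam_base tcomb0l.
(* lam (pi0 z) sits at zero, so h z sits at the point (0, pi1 z) of E2 *)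
have base_h z : tangent_base (h z) = sigma (pi1 z).
  apply: (square_inj sq); rewrite ?sigma0 ?sigma1.
    by have := congr1 (@tangent_base _ _) (h0 z); rewrite /= lam_base (square_comm sq).
  by have := congr1 (@tangent_base _ _) (h1 z).
have base_mu z : tangent_base ((tangent_map plus \os h) z) = pi1 z.
  by rewrite /= base_h plus_sigma.
have T_plus_vertical z : tangent_map q ((tangent_map plus \os h) z) =
    tangent_zero M (q (pi0 z)).
  have -> : (tangent_map plus \os h) z = tangent_map plus (h z) by [].
  rewrite tangent_map_comp (_ : q \o plus = q \o pi0); last first.
    by apply/funext => w; exact: q_plus.
  by rewrite -tangent_map_comp h0 lam_vertical.
split.
- by move=> z; rewrite T_plus_vertical.
- move=> m u mu; pose b := tangent_base u.
  have qb : q b = m by have := congr1 (@tangent_base _ _) mu.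
  have [sub subP] := fibre_combination 1 (-1).
  have [w [w0 w1]] : exists w, tangent_map pi0 w = u /\
      tangent_map pi1 w = tangent_zero E b.
    apply: (square_surj sqT); rewrite -mu -qb.
    by rewrite /= tangent_fun0.
  have base_w0 : pi0 (tangent_base w) = b by have := congr1 (@tangent_base _ _) w0.
  have base_w1 : pi1 (tangent_base w) = b by have := congr1 (@tangent_base _ _) w1.
  (* a is the vertical part of u translated to the zero section *)
  have [a [la qa]] : exists a, lam a = tangent_map sub w /\ q a = m.
    apply: lam_surj.
      apply: lam_inj; rewrite /= (subP _).1 base_w0 base_w1 tcombv.
      by rewrite lam_section lam_base qb.
    rewrite tangent_map_comp (_ : q \o sub = q \o pi0); last first.
      by apply/funext => y; exact: (subP y).2.
    by rewrite -tangent_map_comp w0 -mu.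
  have [z [z0 z1]] : exists z, pi0 z = a /\ pi1 z = b.
    by apply: (square_surj sq); rewrite qa qb.
  exists z; split; first by rewrite /= z0.
  have qsub y : q (sub y) = q (pi1 y) by rewrite (subP y).2; exact: square_comm sq y.
  have [beta betaP] := square_lift sq qsub.
  have hE : h z = tangent_map beta w.
    apply: (square_inj sqT).
      rewrite h0 z0 la tangent_map_comp.
      by congr tangent_fun; apply/funext => y; have [] := betaP y.
    rewrite h1 z1 -w1 tangent_map_comp.
    by congr tangent_fun; apply/funext => y; have [] := betaP y.
  have -> : (tangent_map plus \os h) z = tangent_map plus (h z) by [].
  rewrite hE tangent_map_comp -w0; congr tangent_fun; apply/funext => y.
  have [b0 b1] := betaP y; apply: lam_inj.
  by rewrite /= plusE b0 b1 (subP y).1 tcombK// lam_base2.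
- move=> z0; pose u0 := (tangent_map plus \os h) z0; pose b0 := pi1 z0.
  pose n0 := sigma b0; pose i := chart_at E (xi (q b0)).
  have [rho1 [srho1 rho1P]] := lam_left_inverse (pi0 n0).
  have [rho2 [srho2 rho2P]] := lam_left_inverse (pi0 z0).
  have [kap skap kapP] := square_retract sq z0.
  have i0 : tangent_dom i (lam (plus n0)).
    by rewrite /tangent_dom /= plus_sigma lam_base; exact: chart_at_dom.
  have i1 : tangent_dom i (lam (pi1 n0)).
    by rewrite /tangent_dom /= sigma1 lam_base; exact: chart_at_dom.
  have bp z : tangent_base (lam (plus z)) = tangent_base (lam (pi1 z)).
    by rewrite plusE; exact: lam_base2.
  have subE z : tcomb 1 (-1) (lam (plus z)) (lam (pi1 z)) = lam (pi0 z).
    by rewrite plusE tcombDK// lam_base2.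
  (* rho1 \o D extends the subtraction of E2 to a neighbourhood in E x E *)
  pose D (z : prod_manifold E E) : tangent_bundle E :=
    chart_comb i 1 (-1) (lam z.1) (lam z.2).
  pose p0 : prod_manifold E E := (plus n0, pi1 n0).
  have sD : smooth_at D p0.
    apply: smooth_at_chart_comb => //.
      exact: smooth_at_comp (smooth_at_fst p0) (smooth_map_at lam _).
    exact: smooth_at_comp (smooth_at_snd p0) (smooth_map_at lam _).
  have D0 : D p0 = lam (pi0 n0).
    exact: etrans (chart_combE 1 (-1) i0 (bp n0)) (subE n0).
  have sS : smooth_at (rho1 \o D) p0 by apply: (smooth_at_comp sD); rewrite D0.
  pose pm (z : E2) : prod_manifold E E := (plus z, pi1 z).
  have spm z : smooth_at pm z by exact: smooth_at_pair_map.
  have SE : \forall z \near n0, (rho1 \o D) (pm z) = pi0 z.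
    have n1 : \forall z \near n0, tangent_dom i (lam (plus z)).
      apply: (near_smooth (smooth_map_at (lam \os plus) n0)).
      exact: (@chart_dom_nbhs _ (tangent_bundle E) i).
    have n2 := near_smooth (smooth_map_at (lam \os pi0) n0) rho1P.
    apply: filterS2 n1 n2 => z iz rz.
    by rewrite /= /D /= chart_combE// subE; exact: rz.
  (* G u recovers lam (pi0 z) from u = mu z *)
  pose G (u : tangent_bundle E) : tangent_bundle E :=
    tangent_fun (rho1 \o D) (tpair u (tangent_zero E (tangent_base u))).
  pose P (u : tangent_bundle E) : prod_manifold (tangent_bundle E) (tangent_bundle E) :=
    (u, (tangent_zero E \os tangent_proj E) u).
  have sP u : smooth_at P u.
    exact: smooth_at_pair (smooth_at_id u) (smooth_map_at _ u).
  have base_u0 : tangent_base u0 = b0 by exact: base_mu.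
  have p0E : p0 = (tangent_base u0, tangent_base u0).
    by rewrite /p0 plus_sigma sigma1 base_u0.
  have sG : smooth_at G u0.
    have sS' : smooth_at (rho1 \o D) (tangent_base (P u0).1, tangent_base (P u0).2).
      by rewrite -[X in smooth_at _ X]p0E.
    exact: smooth_at_comp (sP u0) (smooth_at_tangent_pair sS').
  have nG : \forall u \near u0, forall z,
      (tangent_map plus \os h) z = u -> G u = lam (pi0 z).
    have sigma_b := smooth_map_at (sigma \os tangent_proj E) u0.
    have n0E : n0 = (sigma \os tangent_proj E) u0.
      by rewrite -[RHS]/(sigma (tangent_base u0)) base_u0.
    have n1 : \forall u \near u0, \forall z \near sigma (tangent_base u),
        (rho1 \o D) (pm z) = pi0 z.
      have m1 : \forall n \near (sigma \os tangent_proj E) u0, \forall z \near n,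
          (rho1 \o D) (pm z) = pi0 z by rewrite -n0E; exact: near_near.
      exact: near_smooth sigma_b m1.
    have n2 : \forall u \near u0, smooth_at (rho1 \o D) (pm (sigma (tangent_base u))).
      have m2 : \forall n \near (sigma \os tangent_proj E) u0,
          smooth_at (rho1 \o D) (pm n).
        by rewrite -n0E; exact: near_smooth (spm n0) (smooth_at_near sS).
      exact: near_smooth sigma_b m2.
    apply: filterS2 n1 n2 => u e1 s1 z zu.
    have bu : tangent_base u = pi1 z by rewrite -zu base_mu.
    have bh : tangent_base (h z) = sigma (tangent_base u) by rewrite base_h bu.
    rewrite -bh in e1 s1.
    rewrite -h0 /G bu -h1 -zu.
    have -> : (tangent_map plus \os h) z = tangent_map plus (h z) by [].
    rewrite -(tangent_fun_pair (smooth_map_at plus _) (smooth_map_at pi1 _)).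
    rewrite -tangent_fun_comp//.
    apply: (tangent_fun_ext _ e1); exact: smooth_at_comp (spm _) s1.
  have G0 : G u0 = lam (pi0 z0) by exact: (nbhs_singleton nG).
  pose A := prod_manifold M (tangent_bundle E).
  pose H (v : A) : prod_manifold E E := (rho2 (G v.2), tangent_base v.2).
  pose v0 : A := ((q \os pi0) z0, u0).
  have sGv : smooth_at (fun v : A => G v.2) v0.
    exact: smooth_at_comp (smooth_at_snd v0) sG.
  have sH : smooth_at H v0.
    apply: smooth_at_pair; last first.
      exact: smooth_at_comp (smooth_at_snd v0) (smooth_map_at (tangent_proj E) _).
    by apply: (smooth_at_comp sGv); rewrite -[G v0.2]/(G u0) G0.
  have H0 : H v0 = (pi0 z0, pi1 z0).
    by rewrite -[LHS]/(rho2 (G u0), tangent_base u0) G0 ((nbhs_singleton rho2P) _ erefl) base_u0.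
  exists (kap \o H).
    by apply: (smooth_at_comp sH); rewrite H0.
  have n1 : \forall v \near v0, forall e, lam e = G v.2 -> rho2 (G v.2) = e.
    have rho2P' : \forall t \near G v0.2, forall e, lam e = t -> rho2 t = e.
      by rewrite -[G v0.2]/(G u0) G0.
    exact: near_smooth sGv rho2P'.
  have n2 : \forall v \near v0, forall z,
      (tangent_map plus \os h) z = v.2 -> G v.2 = lam (pi0 z).
    exact: near_smooth (smooth_at_snd v0) nG.
  have n3 : \forall v \near v0, forall z,
      pi0 z = (H v).1 -> pi1 z = (H v).2 -> kap (H v) = z.
    have kapP' : \forall w \near H v0, forall z,
        pi0 z = w.1 -> pi1 z = w.2 -> kap w = z by rewrite H0.
    exact: near_smooth sH kapP'.
  apply: filterS3 n1 n2 n3 => v e1 e2 e3 z _ zv.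
  apply: e3; rewrite /H /=.
    by rewrite (e1 (pi0 z))// (e2 z).
  by rewrite -zv base_mu.
- exact: submersion_tangent bundle_submersion.
Qed.

End FibreSquare.

End FromPullback.

(** * From the universal square to the pullback square *)

(** Here mu (a, b) sits at b and mu (a, 0) = lam a by the unit laws. So a vertical
    vector at the zero section, being of the form mu (a, b), is lam a. *)
Lemma differential_bundle_pullback (R : realType) (E M : manifold R)
    (q : smooth_map E M) (xi : smooth_map M E)
    (lam : smooth_map E (tangent_bundle E)) :
  pre_differential_bundle q xi lam -> differential_bundle q xi lam ->
  is_pullback lam q
    (smooth_map_pair (tangent_proj E) (tangent_map q))
    (smooth_map_pair xi (tangent_zero M)).
Proof.
move=> pre [_ [E2 [pi0 [pi1 [plus [pb2 add lamT _ [mu [k [k0 k1 muE]] pbmu]]]]]]].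
have qxi m : q (xi m) = m by exact: smooth_map_eq (pre_differential_section pre) m.
have lamb e : tangent_base (lam e) = xi (q e).
  exact: smooth_map_eq (pre_differential_proj pre) e.
have lamv e : tangent_map q (lam e) = tangent_zero M (q e).
  exact: smooth_map_eq (additive_morphism_square lamT) e.
have inj2 z z' : pi0 z = pi0 z' -> pi1 z = pi1 z' -> z = z'.
  exact: pullback_inj (pb2 0%N).
have injT w w' : tangent_map pi0 w = tangent_map pi0 w' ->
    tangent_map pi1 w = tangent_map pi1 w' -> w = w'.
  exact: pullback_inj (pb2 1%N).
have {}k0 z : tangent_map pi0 (k z) = lam (pi0 z) by exact: smooth_map_eq k0 z.
have {}k1 z : tangent_map pi1 (k z) = tangent_zero E (pi1 z) by exact: smooth_map_eq k1 z.
have {}muE z : mu z = tangent_map plus (k z) by exact: smooth_map_eq muE z.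
have qpi z : q (pi0 z) = q (pi1 z).
  by have [c _] := pb2 0%N; exact: smooth_map_eq c z.
(* j e = (e, 0): the right unit law, whose image under T turns mu into lam *)
have [j [j0 j1 jE]] := additive_comm add (additive_unit add (smooth_map_id E)).
have {}j0 e : pi0 (j e) = e by exact: smooth_map_eq j0 e.
have {}j1 e : pi1 (j e) = xi (q e) by exact: smooth_map_eq j1 e.
have {}jE : plus \o j = id.
  by apply/funext => e; exact: esym (smooth_map_eq jE e).
have muj e : mu (j e) = lam e.
  rewrite muE; have -> : k (j e) = tangent_map j (lam e).
    apply: injT; rewrite ?k0 ?k1 tangent_map_comp.
      have -> : pi0 \o j = id by apply/funext => x; exact: j0.
      by rewrite tangent_fun_id j0.
    have -> : pi1 \o j = xi \o q by apply/funext => x; exact: j1.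
    by rewrite -tangent_map_comp lamv /= tangent_fun0 j1.
  by rewrite tangent_map_comp jE tangent_fun_id.
(* i e = (0, e): the left unit law locates the vector mu z at pi1 z *)
have [i [i0 i1 iE]] := additive_unit add (smooth_map_id E).
have mub z : tangent_base (mu z) = pi1 z.
  have -> : tangent_base (mu z) = plus (tangent_base (k z)) by rewrite muE.
  have -> : tangent_base (k z) = i (pi1 z).
    apply: inj2.
      rewrite [RHS](smooth_map_eq i0 (pi1 z)) /= -qpi -lamb.
      by have := congr1 (@tangent_base _ _) (k0 z).
    rewrite [RHS](smooth_map_eq i1 (pi1 z)).
    by have := congr1 (@tangent_base _ _) (k1 z).
  exact: esym (smooth_map_eq iE (pi1 z)).
split.
  apply: smooth_map_ext => e /=; congr pair; first exact: lamb.
  exact: lamv.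
move=> X u v uv.
have ub z : tangent_base (u z) = xi (v z).
  exact: (congr1 (fun w : E * tangent_bundle M => w.1) (smooth_map_eq uv z)).
have uq : tangent_map q \os u = tangent_zero M \os v.
  apply: smooth_map_ext => z.
  exact: (congr1 (fun w : E * tangent_bundle M => w.2) (smooth_map_eq uv z)).
have [_ univ] := pbmu 0%N; have [h [[hu hv] huniq]] := univ X u v uq.
have {}hu z : mu (h z) = u z by exact: smooth_map_eq hu z.
have {}hv z : q (pi0 (h z)) = v z by exact: smooth_map_eq hv z.
have hj z : h z = j (pi0 (h z)).
  by apply: inj2; rewrite ?j0 ?j1// hv -ub -hu mub.
exists (pi0 \os h); split.
  split; apply: smooth_map_ext => z; last exact: hv.
  by rewrite /= -muj -hj hu.
move=> a [la qa]; have aE : h = j \os a.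
  apply: huniq; split; apply: smooth_map_ext => z.
    by rewrite /= muj; exact: smooth_map_eq la z.
  by rewrite /= j0; exact: smooth_map_eq qa z.
by apply: smooth_map_ext => z; rewrite aE /= j0.
Qed.

(** * The equivalence *)

Lemma pullback_differential_bundle (R : realType) (E M : manifold R)
    (q : smooth_map E M) (xi : smooth_map M E)
    (lam : smooth_map E (tangent_bundle E)) :
  pre_differential_bundle q xi lam ->
  is_pullback lam q
    (smooth_map_pair (tangent_proj E) (tangent_map q))
    (smooth_map_pair xi (tangent_zero M)) ->
  differential_bundle q xi lam.
Proof.
move=> pre pb; split.
  apply: T_fibre_powers => A f; have [P [a [b sq]]] := bundle_pullback pre pb f.
  by exists P, a, b; exact: submersive_square_T_pullback.
have [E2 [pi0 [pi1 sq]]] := bundle_pullback pre pb q.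
have [plus plusP] := fibre_combination pre pb sq 1 1.
have plusE z : lam (plus z) = tcomb 1 1 (lam (pi0 z)) (lam (pi1 z)).
  by have [] := plusP z.
exists E2, pi0, pi1, plus; split.
- exact: submersive_square_T_pullback.
- exact: (bundle_additive pre pb sq plusE).
- exact: (lam_additive_tangent pre pb sq plusE).
- exact: (lam_additive_proj pre pb sq plusE).
- exact: (universal_square pre pb sq plusE).
Qed.

Theorem corollary3p3p9 (R : realType) (E M : manifold R)
    (q : smooth_map E M) (xi : smooth_map M E)
    (lam : smooth_map E (tangent_bundle E))
    (hpre : pre_differential_bundle q xi lam) :
  differential_bundle q xi lam <->
  is_pullback lam q
    (smooth_map_pair (tangent_proj E) (tangent_map q))
    (smooth_map_pair xi (tangent_zero M)).
Proof.
split; first exact: differential_bundle_pullback.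
exact: pullback_differential_bundle.
Qed.
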